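(* For any non-Riemannian power law Berwald metric $$L=\vartheta(t,r)\,u^{2-2\lambda}\left(v+\rho u^2\right)^{\lambda}$$ (as defined in the context, with the attached functions $a_i$, vector fields $\delta_a$ and holonomy distribution $\mathcal{D}_{\mathcal{H}}$), the following hold: 1. $a_5\neq0$ (equivalently, $[\delta_t,\delta_r]\notin\mathrm{Span}\{\dot\partial_t,\dot\partial_r\}$). 2. $\dim\mathcal{V}(\mathcal{D}_{\mathcal{H}})=3$. 3. There is no pseudo-Riemannian metric affinely equivalent to $L$.
   Context: $M\subset\mathbb{R}^4\setminus\{0\}$ is open, with spherical coordinates $(x^a)=(t,r,\theta,\phi)$; $(x^a,\dot x^a)$ are the induced coordinates on $TM$, $\partial_a=\partial/\partial x^a$, $\dot\partial_a=\partial/\partial\dot x^a$, $w^2=\dot\theta^2+\dot\phi^2\sin^2\theta$. A conic subbundle is an open $\mathcal{A}\subset TM\setminus0$ projecting onto $M$ and stable under positive rescaling of vectors. A (pseudo-)Finsler function is a smooth $L:\mathcal{A}\to\mathbb{R}$, positively 2-homogeneous in $\dot x$, with nonsingular Hessian $g_{ab}=\frac12\dot\partial_a\dot\partial_bL$ (any signature). It is (pseudo-)Riemannian if $L=a_{ab}(x)\dot x^a\dot x^b$, non-Riemannian otherwise. With $G^a=\frac14g^{ab}(\dot x^c\partial_c\dot\partial_bL-\partial_bL)$, $L$ is Berwald if $2G^c=\Gamma^c_{ab}(x)\dot x^a\dot x^b$ for a torsion-free affine connection $\nabla$ on $M$ (its canonical connection). Two Berwald metrics are affinely equivalent if they have the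 same canonical connection (for a pseudo-Riemannian metric this is the Levi-Civita connection). $\delta_a=\partial_a-\Gamma^c_{ab}\dot x^b\dot\partial_c$; $\mathcal{D}_{\mathcal{H}}=\mathrm{Span}\{\delta_a,[\delta_a,\delta_b],[\delta_a,[\delta_b,\delta_c]],\dots\}=\mathrm{Span}\{\delta_a\}\oplus\mathcal{V}(\mathcal{D}_{\mathcal{H}})$ on $\mathcal{A}$, where $\mathcal{V}(\mathcal{D}_{\mathcal{H}})\subset\mathrm{Span}\{\dot\partial_a\}$ is the vertical part; dimension means fibre dimension. $L$ is spatially spherically symmetric if $L=L(t,r,\dot t,\dot r,w)$ (invariance under $SO(3)$ rotations fixing $t$). Its canonical connection has the coefficients, with $k_i=k_i(t,r)$: $\Gamma^t_{tt}=k_1$, $\Gamma^t_{tr}=k_2$, $\Gamma^t_{rr}=k_3$, $\Gamma^r_{tt}=k_4$, $\Gamma^r_{rr}=k_5$, $\Gamma^r_{tr}=k_6$, $\Gamma^t_{\theta\theta}=\Gamma^t_{\phi\phi}/\sin^2\theta=k_7$, $\Gamma^\phi_{\phi t}=\Gamma^\theta_{\theta t}=k_8$, $\Gamma^\phi_{\phi r}=\Gamma^\theta_{\theta r}=k_9$, $\Gamma^r_{\theta\theta}=\Gamma^r_{\phi\phi}/\sin^2\theta=k_{10}$, $\Gamma^\theta_{\phi\phi}=-\sin\theta\cos\theta$, $\Gamma^\phi_{\theta\phi}=\cot\theta$, the remaining ones (up to lower-index symmetry) being zero. Curvature functions (commas are partial derivatives): $a_1=k_{1,r}-k_{2,t}+k_3k_4-k_2k_6$,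 $a_2=k_{2,r}-k_{3,t}+k_2^2+k_3k_6-k_1k_3-k_2k_5$, $a_3=k_{4,r}-k_{6,t}+k_1k_6+k_4k_5-k_2k_4-k_6^2$, $a_4=k_{6,r}-k_{5,t}+k_2k_6-k_3k_4$, $a_5=k_{8,r}-k_{9,t}$, $a_6=-k_{7,t}+k_7k_8-k_1k_7-k_2k_{10}$, $a_7=-k_{10,t}+k_8k_{10}-k_4k_7-k_6k_{10}$, $a_8=-k_{8,t}+k_1k_8+k_4k_9-k_8^2$, $a_9=-k_{9,t}+k_2k_8+k_6k_9-k_8k_9$, $a_{10}=-k_{7,r}+k_7k_9-k_2k_7-k_3k_{10}$, $a_{11}=-k_{10,r}+k_9k_{10}-k_6k_7-k_5k_{10}$, $a_{12}=-k_{8,r}+k_2k_8+k_6k_9-k_8k_9$, $a_{13}=-k_{9,r}+k_3k_8+k_5k_9-k_9^2$. In particular $[\delta_t,\delta_r]=(a_1\dot t+a_2\dot r)\dot\partial_t+(a_3\dot t+a_4\dot r)\dot\partial_r+a_5\dot\theta\,\dot\partial_\theta+a_5\dot\phi\,\dot\partial_\phi$. Power law Berwald metric (Class 1): a spatially spherically symmetric Berwald metric whose canonical connection has $k_7,\dots,k_{10}$ not all zero, with $k_{10}\neq0$ (the paper's convention); one puts $a=k_7/k_{10}$, $b=k_8/k_{10}$, $c=(k_9k_{10}-k_7k_8)/k_{10}^2$. The connection satisfies that $[\delta_t,[\delta_t,\delta_r]]$ and $[\delta_r,[\delta_t,\delta_r]]$ are proportional to $[\delta_t,\delta_r]$, and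 $b(aa_1+a_2)+(ab+c)(aa_3+a_4)-a_5(2ab+c)=0$, $a(aa_3+a_4)-(aa_1+a_2)=0$, $(ab+c)a_3+b(aa_3+a_4)+b(a_1-2a_5)=0$, $a_6=aa_7$, $a_8=ba_7$, $a_9=(ab+c)a_7$, $a_{10}=aa_{11}$, $a_{12}=ba_{11}$, $a_{13}=(ab+c)a_{11}$. With $D=aa_3-a_1+a_5$, $E=ba_3$, $F=aa_3-a_1$, $G=2(k_1-k_4a)$, $\tilde G=G-2k_8$, $H=2(k_2-k_6a)$, $\tilde H=H-2k_9$, it is required that $D\neq0$, and $L$ is given by the displayed power law formula with $u=\dot t-a\dot r$, $v=c\dot r^2+2b\dot t\dot r-w^2$, $\lambda=F/D$ a constant, $\rho=E/D$, and $\vartheta(t,r)=\exp\left(\int(G-\lambda\tilde G)\,dt+(H-\lambda\tilde H)\,dr\right)$ (integral along an arbitrary path in the $(t,r)$ plane from some $(t_0,r_0)$ to $(t,r)$). The value $\lambda=1$ corresponds to Riemannian metrics, so non-Riemannian means $\lambda\neq1$. *)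

(* Defs.v *)
From HB Require Import structures.
From mathcomp Require Import all_boot all_order all_algebra.
From mathcomp Require Import all_classical all_reals all_analysis.

Set Implicit Arguments.
Unset Strict Implicit.
Unset Printing Implicit Defensive.

Import Order.TTheory GRing.Theory Num.Theory.
Import numFieldNormedType.Exports.

Local Open Scope classical_set_scope.
Local Open Scope ring_scope.

(* The base M is an open subset of the coordinate space 'rV_4, with coordinates
   (x^0, x^1, x^2, x^3) = (t, r, theta, phi); a point of TM is the pair
   (x, xdot). *)
Notation TM4 R := ('rV[R]_4 * 'rV[R]_4)%type.

Definition it : 'I_4 := @Ordinal 4 0 isT.
Definition ir : 'I_4 := @Ordinal 4 1 isT.
Definition ith : 'I_4 := @Ordinal 4 2 isT.
Definition iph : 'I_4 := @Ordinal 4 3 isT.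

Section Calculus.
Context {R : realType}.

(* f is C^n on the open set U: all iterated directional derivatives of order
   at most n exist and are continuous on U. *)
Fixpoint Ck_on (V : normedModType R) (n : nat) (U : set V) (f : V -> R) : Prop :=
  (forall x, U x -> {for x, continuous f}) /\
  if n is m.+1 then
    forall v, (forall x, U x -> derivable f x v) /\ Ck_on m U ('D_v f)
  else True.

Definition smooth_on (V : normedModType R) (U : set V) (f : V -> R) : Prop :=
  forall n, Ck_on n U f.

Definition lspan (V : lmodType R) (S : set V) : set V :=
  [set v | exists n (c : 'I_n -> R) (s : 'I_n -> V),
     (forall i, S (s i)) /\ v = \sum_(i < n) c i *: s i].

Definition has_dim (S : set 'rV[R]_4) (n : nat) : Prop :=
  exists W : {vspace 'rV[R]_4}, S = [set v | v \in W] /\ (\dim W = n)%N.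

(* real_power x p y: "the real number y is x to the real power p". The power is
   defined for x > 0 and, when p = m / n with n odd, also for x < 0, and for
   x = 0 if m >= 0 (with 0 to the 0 equal to 1). *)
Definition real_power (x p y : R) : Prop :=
  (0 < x /\ y = x `^ p) \/
  exists (m : int) (n : nat),
    [/\ odd n, p = m%:~R / n%:R, x != 0 \/ 0 <= m & y ^+ n = x ^ m].

Definition C1_path (U : set (R * R)) (p q : R * R) (g1 g2 : R -> R) : Prop :=
  [/\ (g1 0, g2 0) = p, (g1 1, g2 1) = q,
      forall s, 0 <= s <= 1 -> U (g1 s, g2 s),
      (forall s, derivable g1 s 1) /\ (forall s, derivable g2 s 1) &
      continuous (derive1 g1) /\ continuous (derive1 g2)].

Definition path_integral (P Q : R -> R -> R) (g1 g2 : R -> R) : R :=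
  Rintegral (@lebesgue_measure R) `[0, 1]
    (fun s => P (g1 s) (g2 s) * derive1 g1 s + Q (g1 s) (g2 s) * derive1 g2 s).

End Calculus.

Section Finsler.
Context {R : realType}.
Local Notation TM := (TM4 R).

Definition evec (a : 'I_4) : 'rV[R]_4 := delta_mx 0 a.

Definition par (a : 'I_4) (f : TM -> R) : TM -> R := 'D_(evec a, 0) f.
Definition dotpar (a : 'I_4) (f : TM -> R) : TM -> R := 'D_(0, evec a) f.

Definition conic_subbundle (M : set 'rV[R]_4) (A : set TM) : Prop :=
  [/\ open A,
      forall p, A p -> M p.1 /\ p.2 != 0,
      forall x, M x -> exists y, A (x, y) &
      forall x y (s : R), 0 < s -> A (x, y) -> A (x, s *: y)].

Definition fund_tensor (L : TM -> R) (p : TM) : 'M[R]_4 :=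
  \matrix_(a, b) (2^-1 * dotpar a (dotpar b L) p).

Definition pseudo_finsler (M : set 'rV[R]_4) (A : set TM) (L : TM -> R) : Prop :=
  [/\ conic_subbundle M A,
      smooth_on A L,
      forall x y (s : R), A (x, y) -> 0 < s -> L (x, s *: y) = s ^+ 2 * L (x, y) &
      forall p, A p -> fund_tensor L p \in unitmx].

Definition pseudo_riemannian (A : set TM) (L : TM -> R) : Prop :=
  exists g : 'rV[R]_4 -> 'M[R]_4, forall x y, A (x, y) ->
    L (x, y) = \sum_a \sum_b g x a b * y 0 a * y 0 b.

Definition spray (L : TM -> R) (c : 'I_4) (p : TM) : R :=
  4^-1 * \sum_b invmx (fund_tensor L p) c b *
    (\sum_a p.2 0 a * par a (dotpar b L) p - par b L p).

(* Christoffel symbols: Gam x c a b is Gamma^c_{ab}(x). *)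
Definition christoffel : Type := 'rV[R]_4 -> 'I_4 -> 'I_4 -> 'I_4 -> R.

Definition torsion_free_connection (M : set 'rV[R]_4) (Gam : christoffel) : Prop :=
  (forall c a b, smooth_on M (fun x => Gam x c a b)) /\
  (forall x c a b, M x -> Gam x c a b = Gam x c b a).

Definition canonical_connection (M : set 'rV[R]_4) (A : set TM) (L : TM -> R)
    (Gam : christoffel) : Prop :=
  torsion_free_connection M Gam /\
  forall x y c, A (x, y) ->
    2 * spray L c (x, y) = \sum_a \sum_b Gam x c a b * y 0 a * y 0 b.

Definition affinely_equivalent (M : set 'rV[R]_4) (A : set TM) (L : TM -> R)
    (A' : set TM) (L' : TM -> R) : Prop :=
  exists Gam, canonical_connection M A L Gam /\ canonical_connection M A' L' Gam.

(* A vector field on TM is given by its components with respect to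
   (partial_a, dot partial_a). *)
Definition vfield : Type := TM -> TM.

(* In coordinates [X, Y] is the derivative of Y along X minus that of X along Y. *)
Definition bracket (X Y : vfield) : vfield :=
  fun p => ('D_(X p) Y p : TM) - 'D_(Y p) X p.

Definition delta (Gam : christoffel) (a : 'I_4) : vfield :=
  fun p => (evec a, \row_c (- \sum_b Gam p.1 c a b * p.2 0 b)).

Fixpoint nested_bracket (Gam : christoffel) (a : 'I_4) (s : seq 'I_4) : vfield :=
  if s is b :: s' then bracket (delta Gam a) (nested_bracket Gam b s')
  else delta Gam a.

Definition hol_distribution (Gam : christoffel) (p : TM) : set TM :=
  lspan [set v | exists a s, v = nested_bracket Gam a s p].

Definition vertical_part (S : set TM) : set 'rV[R]_4 := [set y | S (0, y)].

End Finsler.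

Section Spherical.
Context {R : realType}.
Local Notation TM := (TM4 R).

Definition in_spherical_chart (x : 'rV[R]_4) : Prop :=
  0 < x 0 ir /\ 0 < x 0 ith < pi.

(* This is w, with w^2 = thetadot^2 + phidot^2 sin^2 theta. *)
Definition wspeed (x y : 'rV[R]_4) : R :=
  Num.sqrt (y 0 ith ^+ 2 + y 0 iph ^+ 2 * sin (x 0 ith) ^+ 2).

Definition spatially_spherical (A : set TM) (L : TM -> R) : Prop :=
  exists l : R -> R -> R -> R -> R -> R, forall x y, A (x, y) ->
    L (x, y) = l (x 0 it) (x 0 ir) (y 0 it) (y 0 ir) (wspeed x y).

Definition tr_domain (M : set 'rV[R]_4) : set (R * R) :=
  [set q | exists2 x, M x & q = (x 0 it, x 0 ir)].

Record sph_coef : Type := SphCoef {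
  k1 : R -> R -> R; k2 : R -> R -> R; k3 : R -> R -> R; k4 : R -> R -> R;
  k5 : R -> R -> R; k6 : R -> R -> R; k7 : R -> R -> R; k8 : R -> R -> R;
  k9 : R -> R -> R; k10 : R -> R -> R }.

Definition sph_connection (k : sph_coef) : christoffel :=
  fun x c a b =>
    let t := x 0 it in let r := x 0 ir in let th := x 0 ith in
    match nat_of_ord c, nat_of_ord a, nat_of_ord b with
    | 0, 0, 0 => k1 k t r
    | 0, 0, 1 | 0, 1, 0 => k2 k t r
    | 0, 1, 1 => k3 k t r
    | 0, 2, 2 => k7 k t r
    | 0, 3, 3 => (k7 k t r * sin th ^+ 2)%R
    | 1, 0, 0 => k4 k t r
    | 1, 1, 1 => k5 k t r
    | 1, 0, 1 | 1, 1, 0 => k6 k t r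
    | 1, 2, 2 => k10 k t r
    | 1, 3, 3 => (k10 k t r * sin th ^+ 2)%R
    | 2, 2, 0 | 2, 0, 2 | 3, 3, 0 | 3, 0, 3 => k8 k t r
    | 2, 2, 1 | 2, 1, 2 | 3, 3, 1 | 3, 1, 3 => k9 k t r
    | 2, 3, 3 => (- (sin th * cos th))%R
    | 3, 2, 3 | 3, 3, 2 => (cos th / sin th)%R
    | _, _, _ => 0%R
    end%N.

Definition d_t (f : R -> R -> R) (t r : R) : R := derive1 (fun s => f s r) t.
Definition d_r (f : R -> R -> R) (t r : R) : R := derive1 (f t) r.

Section Data.
Variables (k : sph_coef) (t r : R).
Local Notation K1 := (k1 k t r).
Local Notation K2 := (k2 k t r).
Local Notation K3 := (k3 k t r).
Local Notation K4 := (k4 k t r).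
Local Notation K5 := (k5 k t r).
Local Notation K6 := (k6 k t r).
Local Notation K7 := (k7 k t r).
Local Notation K8 := (k8 k t r).
Local Notation K9 := (k9 k t r).
Local Notation K10 := (k10 k t r).

Definition a1 := d_r (k1 k) t r - d_t (k2 k) t r
  + K3 * K4 - K2 * K6.
Definition a2 := d_r (k2 k) t r - d_t (k3 k) t r
  + K2 ^+ 2 + K3 * K6 - K1 * K3 - K2 * K5.
Definition a3 := d_r (k4 k) t r - d_t (k6 k) t r
  + K1 * K6 + K4 * K5 - K2 * K4 - K6 ^+ 2.
Definition a4 := d_r (k6 k) t r - d_t (k5 k) t r
  + K2 * K6 - K3 * K4.
Definition a5 := d_r (k8 k) t r - d_t (k9 k) t r.
Definition a6 := - d_t (k7 k) t r
  + K7 * K8 - K1 * K7 - K2 * K10.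
Definition a7 := - d_t (k10 k) t r
  + K8 * K10 - K4 * K7 - K6 * K10.
Definition a8 := - d_t (k8 k) t r
  + K1 * K8 + K4 * K9 - K8 ^+ 2.
Definition a9 := - d_t (k9 k) t r
  + K2 * K8 + K6 * K9 - K8 * K9.
Definition a10 := - d_r (k7 k) t r
  + K7 * K9 - K2 * K7 - K3 * K10.
Definition a11 := - d_r (k10 k) t r
  + K9 * K10 - K6 * K7 - K5 * K10.
Definition a12 := - d_r (k8 k) t r
  + K2 * K8 + K6 * K9 - K8 * K9.
Definition a13 := - d_r (k9 k) t r
  + K3 * K8 + K5 * K9 - K9 ^+ 2.

(* ca, cb, cc, cD, ..., cHt are the functions a, b, c, D, E, F, G, G-tilde, H,
   H-tilde of (t, r). *)
Definition ca := K7 / K10.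
Definition cb := K8 / K10.
Definition cc := (K9 * K10 - K7 * K8) / K10 ^+ 2.

Definition cD := ca * a3 - a1 + a5.
Definition cE := cb * a3.
Definition cF := ca * a3 - a1.
Definition cG := 2 * (K1 - K4 * ca).
Definition cGt := cG - 2 * K8.
Definition cH := 2 * (K2 - K6 * ca).
Definition cHt := cH - 2 * K9.
Definition rho := cE / cD.

Definition power_law_relations : Prop :=
  [/\ cb * (ca * a1 + a2) + (ca * cb + cc) * (ca * a3 + a4)
        - a5 * (2 * ca * cb + cc) = 0,
      ca * (ca * a3 + a4) - (ca * a1 + a2) = 0,
      (ca * cb + cc) * a3 + cb * (ca * a3 + a4) + cb * (a1 - 2 * a5) = 0,
      [/\ a6 = ca * a7, a8 = cb * a7 & a9 = (ca * cb + cc) * a7] &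
      [/\ a10 = ca * a11, a12 = cb * a11 & a13 = (ca * cb + cc) * a11]].

End Data.

(* The line integral must not depend on the path, whence the quantification over
   all paths; an integral reaching every (t, r) requires some path to exist. *)
Definition power_law_factor (U : set (R * R)) (k : sph_coef) (lam : R)
    (vth : R -> R -> R) : Prop :=
  let P t r := cG k t r - lam * cGt k t r in
  let Q t r := cH k t r - lam * cHt k t r in
  exists2 q0, U q0 & forall t r, U (t, r) ->
    (exists g1 g2, C1_path U q0 (t, r) g1 g2) /\
    (forall g1 g2, C1_path U q0 (t, r) g1 g2 ->
       vth t r = expR (path_integral P Q g1 g2)).

Definition u_form (k : sph_coef) (x y : 'rV[R]_4) : R :=
  y 0 it - ca k (x 0 it) (x 0 ir) * y 0 ir.

Definition v_form (k : sph_coef) (x y : 'rV[R]_4) : R :=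
  cc k (x 0 it) (x 0 ir) * y 0 ir ^+ 2
  + 2 * cb k (x 0 it) (x 0 ir) * y 0 it * y 0 ir - wspeed x y ^+ 2.

Definition proportional_on (A : set TM) (X Y : @vfield R) : Prop :=
  exists mu : TM -> R, forall p, A p -> X p = mu p *: Y p.

Definition power_law_berwald (M : set 'rV[R]_4) (A : set TM) (L : TM -> R)
    (k : sph_coef) (lam : R) (vth : R -> R -> R) : Prop :=
  let Gam := sph_connection k in
  let del := delta Gam in
  let Btr := bracket (del it) (del ir) in
  let U := tr_domain M in
  [/\ [/\ pseudo_finsler M A L, spatially_spherical A L &
          canonical_connection M A L Gam],
      [/\ forall t r, U (t, r) -> k10 k t r != 0,
          proportional_on A (bracket (del it) Btr) Btr,
          proportional_on A (bracket (del ir) Btr) Btr &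
          forall t r, U (t, r) -> power_law_relations k t r],
      forall t r, U (t, r) -> cD k t r != 0 /\ lam = cF k t r / cD k t r,
      power_law_factor U k lam vth &
      forall x y, A (x, y) -> exists P Q : R,
        [/\ real_power (u_form k x y) (2 - 2 * lam) P,
            real_power (v_form k x y
              + rho k (x 0 it) (x 0 ir) * u_form k x y ^+ 2) lam Q &
            L (x, y) = vth (x 0 it) (x 0 ir) * P * Q]].

End Spherical.
Arguments sph_coef R : clear implicits.

(* Main.v *)
(* Write [y *m N x] for the vertical field defined by a matrix field N; brackets
   with delta_a turn N into its covariant derivative.  With X = k7 dt + k10 dr and
   sigma = k8 dt + k9 dr, the vertical parts of all iterated brackets stay in the
   module spanned over functions of the base by B = [delta_t, delta_r], by
   V_theta = X (x) dtheta + dtheta (x) sigma, its analogue V_phi, and the infinitesimal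
   rotation.  V_theta, V_phi and the rotation satisfy one linear relation at every
   point; the rank of the four fields is 3 unless u = v = 0, or sigma(y) = w = 0.
   Such points do not belong to A: there dL would vanish or L would fail to be
   differentiable, whereas y *m fund_tensor L = dL / 2 is not zero.  As k10 a5 =
   k9 a7 - k8 a11 is not zero, a7 or a11 is not zero, so V_theta and V_phi occur
   among the brackets.

   If a5 = 0 then lambda = 1 and L is quadratic.  A metric h with the same
   connection is parallel, so B and V_theta are h-skew: the (theta, theta) entry of
   the first relation gives a5 h(dtheta, dtheta) = 0, and then the second one gives
   h(X, _) = 0, against nondegeneracy. *)
Require Import Defs.
From HB Require Import structures.
From mathcomp Require Import all_boot all_order all_algebra.
From mathcomp Require Import all_classical all_reals all_analysis.
From mathcomp Require Import ring lra.

Set Implicit Arguments.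
Unset Strict Implicit.
Unset Printing Implicit Defensive.

Import Order.TTheory GRing.Theory Num.Theory.
Import numFieldNormedType.Exports.

Local Open Scope classical_set_scope.
Local Open Scope ring_scope.

(** * Directional calculus *)

(** The delicate points of [A] are the zeros of the two bases of the power law. [real_power] admits
    the base 0 only for exponents m / n >= 0 with n odd, so after an n-th power every restriction of
    L to a line becomes a comparison of integer powers of |h|. Through u = v = 0 the order is at
    least 2 - lambda, and 2 - 2 lambda >= 0 makes it exceed 1. At sigma(y) = w = 0 with X paired
    nontrivially with sigma, v + rho u^2 is a quadratic form in quantities vanishing there, so the
    order is 2 lambda: differentiability in one direction forces 2 lambda > 1, and then all first
    derivatives vanish.

    The rank also uses lambda <> 0, which holds because vth u^2 is quadratic: F = lambda D is then
    nonzero, and F is what separates B from V_theta and V_phi off u = 0.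

    The proportionality factors of the iterated brackets are arbitrary functions on [A], whereas the
    module argument needs smooth functions on the base; as a5 <> 0, they turn out to be logarithmic
    derivatives of a5. *)

Section DirectionalCalculus.
Context {R : realType} {V : normedModType R}.
Implicit Types (U : set V) (f g : V -> R) (x v w : V).

Lemma is_derive_pair (W1 W2 : normedModType R) (f : V -> W1) (g : V -> W2)
    (x v : V) df dg :
  is_derive x v f df -> is_derive x v g dg ->
  is_derive x v (fun y => (f y, g y)) (df, dg).
Proof.
move=> [fd <-] [gd <-].
suff cv : (fun h => h^-1 *: (((fun y => (f y, g y)) \o shift x) (h *: v)
    - (f x, g x))) @ 0^' --> ('D_v f x, 'D_v g x).
  by apply: DeriveDef; [apply/cvg_ex; exists ('D_v f x, 'D_v g x)|exact: cvg_lim cv].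
by apply: cvg_pair; [exact: fd|exact: gd].
Qed.

Lemma is_derive_open U (W : normedModType R) (f g : V -> W) x v df :
  open U -> U x -> (forall y, U y -> f y = g y) ->
  is_derive x v f df -> is_derive x v g df.
Proof.
move=> oU Ux fg; apply: near_eq_is_derive.
by near=> y; apply: fg; near: y; exact: open_nbhs_nbhs.
Unshelve. all: by end_near. Qed.

Lemma is_derive_line f x w (c : R) : derivable f (c *: w + x) w ->
  is_derive c 1 (fun s : R => f (s *: w + x)) ('D_w f (c *: w + x)).
Proof.
move=> fd.
have E : (fun h : R => h^-1 *: (((fun s : R => f (s *: w + x)) \o shift c) (h *: 1)
    - f (c *: w + x)))
  = (fun h : R => h^-1 *: ((f \o shift (c *: w + x)) (h *: w) - f (c *: w + x))).
  by apply/funext => h /=; rewrite [_%:A]mulr1 scalerDl addrA.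
by apply: DeriveDef; rewrite /derivable /derive E.
Qed.

(** [h] may have either sign, since difference quotients are taken over a punctured neighbourhood of
    0. *)
Lemma line_mvt f x w (h : R) :
  (forall s : R, `|s| <= `|h| -> derivable f (s *: w + x) w) ->
  exists2 s : R, `|s| <= `|h| & f (h *: w + x) - f x = h * 'D_w f (s *: w + x).
Proof.
move=> fd; pose g (s : R) : R := f (s *: w + x); pose dg (s : R) : R := 'D_w f (s *: w + x).
have gd (s : R) : `|s| <= `|h| -> is_derive s 1 g (dg s).
  by move=> /fd; exact: is_derive_line.
have gc (a b : R) : (forall s, s \in `[a, b]%R -> `|s| <= `|h|) ->
    {within `[a, b], continuous g}.
  move=> ab; apply: derivable_within_continuous => s /ab /gd gs.
  exact: ex_derive.
have g0 : g 0 = f x by rewrite /g scale0r add0r.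
have [h0|/ltW h0] := leP 0 h.
- have [s||s sh E] := @MVT_segment _ g dg 0 h h0.
  + rewrite in_itv /= => /andP[s0 sh]; apply: gd.
    by rewrite !ger0_norm// ltW.
  + apply: gc => s; rewrite in_itv /= => /andP[s0 sh].
    by rewrite !ger0_norm.
  + exists s; last by rewrite -/(g h) -g0 E subr0 mulrC.
    by move: sh; rewrite in_itv /= => /andP[s0 sh]; rewrite !ger0_norm.
- have [s||s sh E] := @MVT_segment _ g dg h 0 h0.
  + rewrite in_itv /= => /andP[s0 sh]; apply: gd.
    by rewrite !ler0_norm ?lerN2// ltW.
  + apply: gc => s; rewrite in_itv /= => /andP[s0 sh].
    by rewrite !ler0_norm ?lerN2.
  + exists s.
      by move: sh; rewrite in_itv /= => /andP[s0 sh]; rewrite !ler0_norm ?lerN2.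
    by rewrite -/(g h) -g0 -[LHS]opprB E sub0r mulrN opprK mulrC.
Qed.

(** The intermediate points of one or two nested mean value theorems stay in such a parallelogram,
    where continuity of the derivatives applies. *)
Lemma nbhs_parallelogram (N : set V) x v w : nbhs x N ->
  exists2 d : R, 0 < d & forall a b : R, `|a| <= d -> `|b| <= d ->
    N (a *: v + (b *: w + x)).
Proof.
move=> /nbhs_ballP[e /= e0 eN].
have n0 : 0 < `|v| + `|w| + 1 by rewrite ltr_wpDl ?addr_ge0.
exists (e / (`|v| + `|w| + 1)) => [|a b ad bd]; first by rewrite divr_gt0.
apply: eN; rewrite -ball_normE /ball_ /= distrC addrA addrK.
rewrite (le_lt_trans (ler_normD _ _))// !normrZ.
set d := e / _ in ad bd.
have -> : e = d * (`|v| + `|w| + 1) by rewrite /d divfK// gt_eqF.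
have d0 : 0 < d by rewrite divr_gt0.
apply: (@le_lt_trans _ _ (d * `|v| + d * `|w|)).
  by rewrite lerD// ler_wpM2r.
by rewrite -mulrDr ltr_pM2l// ltrDl.
Qed.

Lemma norm_sub_small (a b : R) : (forall e, 0 < e -> `|a - b| <= e) -> a = b.
Proof.
move=> ab; apply/eqP; rewrite -subr_eq0 -normr_le0; apply/ler_addgt0Pl => e e0.
by rewrite addr0 ab.
Qed.

Lemma Ck_mono n U f : Ck_on n.+1 U f -> Ck_on n U f.
Proof.
elim: n f => [|n IH] f [fc fd]; split=> // v.
by have [fv fk] := fd v; split=> //; exact: IH.
Qed.

Lemma Ck_ext n U f g : open U -> (forall x, U x -> f x = g x) ->
  Ck_on n U f -> Ck_on n U g.
Proof.
move=> oU; elim: n f g => [|n IH] f g fg [fc fd].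
  split=> // x Ux; apply: cvg_trans (_ : f @ x --> g x).
    apply: near_eq_cvg; near=> y; rewrite fg//; near: y.
    exact: open_nbhs_nbhs.
  by rewrite -fg//; exact: fc.
split.
  move=> x Ux; apply: cvg_trans (_ : f @ x --> g x).
    apply: near_eq_cvg; near=> y; rewrite fg//; near: y.
    exact: open_nbhs_nbhs.
  by rewrite -fg//; exact: fc.
move=> v; have [fv fk] := fd v; split.
  move=> x Ux; have /derivableP fx := fv x Ux.
  by have [] := is_derive_open oU Ux fg fx.
apply: IH fk => x Ux; apply: near_eq_derive; near=> y.
by apply: fg; near: y; exact: open_nbhs_nbhs.
Unshelve. all: by end_near. Qed.

Lemma Ck_cst n U (c : R) : Ck_on n U (cst c).
Proof.
elim: n c => [|n IH] c; (split; first by move=> x _; exact: cvg_cst) => // v.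
split=> [x _|]; first exact: derivable_cst.
have -> : 'D_v (cst c) = cst 0 :> (V -> R) by apply/funext => x; rewrite derive_cst.
exact: IH.
Qed.

Lemma CkD n U f g : open U -> Ck_on n U f -> Ck_on n U g -> Ck_on n U (f + g).
Proof.
move=> oU; elim: n f g => [|n IH] f g [fc fd] [gc gd];
  (split; first by move=> x Ux; apply: continuousD; [exact: fc|exact: gc]) => // v.
have [fv fk] := fd v; have [gv gk] := gd v; split.
  by move=> x Ux; apply: derivableD; [exact: fv|exact: gv].
apply: (Ck_ext oU _ (IH _ _ fk gk)) => x Ux.
by rewrite deriveD//; [exact: fv|exact: gv].
Qed.

Lemma CkM n U f g : open U -> Ck_on n U f -> Ck_on n U g -> Ck_on n U (f * g).
Proof.
move=> oU; elim: n f g => [|n IH] f g fC gC; move: (fC) (gC) => [fc fd] [gc gd];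
  (split; first by move=> x Ux; apply: continuousM; [exact: fc|exact: gc]) => // v.
have [fv fk] := fd v; have [gv gk] := gd v; split.
  by move=> x Ux; apply: derivableM; [exact: fv|exact: gv].
apply: (Ck_ext oU _ (CkD oU (IH _ _ (Ck_mono fC) gk) (IH _ _ (Ck_mono gC) fk))).
by move=> x Ux; rewrite deriveM//; [exact: fv|exact: gv].
Qed.

Lemma CkV n U f : open U -> (forall x, U x -> f x != 0) -> Ck_on n U f ->
  Ck_on n U (fun x => (f x)^-1).
Proof.
move=> oU f0; elim: n => [|n IH] fC; move: (fC) => [fc fd];
  (split; first by move=> x Ux; apply: cvgV; [exact: f0|exact: fc]) => // v.
have [fv fk] := fd v; split.
  by move=> x Ux; apply: derivableV; [exact: f0|exact: fv].
have iC := IH (Ck_mono fC).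
apply: (Ck_ext oU _ (CkM oU (Ck_cst n U (-1)) (CkM oU (CkM oU iC iC) fk))).
move=> x Ux; rewrite deriveV; [|exact: f0|exact: fv].
by rewrite -[RHS]/(_ * _) !fctE /= mulN1r mulNr -exprVn expr2.
Qed.

(* Directional derivatives are not assumed to be linear in the direction; for
   C^1 functions this follows from the mean value theorem. *)
Lemma derive_dirD U f x v w : open U -> Ck_on 1 U f -> U x ->
  'D_(v + w) f x = 'D_v f x + 'D_w f x.
Proof.
move=> oU [fc fd] Ux; have [fv _] := fd v; have [fw [wc _]] := fd w.
apply: cvg_lim => //.
have E : (fun h : R => h^-1 *: ((f \o shift x) (h *: (v + w)) - f x)) =
  (fun h : R => h^-1 *: ((f \o shift x) (h *: v) - f x)
     + h^-1 *: (f (h *: w + (h *: v + x)) - f (h *: v + x))).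
  apply/funext => h /=; rewrite -scalerDr; congr (_ *: _).
  rewrite [RHS]addrC [RHS]addrA subrK scalerDr.
  by rewrite -addrA addrCA.
rewrite E; apply: cvgD; first exact: fv.
apply/cvgrPdist_le => e e0.
have := wc x Ux; move=> /cvgrPdist_le /(_ e e0) we.
have [d d0 dN] := nbhs_parallelogram w v
  (filterI we (open_nbhs_nbhs (conj oU Ux))).
near=> h.
have hd : `|h| <= d by near: h; exact: dnbhs0_le.
have h0 : h != 0 by near: h; exact: nbhs_dnbhs_neq.
have [s sh ->] : exists2 s : R, `|s| <= `|h| &
    f (h *: w + (h *: v + x)) - f (h *: v + x) = h * 'D_w f (s *: w + (h *: v + x)).
  apply: line_mvt => s sh; apply: fw.
  by have [] := dN s h (le_trans sh hd) hd.
rewrite [_ *: _]mulrA mulVf// mul1r.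
by have [] := dN s h (le_trans sh hd) hd.
Unshelve. all: by end_near. Qed.

(** The second difference of [f] over a small parallelogram is symmetric in the two sides. Two mean
    value theorems write it as h^2 times a mixed derivative at a nearby point, in either order, and
    both mixed derivatives are continuous. *)
Lemma derive_commute U f x v w : open U -> Ck_on 2 U f -> U x ->
  'D_v ('D_w f) x = 'D_w ('D_v f) x.
Proof.
move=> oU fC Ux.
have key v' w' e : 0 < e -> exists2 d : R, 0 < d & forall h : R, `|h| <= d ->
    exists2 l, `|'D_w' ('D_v' f) x - l| <= e &
    f (h *: v' + (h *: w' + x)) - f (h *: v' + x) - (f (h *: w' + x) - f x) =
    h * (h * l).
  move=> e0; move: fC => [_ fd].
  have [fv [_ fdv]] := fd v'; have [fvw [cvw _]] := fdv w'.
  have := cvw x Ux; move=> /cvgrPdist_le /(_ e e0) we.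
  have [d d0 dN] := nbhs_parallelogram v' w'
    (filterI we (open_nbhs_nbhs (conj oU Ux))).
  exists d => // h hd.
  have Un a b : `|a| <= d -> `|b| <= d -> U (a *: v' + (b *: w' + x)).
    by move=> ad bd; have [] := dN a b ad bd.
  have Un0 a : `|a| <= d -> U (a *: v' + x).
    move=> ad; have := Un a 0; rewrite scale0r add0r; apply => //.
    by rewrite normr0 ltW.
  pose phi z := f (h *: w' + z) - f z.
  have dphi s : `|s| <= d -> is_derive (s *: v' + x) v' phi
      ('D_v' f (h *: w' + (s *: v' + x)) - 'D_v' f (s *: v' + x)).
    move=> sd; apply: is_deriveB; last first.
      by apply: derivableP; apply: fv; exact: Un0.
    have : derivable f (h *: w' + (s *: v' + x)) v'.
      by apply: fv; rewrite addrCA; exact: Un.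
    move=> fdd; have F : (fun t : R => t^-1 *: (((fun z => f (h *: w' + z)) \o
         shift (s *: v' + x)) (t *: v') - f (h *: w' + (s *: v' + x)))) =
       (fun t : R => t^-1 *: ((f \o shift (h *: w' + (s *: v' + x))) (t *: v')
          - f (h *: w' + (s *: v' + x)))).
      by apply/funext => t /=; rewrite addrCA.
    by apply: DeriveDef; rewrite /derivable /derive F.
  have [s sh E] : exists2 s : R, `|s| <= `|h| &
      phi (h *: v' + x) - phi x = h * 'D_v' phi (s *: v' + x).
    apply: line_mvt => s sh.
    by have [] := dphi s (le_trans sh hd).
  have sd := le_trans sh hd.
  have [_ Es] := dphi s sd.
  have [t th Et] : exists2 t : R, `|t| <= `|h| &
      'D_v' f (h *: w' + (s *: v' + x)) - 'D_v' f (s *: v' + x) =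
      h * 'D_w' ('D_v' f) (t *: w' + (s *: v' + x)).
    apply: (line_mvt (f := 'D_v' f)) => t th; apply: fvw.
    by rewrite addrCA; apply: Un => //; exact: le_trans th hd.
  exists ('D_w' ('D_v' f) (t *: w' + (s *: v' + x))).
    by rewrite addrCA; have [] := dN s t sd (le_trans th hd).
  by rewrite -Et -Es -E /phi [h *: w' + (h *: v' + x)]addrCA.
apply: norm_sub_small => e e0.
have e20 : 0 < e / 2 by rewrite divr_gt0.
have [d1 d10 H1] := key v w _ e20.
have [d2 d20 H2] := key w v _ e20.
pose h := Num.min d1 d2.
have h0 : 0 < h by rewrite /h lt_min d10.
have [|l1 l1e E1] := H1 h; first by rewrite gtr0_norm// /h ge_min lexx.
have [|l2 l2e E2] := H2 h; first by rewrite gtr0_norm// /h ge_min lexx orbT.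
have l12 : l1 = l2.
  apply: (mulfI (lt0r_neq0 h0)); apply: (mulfI (lt0r_neq0 h0)).
  rewrite -E1 -E2 [h *: v + (_ + _)]addrCA; ring.
rewrite (_ : _ - _ = ('D_v ('D_w f) x - l2) - ('D_w ('D_v f) x - l1)); last first.
  by rewrite l12 opprB addrA subrK.
by rewrite (le_trans (ler_normB _ _))// [e]splitr lerD.
Qed.

End DirectionalCalculus.

(** * Brackets of the horizontal fields with linear vertical fields *)

Section LinearVerticalFields.
Context {R : realType}.
Local Notation X4 := 'rV[R]_4.
Local Notation TM := (TM4 R).

Lemma is_derive_mx (V : normedModType R) (m n : nat) (F : V -> 'M[R]_(m, n))
    (x v : V) (D : 'M[R]_(m, n)) :
  (forall i j, is_derive x v (fun z => F z i j) (D i j)) -> is_derive x v F D.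
Proof.
move=> FD; have Fd : derivable F x v.
  by apply/derivable_mxP => i j; have [] := FD i j.
apply: DeriveDef => //; rewrite derive_mx//; apply/matrixP => i j.
by rewrite mxE; have [] := FD i j.
Qed.

Lemma is_derive_coord (n : nat) (x v : 'rV[R]_n) k :
  is_derive x v (fun z : 'rV[R]_n => z 0 k) (v 0 k).
Proof.
have /derivableP := @derivable_id R 'rV[R]_n x v; rewrite derive_id => iv.
have /derivable_mxP/(_ 0 k) kd : derivable (@id 'rV[R]_n) x v by [].
apply: DeriveDef => //.
have := @derive_val _ _ _ _ _ _ _ iv; rewrite derive_mx//.
by move=> /matrixP/(_ 0 k); rewrite mxE.
Qed.

Lemma is_derive_fst (f : X4 -> R) (p q : TM) df :
  is_derive p.1 q.1 f df -> is_derive p q (fun z : TM => f z.1) df.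
Proof. by move=> [fd fE]; exact: DeriveDef. Qed.

Lemma is_derive_snd (f : X4 -> R) (p q : TM) df :
  is_derive p.2 q.2 f df -> is_derive p q (fun z : TM => f z.2) df.
Proof. by move=> [fd fE]; exact: DeriveDef. Qed.

Lemma is_derive_bigsum (V : normedModType R) (n : nat) (h : 'I_n -> V -> R) (x v : V)
    (dh : 'I_n -> R) :
  (forall i, is_derive x v (h i) (dh i)) ->
  is_derive x v (fun z => \sum_(i < n) h i z) (\sum_(i < n) dh i).
Proof.
move=> hd; have -> : (fun z => \sum_(i < n) h i z) = \sum_(i < n) h i.
  by apply/funext => z; rewrite fct_sumE.
exact: is_derive_sum.
Qed.

Definition dmx (a : 'I_4) (N : X4 -> 'M[R]_4) (x : X4) : 'M[R]_4 :=
  \matrix_(i, j) 'D_(evec a) (fun z => N z i j) x.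

Lemma is_derive_mulmx (N : X4 -> 'M[R]_4) (D : 'M[R]_4) (p q : TM) :
  (forall i j, is_derive p.1 q.1 (fun z => N z i j) (D i j)) ->
  is_derive p q (fun z : TM => z.2 *m N z.1) (q.2 *m N p.1 + p.2 *m D).
Proof.
move=> ND; apply: is_derive_mx => i j.
rewrite !mxE -big_split /=.
have -> : (fun z : TM => (z.2 *m N z.1) i j) =
   (fun z : TM => \sum_(k < 4) ((fun z : TM => z.2 i k) * (fun z : TM => N z.1 k j)) z).
  by apply/funext => z; rewrite mxE.
apply: is_derive_bigsum => k.
apply: is_derive_eq.
  apply: is_deriveM.
    rewrite ord1; apply: (@is_derive_snd (fun y => y 0 k)).
    exact: is_derive_coord.
  apply: (@is_derive_fst (fun x => N x k j)); exact: ND.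
by rewrite /GRing.scale /= ord1 addrC [N _ _ _ * _]mulrC.
Qed.

Variable Gam : @christoffel R.

(** The row carries the lower index, so that velocities act as row vectors on the left and the
    vertical part of delta_a is minus [y *m conn_mx a x]. *)
Definition conn_mx (a : 'I_4) (x : X4) : 'M[R]_4 := \matrix_(b, c) Gam x c a b.

Definition vert (N : X4 -> 'M[R]_4) : @vfield R := fun p => (0, p.2 *m N p.1).

Definition nabla (a : 'I_4) (N : X4 -> 'M[R]_4) (x : X4) : 'M[R]_4 :=
  dmx a N x + N x *m conn_mx a x - conn_mx a x *m N x.

Definition curv (a b : 'I_4) (x : X4) : 'M[R]_4 :=
  dmx b (conn_mx a) x - dmx a (conn_mx b) x
  + conn_mx a x *m conn_mx b x - conn_mx b x *m conn_mx a x.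

Lemma deltaE a : delta Gam a = fun p => (evec a, - (p.2 *m conn_mx a p.1)).
Proof.
apply/funext => p; congr (_, _); apply/rowP => c; rewrite !mxE; congr (- _).
by apply: eq_bigr => b _; rewrite !mxE mulrC.
Qed.

Definition mx_derivable (N : X4 -> 'M[R]_4) (x v : X4) :=
  forall i j, derivable (fun z => N z i j) x v.

Lemma is_derive_vert (N : X4 -> 'M[R]_4) (p q : TM) a :
  mx_derivable N p.1 q.1 -> q.1 = evec a ->
  is_derive p q (vert N) (0, q.2 *m N p.1 + p.2 *m dmx a N p.1).
Proof.
move=> Nd qa; apply: is_derive_pair; apply: is_derive_mulmx => i j.
by rewrite mxE -qa; exact: derivableP.
Qed.

Lemma is_derive_delta a b (p q : TM) :
  mx_derivable (conn_mx a) p.1 q.1 -> q.1 = evec b ->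
  is_derive p q (delta Gam a)
    (0, - (q.2 *m conn_mx a p.1 + p.2 *m dmx b (conn_mx a) p.1)).
Proof.
move=> Cd qb; rewrite deltaE; apply: is_derive_pair.
apply: is_deriveN; apply: is_derive_mulmx => i j.
by rewrite [dmx _ _ _ _ _]mxE -qb; exact: derivableP.
Qed.

(** Along a vertical direction only the linear dependence on the velocity is differentiated, whence
    no regularity of [Gam] is required. *)
Lemma is_derive_delta0 a (p q : TM) : q.1 = 0 ->
  is_derive p q (delta Gam a) (0, - (q.2 *m conn_mx a p.1)).
Proof.
move=> q0; rewrite deltaE -[X in - X]addr0 -[X in _ + X](mulmx0 _ p.2).
apply: is_derive_pair.
apply: is_deriveN; apply: is_derive_mulmx => i j.
by rewrite [X in is_derive _ _ _ X]mxE q0; exact: is_derive0.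
Qed.

Lemma bracket_delta_vert a (N : X4 -> 'M[R]_4) (p : TM) :
  mx_derivable N p.1 (evec a) ->
  bracket (delta Gam a) (vert N) p = vert (nabla a N) p.
Proof.
move=> Nd; rewrite /bracket.
have [_ ->] := @is_derive_vert N p (delta Gam a p) a Nd erefl.
have [_ ->] := @is_derive_delta0 a p (vert N p) erefl.
rewrite deltaE; apply: injective_projections; rewrite /= ?subr0 ?sub0r ?oppr0// ?opprK /nabla.
rewrite mulNmx mulmxBr !mulmxDr !mulmxA.
by rewrite [_ + _ *m dmx _ _ _]addrC addrAC.
Qed.

Lemma bracket_delta_delta a b (p : TM) :
  mx_derivable (conn_mx b) p.1 (evec a) ->
  mx_derivable (conn_mx a) p.1 (evec b) ->
  bracket (delta Gam a) (delta Gam b) p = vert (curv a b) p.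
Proof.
move=> bd ad; rewrite /bracket.
have [_ ->] := @is_derive_delta b a p (delta Gam a p) bd erefl.
have [_ ->] := @is_derive_delta a b p (delta Gam b p) ad erefl.
rewrite !deltaE; apply: injective_projections; rewrite /= ?subr0 ?sub0r ?oppr0// ?opprK /curv.
rewrite mulmxBr mulmxDr mulmxBr !mulmxA !mulNmx !opprD !opprK.
set u1 := _ *m _ *m _; set d1 := p.2 *m dmx _ _ _.
set u2 := _ *m _ *m _; set d2 := p.2 *m dmx _ _ _.
by rewrite [u1 - d1]addrC [- u2 + _]addrC addrACA [- d1 + _]addrC addrA.
Qed.

Lemma curv_anti a b x : curv a b x = -1 *: curv b a x.
Proof.
rewrite scaleN1r /curv !opprD !opprK.
by rewrite [LHS]addrAC [- _ + dmx b _ _]addrC.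
Qed.

Lemma curv_diag a x : curv a a x = 0.
Proof. by rewrite /curv subrr add0r subrr. Qed.

(** Inner brackets are known in matrix form only above [M]; this permits replacing them under a
    further bracket. *)
Lemma bracket_eq_near (U : set TM) (X Y Z : @vfield R) p : open U -> U p ->
  (forall q, U q -> Y q = Z q) -> bracket X Y p = bracket X Z p.
Proof.
move=> oU Up YZ.
have E : \near p, Y p = Z p.
  by near=> q; apply: YZ; near: q; exact: open_nbhs_nbhs.
by rewrite /bracket (YZ _ Up) (near_eq_derive (X p) E).
Unshelve. all: by end_near. Qed.

Lemma open_fst (M : set X4) : open M -> open [set p : TM | M p.1].
Proof. by move=> oM; apply: open_comp => // p _; exact: cvg_fst. Qed.

(** Induction on the nesting depth: [P] is any class of matrix fields containing the curvatures and
    stable under [nabla]. It will be the module generated by four explicit fields. *)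
Lemma nested_bracket_vert (M : set X4) (P : (X4 -> 'M[R]_4) -> Prop) :
  open M ->
  (forall a x v, M x -> mx_derivable (conn_mx a) x v) ->
  (forall N x v, P N -> M x -> mx_derivable N x v) ->
  (forall a b, P (curv a b)) -> (forall a N, P N -> P (nabla a N)) ->
  forall s a b, exists2 N, P N &
    forall p, M p.1 -> nested_bracket Gam a (b :: s) p = vert N p.
Proof.
move=> oM Cd Pd PR PN; elim=> [|c s IH] a b.
  exists (curv a b) => // p Mp; apply: bracket_delta_delta; exact: Cd.
have [N NP NE] := IH b c; exists (nabla a N); first exact: PN.
move=> p Mp.
rewrite -bracket_delta_vert; last exact: Pd.
exact: (bracket_eq_near _ (open_fst oM)).
Qed.

End LinearVerticalFields.

(** * Algebra of smooth functions *)

Section SmoothFunctions.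
Context {R : realType} {V : normedModType R}.
Variable U : set V.
Hypothesis oU : open U.
Implicit Types f g : V -> R.

Lemma smooth_ext f g : (forall x, U x -> f x = g x) -> smooth_on U f -> smooth_on U g.
Proof. by move=> fg fs n; exact: Ck_ext (fs n). Qed.

Lemma smooth_cst (c : R) : smooth_on U (fun=> c).
Proof. by move=> n; exact: Ck_cst. Qed.

Lemma smoothD f g : smooth_on U f -> smooth_on U g ->
  smooth_on U (fun x => f x + g x).
Proof. by move=> fs gs n; exact: CkD. Qed.

Lemma smoothM f g : smooth_on U f -> smooth_on U g ->
  smooth_on U (fun x => f x * g x).
Proof. by move=> fs gs n; exact: CkM. Qed.

Lemma smoothN f : smooth_on U f -> smooth_on U (fun x => - f x).
Proof.
move=> fs; apply: smooth_ext (smoothM (smooth_cst (-1)) fs) => x _.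
by rewrite mulN1r.
Qed.

Lemma smoothB f g : smooth_on U f -> smooth_on U g ->
  smooth_on U (fun x => f x - g x).
Proof. by move=> fs gs; apply: smoothD => //; exact: smoothN. Qed.

Lemma smoothX f n : smooth_on U f -> smooth_on U (fun x => f x ^+ n).
Proof.
move=> fs; elim: n => [|n IH]; first exact: smooth_cst.
by apply: smooth_ext (smoothM fs IH) => x _; rewrite exprS.
Qed.

Lemma smoothV f : (forall x, U x -> f x != 0) -> smooth_on U f ->
  smooth_on U (fun x => (f x)^-1).
Proof. by move=> f0 fs n; exact: CkV. Qed.

Lemma smooth_div f g : (forall x, U x -> g x != 0) ->
  smooth_on U f -> smooth_on U g -> smooth_on U (fun x => f x / g x).
Proof. by move=> g0 fs gs; apply: smoothM => //; exact: smoothV. Qed.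

Lemma smooth_derivable f x v : U x -> smooth_on U f -> derivable f x v.
Proof. by move=> Ux /(_ 1%N)[_ /(_ v)[fd _]]; exact: fd. Qed.

Lemma smooth_derive f v : smooth_on U f -> smooth_on U ('D_v f).
Proof. by move=> fs n; have [_ /(_ v)[]] := fs n.+1. Qed.

End SmoothFunctions.

(** * Modules of matrix fields over the smooth functions of the base *)

Section SmoothModule.
Context {R : realType}.
Local Notation X4 := 'rV[R]_4.
Variables (Gam : @christoffel R) (M : set X4).
Hypothesis oM : open M.

Definition mx_smooth (N : X4 -> 'M[R]_4) :=
  forall i j, smooth_on M (fun x => N x i j).

Lemma dmxD a (N1 N2 : X4 -> 'M[R]_4) x :
  mx_derivable N1 x (evec a) -> mx_derivable N2 x (evec a) ->
  dmx a (fun z => N1 z + N2 z) x = dmx a N1 x + dmx a N2 x.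
Proof.
move=> d1 d2; apply/matrixP => i j; rewrite !mxE.
rewrite -(deriveD (d1 i j) (d2 i j)); congr (derive _ x (evec a)).
by apply/funext => z; rewrite mxE.
Qed.

Lemma dmxZ a (f : X4 -> R) (N : X4 -> 'M[R]_4) x :
  derivable f x (evec a) -> mx_derivable N x (evec a) ->
  dmx a (fun z => f z *: N z) x = 'D_(evec a) f x *: N x + f x *: dmx a N x.
Proof.
move=> fd Nd; apply/matrixP => i j; rewrite !mxE addrC [_ * N x i j]mulrC.
rewrite -(deriveM fd (Nd i j)); congr (derive _ x (evec a)).
by apply/funext => z; rewrite mxE.
Qed.

Lemma nablaD a (N1 N2 : X4 -> 'M[R]_4) x :
  mx_derivable N1 x (evec a) -> mx_derivable N2 x (evec a) ->
  nabla Gam a (fun z => N1 z + N2 z) x = nabla Gam a N1 x + nabla Gam a N2 x.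
Proof.
move=> d1 d2; rewrite /nabla dmxD// mulmxDl mulmxDr opprD.
by rewrite [X in X + _]addrACA [LHS]addrACA.
Qed.

Lemma nablaZ a (f : X4 -> R) (N : X4 -> 'M[R]_4) x :
  derivable f x (evec a) -> mx_derivable N x (evec a) ->
  nabla Gam a (fun z => f z *: N z) x
    = 'D_(evec a) f x *: N x + f x *: nabla Gam a N x.
Proof.
move=> fd Nd; rewrite /nabla dmxZ// -scalemxAl -scalemxAr.
by rewrite scalerBr scalerDr !addrA.
Qed.

Lemma nabla_ext a (N1 N2 : X4 -> 'M[R]_4) x : M x ->
  (forall z, M z -> N1 z = N2 z) -> nabla Gam a N1 x = nabla Gam a N2 x.
Proof.
move=> Mx N12; rewrite /nabla N12//.
suff -> : dmx a N1 x = dmx a N2 x by [].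
apply/matrixP => i j; rewrite !mxE; apply: near_eq_derive; near=> z.
by rewrite N12//; near: z; exact: open_nbhs_nbhs.
Unshelve. all: by end_near. Qed.

Variable G : (X4 -> 'M[R]_4) -> Prop.

(** Matrix fields are total functions on the coordinate space while all identities hold on [M] only;
    [span_ext] absorbs the difference. *)
Inductive smooth_span : (X4 -> 'M[R]_4) -> Prop :=
| span_gen N : G N -> smooth_span N
| span_add N1 N2 : smooth_span N1 -> smooth_span N2 ->
    smooth_span (fun x => N1 x + N2 x)
| span_scale f N : smooth_on M f -> smooth_span N ->
    smooth_span (fun x => f x *: N x)
| span_ext N1 N2 : smooth_span N1 -> (forall x, M x -> N1 x = N2 x) ->
    smooth_span N2.

Hypothesis G_smooth : forall N, G N -> mx_smooth N.
Hypothesis G_nabla : forall a N, G N -> smooth_span (nabla Gam a N).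

Lemma smooth_span_smooth N : smooth_span N -> mx_smooth N.
Proof.
elim=> {N} [N /G_smooth//|N1 N2 _ s1 _ s2|f N fs _ Ns|N1 N2 _ s1 E] i j.
- by apply: smooth_ext (smoothD oM (s1 i j) (s2 i j)) => // x _; rewrite mxE.
- by apply: smooth_ext (smoothM oM fs (Ns i j)) => // x _; rewrite mxE.
- by apply: smooth_ext (s1 i j) => // x Mx; rewrite E.
Qed.

Lemma smooth_span_derivable N x v : smooth_span N -> M x -> mx_derivable N x v.
Proof.
by move=> /smooth_span_smooth Ns Mx i j; exact: smooth_derivable (Ns i j).
Qed.

(** By the Leibniz rule, stability under covariant differentiation need only be checked on the
    generators. *)
Lemma smooth_span_nabla a N : smooth_span N -> smooth_span (nabla Gam a N).
Proof.
elim=> {N} [N /G_nabla//|N1 N2 s1 n1 s2 n2|f N fs Ns nN|N1 N2 s1 n1 E].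
- apply: span_ext (span_add n1 n2) _ => x Mx.
  by rewrite nablaD//; exact: smooth_span_derivable.
- apply: span_ext (span_add (span_scale (smooth_derive (evec a) fs) Ns)
    (span_scale fs nN)) _ => x Mx.
  rewrite nablaZ//; first exact: smooth_derivable Mx fs.
  exact: smooth_span_derivable.
- by apply: span_ext n1 _ => x Mx; exact: nabla_ext.
Qed.

End SmoothModule.

(** * Explicit 4 by 4 matrices and rows *)

Section ExplicitMatrices.
Context {R : realType}.

Local Notation X4 := 'rV[R]_4.

(** Entries listed explicitly let sums, products and derivatives be computed by rewriting, so that a
    matrix identity splits into 16 scalar ones. *)
Definition mx4 (F : seq (seq R)) : 'M[R]_4 :=
  \matrix_(i < 4, j < 4) nth 0 (nth [::] F i) j.

Lemma sum4 (V : nmodType) (F : 'I_4 -> V) :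
  \sum_(i < 4) F i = F it + F ir + F ith + F iph.
Proof.
rewrite !big_ord_recl big_ord0 addr0 !addrA.
by congr (_ + _ + _ + _); congr (F _); apply/val_inj.
Qed.

Lemma forall_ord4 (P : 'I_4 -> Prop) : P it -> P ir -> P ith -> P iph -> forall i, P i.
Proof.
move=> P0 P1 P2 P3 [[|[|[|[|//]]]] h].
- by rewrite (_ : Ordinal h = it)//; exact/val_inj.
- by rewrite (_ : Ordinal h = ir)//; exact/val_inj.
- by rewrite (_ : Ordinal h = ith)//; exact/val_inj.
- by rewrite (_ : Ordinal h = iph)//; exact/val_inj.
Qed.

Lemma mx4D a0 a1 a2 a3 b0 b1 b2 b3 c0 c1 c2 c3 d0 d1 d2 d3
    a0' a1' a2' a3' b0' b1' b2' b3' c0' c1' c2' c3' d0' d1' d2' d3' :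
  mx4 [:: [:: a0; a1; a2; a3]; [:: b0; b1; b2; b3];
          [:: c0; c1; c2; c3]; [:: d0; d1; d2; d3]]
  + mx4 [:: [:: a0'; a1'; a2'; a3']; [:: b0'; b1'; b2'; b3'];
          [:: c0'; c1'; c2'; c3']; [:: d0'; d1'; d2'; d3']]
  = mx4 [:: [:: a0 + a0'; a1 + a1'; a2 + a2'; a3 + a3'];
            [:: b0 + b0'; b1 + b1'; b2 + b2'; b3 + b3'];
            [:: c0 + c0'; c1 + c1'; c2 + c2'; c3 + c3'];
            [:: d0 + d0'; d1 + d1'; d2 + d2'; d3 + d3']].
Proof.
by apply/matrixP; apply: forall_ord4; apply: forall_ord4; rewrite !mxE.
Qed.

Lemma mx4Z k a0 a1 a2 a3 b0 b1 b2 b3 c0 c1 c2 c3 d0 d1 d2 d3 :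
  k *: mx4 [:: [:: a0; a1; a2; a3]; [:: b0; b1; b2; b3];
          [:: c0; c1; c2; c3]; [:: d0; d1; d2; d3]]
  = mx4 [:: [:: k * a0; k * a1; k * a2; k * a3];
            [:: k * b0; k * b1; k * b2; k * b3];
            [:: k * c0; k * c1; k * c2; k * c3];
            [:: k * d0; k * d1; k * d2; k * d3]].
Proof.
by apply/matrixP; apply: forall_ord4; apply: forall_ord4; rewrite !mxE.
Qed.

Lemma mx4N a0 a1 a2 a3 b0 b1 b2 b3 c0 c1 c2 c3 d0 d1 d2 d3 :
  - mx4 [:: [:: a0; a1; a2; a3]; [:: b0; b1; b2; b3];
          [:: c0; c1; c2; c3]; [:: d0; d1; d2; d3]]
  = mx4 [:: [:: - a0; - a1; - a2; - a3]; [:: - b0; - b1; - b2; - b3];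
            [:: - c0; - c1; - c2; - c3]; [:: - d0; - d1; - d2; - d3]].
Proof.
by apply/matrixP; apply: forall_ord4; apply: forall_ord4; rewrite !mxE.
Qed.

Lemma mx4M a0 a1 a2 a3 b0 b1 b2 b3 c0 c1 c2 c3 d0 d1 d2 d3
    e0 e1 e2 e3 f0 f1 f2 f3 g0 g1 g2 g3 h0 h1 h2 h3 :
  mx4 [:: [:: a0; a1; a2; a3]; [:: b0; b1; b2; b3];
          [:: c0; c1; c2; c3]; [:: d0; d1; d2; d3]]
  *m mx4 [:: [:: e0; e1; e2; e3]; [:: f0; f1; f2; f3];
             [:: g0; g1; g2; g3]; [:: h0; h1; h2; h3]]
  = let dot u0 u1 u2 u3 v0 v1 v2 v3 := u0 * v0 + u1 * v1 + u2 * v2 + u3 * v3 in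
    let row u0 u1 u2 u3 := [:: dot u0 u1 u2 u3 e0 f0 g0 h0;
      dot u0 u1 u2 u3 e1 f1 g1 h1; dot u0 u1 u2 u3 e2 f2 g2 h2;
      dot u0 u1 u2 u3 e3 f3 g3 h3] in
    mx4 [:: row a0 a1 a2 a3; row b0 b1 b2 b3; row c0 c1 c2 c3; row d0 d1 d2 d3].
Proof.
by apply/matrixP; apply: forall_ord4; apply: forall_ord4; rewrite !mxE sum4 !mxE.
Qed.

Lemma dmx4 a x (a0 a1 a2 a3 b0 b1 b2 b3 c0 c1 c2 c3 d0 d1 d2 d3 : 'rV[R]_4 -> R) :
  dmx a (fun z => mx4 [:: [:: a0 z; a1 z; a2 z; a3 z]; [:: b0 z; b1 z; b2 z; b3 z];
          [:: c0 z; c1 z; c2 z; c3 z]; [:: d0 z; d1 z; d2 z; d3 z]]) x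
  = let d f := 'D_(evec a) f x in
    mx4 [:: [:: d a0; d a1; d a2; d a3]; [:: d b0; d b1; d b2; d b3];
            [:: d c0; d c1; d c2; d c3]; [:: d d0; d d1; d d2; d d3]].
Proof.
by apply/matrixP; apply: forall_ord4; apply: forall_ord4; rewrite !mxE /=;
  congr (derive _ x (evec a)); apply/funext => z; rewrite mxE.
Qed.

Lemma mx4_eq (a0 a1 a2 a3 b0 b1 b2 b3 c0 c1 c2 c3 d0 d1 d2 d3
    a0' a1' a2' a3' b0' b1' b2' b3' c0' c1' c2' c3' d0' d1' d2' d3' : R) :
  a0 = a0' -> a1 = a1' -> a2 = a2' -> a3 = a3' ->
  b0 = b0' -> b1 = b1' -> b2 = b2' -> b3 = b3' ->
  c0 = c0' -> c1 = c1' -> c2 = c2' -> c3 = c3' ->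
  d0 = d0' -> d1 = d1' -> d2 = d2' -> d3 = d3' ->
  mx4 [:: [:: a0; a1; a2; a3]; [:: b0; b1; b2; b3];
          [:: c0; c1; c2; c3]; [:: d0; d1; d2; d3]]
  = mx4 [:: [:: a0'; a1'; a2'; a3']; [:: b0'; b1'; b2'; b3'];
          [:: c0'; c1'; c2'; c3']; [:: d0'; d1'; d2'; d3']].
Proof. by do 16 move=> ->. Qed.

Definition row4 (a b c d : R) : X4 := \row_(j < 4) nth 0 [:: a; b; c; d] j.

Lemma row4D a b c d a' b' c' d' :
  row4 a b c d + row4 a' b' c' d' = row4 (a + a') (b + b') (c + c') (d + d').
Proof. by apply/rowP; apply: forall_ord4; rewrite !mxE. Qed.

Lemma row4Z e a b c d : e *: row4 a b c d = row4 (e * a) (e * b) (e * c) (e * d).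
Proof. by apply/rowP; apply: forall_ord4; rewrite !mxE. Qed.

Lemma row4_eq0 a b c d : row4 a b c d = 0 -> [/\ a = 0, b = 0, c = 0 & d = 0].
Proof.
move=> /rowP E; have := E it; have := E ir; have := E ith; have := E iph.
by rewrite !mxE.
Qed.

Lemma row4M (y : X4) a0 a1 a2 a3 b0 b1 b2 b3 c0 c1 c2 c3 d0 d1 d2 d3 :
  y *m mx4 [:: [:: a0; a1; a2; a3]; [:: b0; b1; b2; b3];
    [:: c0; c1; c2; c3]; [:: d0; d1; d2; d3]] =
  let dot u v w z := y 0 it * u + y 0 ir * v + y 0 ith * w + y 0 iph * z in
  row4 (dot a0 b0 c0 d0) (dot a1 b1 c1 d1) (dot a2 b2 c2 d2) (dot a3 b3 c3 d3).
Proof. by apply/rowP; apply: forall_ord4; rewrite !mxE sum4 !mxE. Qed.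

End ExplicitMatrices.

(** * Partial derivatives of functions of (t, r) and of theta *)

Section CoordinateDerivatives.
Context {R : realType}.
Local Notation X4 := 'rV[R]_4.
Implicit Types (x : X4) (a b : 'I_4) (f : R -> R -> R).

Definition trf f x : R := f (x 0 it) (x 0 ir).

Lemma evec_shift (h : R) a b x :
  (h *: evec a + x) 0 b = (if a == b then h else 0) + x 0 b.
Proof.
by rewrite !mxE /= eq_sym; case: eqP => _; rewrite ?mulr1 ?mulr0.
Qed.

Lemma derive_trf_t f x : 'D_(evec it) (trf f) x = trf (d_t f) x.
Proof.
rewrite /derive /trf /d_t derive1E /derive.
suff -> : (fun h : R => h^-1 *: ((trf f \o shift x) (h *: evec it) - trf f x)) =
  (fun h : R => h^-1 *: (((fun s => f s (x 0 ir)) \o shift (x 0 it)) (h *: 1)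
    - f (x 0 it) (x 0 ir))) by [].
by apply/funext => h; rewrite /trf /= !evec_shift /= add0r [_%:A]mulr1.
Qed.

Lemma derive_trf_r f x : 'D_(evec ir) (trf f) x = trf (d_r f) x.
Proof.
rewrite /derive /trf /d_r derive1E /derive.
suff -> : (fun h : R => h^-1 *: ((trf f \o shift x) (h *: evec ir) - trf f x)) =
  (fun h : R => h^-1 *: ((f (x 0 it) \o shift (x 0 ir)) (h *: 1)
    - f (x 0 it) (x 0 ir))) by [].
by apply/funext => h; rewrite /trf /= !evec_shift /= add0r [_%:A]mulr1.
Qed.

Lemma is_derive_invariant (F : X4 -> R) x v :
  (forall h, F (h *: v + x) = F x) -> is_derive x v F 0.
Proof.
move=> Fv; have E : (fun h : R => h^-1 *: ((F \o shift x) (h *: v) - F x)) = cst 0.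
  by apply/funext => h /=; rewrite Fv subrr scaler0.
by apply: DeriveDef; rewrite /derivable /derive E; [exact: is_cvg_cst|exact: lim_cst].
Qed.

Lemma derive_trf_th f x : 'D_(evec ith) (trf f) x = 0.
Proof.
have [] // := @is_derive_invariant (trf f) x (evec ith) _.
by move=> h; rewrite /trf !evec_shift /= !add0r.
Qed.

Lemma derive_trf_ph f x : 'D_(evec iph) (trf f) x = 0.
Proof.
have [] // := @is_derive_invariant (trf f) x (evec iph) _.
by move=> h; rewrite /trf !evec_shift /= !add0r.
Qed.

Definition thf (g : R -> R) x : R := g (x 0 ith).

Lemma is_derive_thf g dg x : is_derive (x 0 ith) 1 g dg ->
  is_derive x (evec ith) (thf g) dg.
Proof.
move=> [gd <-].
have E : (fun h : R => h^-1 *: ((thf g \o shift x) (h *: evec ith) - thf g x)) =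
  (fun h : R => h^-1 *: ((g \o shift (x 0 ith)) (h *: 1) - g (x 0 ith))).
  by apply/funext => h; rewrite /thf /= evec_shift /= [_%:A]mulr1.
by apply: DeriveDef; rewrite /derivable /derive E.
Qed.

Lemma derive_thf0 g x a : a != ith -> 'D_(evec a) (thf g) x = 0.
Proof.
move=> an; have [] // := @is_derive_invariant (thf g) x (evec a) _.
by move=> h; rewrite /thf evec_shift (negbTE an) add0r.
Qed.

Definition sin2 (s : R) := sin s ^+ 2.
Definition sincos (s : R) := sin s * cos s.
Definition cotan (s : R) := cos s / sin s.

Lemma is_derive_sin2 (s : R) : is_derive s 1 sin2 (2 * (sin s * cos s)).
Proof.
have -> : sin2 = (fun z : R => sin z : R) ^+ 2 by apply/funext => z.
apply: is_derive_eq; rewrite /GRing.scale /= expr1; ring.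
Qed.

Lemma is_derive_sincos (s : R) : is_derive s 1 sincos (cos s ^+ 2 - sin s ^+ 2).
Proof.
have -> : sincos = (fun z : R => sin z : R) * cos by apply/funext => z.
apply: is_derive_eq; rewrite /GRing.scale /=; ring.
Qed.

Lemma is_derive_cotan (s : R) : sin s != 0 ->
  is_derive s 1 cotan (- (sin s ^+ 2)^-1).
Proof.
move=> s0; have -> : cotan = (fun z : R => cos z : R) * (fun z => (sin z)^-1).
  by apply/funext => z.
have iV : is_derive s 1 (fun z : R => (sin z)^-1) (- (sin s) ^- 2 *: cos s).
  have [sd sE] := is_derive_sin s.
  by apply: DeriveDef; [exact: derivableV|rewrite deriveV// sE].
apply: is_derive_eq; rewrite /GRing.scale /=.
have := cos2Dsin2 s; move: (sin s) (cos s) s0 => u v u0 E.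
rewrite -[in RHS](mul1r (u ^+ 2)^-1) -E.
by field.
Qed.

Lemma open_slice (A : set (TM4 R)) x : open A -> open [set y | A (x, y)].
Proof.
move=> oA; apply: (open_comp (f := fun y : X4 => (x, y))) => // y _ B.
move=> [[B1 B2] /= [xB1 yB2] sub]; apply: filterS yB2 => z B2z; apply: sub.
by split => //=; exact: nbhs_singleton.
Qed.

Lemma open_perturb (S : set X4) y v : open S -> S y ->
  exists2 h : R, h != 0 & S (y + h *: v) /\ S (y - h *: v).
Proof.
move=> oS Sy; have [d d0 dS] := nbhs_parallelogram v 0 (open_nbhs_nbhs (conj oS Sy)).
exists d; first by rewrite gt_eqF.
have n0 : `|0 : R| <= d by rewrite normr0 ltW.
split.
  by have := dS d 0; rewrite scaler0 add0r addrC gtr0_norm//; exact.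
by have := dS (- d) 0; rewrite scaler0 add0r scaleNr addrC normrN gtr0_norm//; exact.
Qed.

Lemma open_coord_neq0 a : open [set y : X4 | y 0 a != 0].
Proof.
apply: (@open_comp _ _ (fun y : X4 => y 0 a) [set z | z != 0]).
  by move=> y _; exact: coord_continuous.
exact: open_neq.
Qed.

End CoordinateDerivatives.

(** * Linear spans and dimension 3 *)

Section LinearSpan.
Context {R : realType}.

Lemma lspan_gen (V : lmodType R) (S : set V) v : S v -> lspan S v.
Proof.
move=> Sv; exists 1%N, (fun=> 1), (fun=> v); split=> //.
by rewrite big_ord1 scale1r.
Qed.

Lemma lspan_scale (V : lmodType R) (S : set V) (c : R) v :
  lspan S v -> lspan S (c *: v).
Proof.
move=> [n [d [s [sS ->]]]]; exists n, (fun i => c * d i), s; split=> //.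
by rewrite scaler_sumr; apply: eq_bigr => i _; rewrite scalerA.
Qed.

Lemma lspan_add (V : lmodType R) (S : set V) v w :
  lspan S v -> lspan S w -> lspan S (v + w).
Proof.
move=> [n [c [s [sS ->]]]] [m [d [u [uS ->]]]].
exists (n + m)%N, (fun i => match fintype.split i with inl j => c j | inr j => d j end),
  (fun i => match fintype.split i with inl j => s j | inr j => u j end); split.
  by move=> i; case: fintype.split.
rewrite big_split_ord /=; congr (_ + _); apply: eq_bigr => i _.
  by rewrite (unsplitK (inl i : 'I_n + 'I_m)).
by rewrite (unsplitK (inr i : 'I_n + 'I_m)).
Qed.

Lemma has_dim3 (S : set 'rV[R]_4) v1 v2 v3 :
  (forall v, S v <-> exists c1 c2 c3 : R, v = c1 *: v1 + c2 *: v2 + c3 *: v3) ->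
  (forall c1 c2 c3 : R, c1 *: v1 + c2 *: v2 + c3 *: v3 = 0 ->
     [/\ c1 = 0, c2 = 0 & c3 = 0]) ->
  has_dim S 3.
Proof.
move=> SE ind; exists <<[:: v1; v2; v3]>>%VS; split.
  apply/seteqP; split=> v /=.
    move=> /SE[c1 [c2 [c3 ->]]].
    by rewrite !rpredD// rpredZ// memv_span// !inE eqxx ?orbT.
  rewrite !span_cons span_nil addv0 => /memv_addP[w1 /vlineP[c1 ->]].
  move=> [w /memv_addP[w2 /vlineP[c2 ->] [w3 /vlineP[c3 ->] ->]] ->].
  by apply/SE; exists c1, c2, c3; rewrite addrA.
apply/eqP; rewrite -[3%N]/(size [:: v1; v2; v3]) -/(free _).
rewrite !free_cons nil_free andbT !span_cons span_nil addv0.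
apply/and3P; split.
- apply/negP => /memv_addP[w2 /vlineP[c2 ->] [w3 /vlineP[c3 ->] E]].
  have [|/eqP] := ind (-1) c2 c3; last by rewrite oppr_eq0 oner_eq0.
  by rewrite E scaleN1r -addrA addNr.
- apply/negP => /vlineP[c3 E].
  have [|_ /eqP] := ind 0 (-1) c3; last by rewrite oppr_eq0 oner_eq0.
  by rewrite E scale0r add0r scaleN1r addNr.
- apply/negP; rewrite memv0 => /eqP E.
  have [|_ _ /eqP] := ind 0 0 1; last by rewrite oner_eq0.
  by rewrite E !scale0r scaler0 !addr0.
Qed.

End LinearSpan.

(** * Pointwise algebra of the curvature relations and of the rank *)

Section PointwiseAlgebra.
Context {R : realType}.

(** Read a h, b h, (a b + c) h, h as k7, k8, k9, k10, and [y1] to [y5] as a1 to a5. The relations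
    then say that (k7, k10) is a left eigenvector of the (t, r) block of B with eigenvalue [p], that
    (k8, k9) is a right eigenvector with eigenvalue 2 a5 - p, and that p = a5 unless the two vectors
    pair to zero. *)
Lemma curvature_block_algebra (a b c h y1 y2 y3 y4 y5 : R) : h != 0 ->
  let p := a * y3 + y4 in
  b * (a * y1 + y2) + (a * b + c) * p - y5 * (2 * a * b + c) = 0 ->
  a * p - (a * y1 + y2) = 0 ->
  (a * b + c) * y3 + b * p + b * (y1 - 2 * y5) = 0 ->
  [/\ a * h * y1 + h * y2 = a * h * p,
      b * h * y1 + (a * b + c) * h * y3 = b * h * (2 * y5 - p),
      b * h * y2 + (a * b + c) * h * y4 = (a * b + c) * h * (2 * y5 - p) &
      (a * h * (b * h) + (a * b + c) * h * h) * (p - y5) = 0].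
Proof.
move=> h0 p r1 r2 r3.
have y2E : y2 = a * p - a * y1 by apply/eqP; rewrite -subr_eq0 -oppr_eq0 -r2; apply/eqP; ring.
have y4E : y4 = p - a * y3 by rewrite /p; ring.
have q3 : (a * b + c) * y3 = b * (2 * y5 - p) - b * y1.
  by apply/eqP; rewrite -subr_eq0 -r3; apply/eqP; ring.
have q1 : (2 * a * b + c) * p = (2 * a * b + c) * y5.
  apply/eqP; rewrite -subr_eq0 -r1 y2E; apply/eqP; ring.
move: p r1 r2 r3 y2E y4E q3 q1 => p _ _ _ y2E y4E q3 q1; split.
- rewrite y2E; ring.
- rewrite (_ : _ + _ = h * (b * y1 + (a * b + c) * y3)); last ring.
  rewrite q3; ring.
- rewrite y2E y4E.
  rewrite (_ : _ + _ = h * (2 * ((2 * a * b + c) * p) - (a * b + c) * p - a * (b * p) - a * (b * y1) - a * ((a * b + c) * y3))); last ring.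
  rewrite q1 q3; ring.
- by rewrite (_ : _ * _ = h ^+ 2 * ((2 * a * b + c) * p - (2 * a * b + c) * y5)); [rewrite q1 subrr mulr0|ring].
Qed.

(** Case sigma(y) = [s] <> 0, with frame V_theta, V_phi, B. The (t, r) parts of V_theta and V_phi
    are multiples of (k7, k10); eliminating them leaves c3 F u = 0 up to nonzero factors. If c3 were
    nonzero, then u = 0, and the remaining equations would give v = 0. *)
Lemma rank3_generic (yt yr yh yp s q7 q8 q9 q10 b1 b2 b3 b4 b5 p z : R) :
  q10 != 0 -> b5 != 0 -> q7 * b3 - q10 * b1 != 0 ->
  q7 * b1 + q10 * b2 = q7 * p -> q7 * b3 + q10 * b4 = q10 * p ->
  (q7 * q8 + q9 * q10) * (p - b5) = 0 ->
  s = yt * q8 + yr * q9 -> s != 0 ->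
  ~ (q10 * yt - q7 * yr = 0 /\
     (q7 * q8 + q9 * q10) * yr ^+ 2 = q10 ^+ 2 * (yh ^+ 2 + yp ^+ 2 * z)) ->
  forall c1 c2 c3 : R,
  c1 * (yh * q7) + c2 * (yp * (q7 * z)) + c3 * (yt * b1 + yr * b2) = 0 ->
  c1 * (yh * q10) + c2 * (yp * (q10 * z)) + c3 * (yt * b3 + yr * b4) = 0 ->
  c1 * s + c3 * (yh * b5) = 0 -> c2 * s + c3 * (yp * b5) = 0 ->
  [/\ c1 = 0, c2 = 0 & c3 = 0].
Proof.
move=> q0 b50 F0 r1 r2 r3 sE s0 excl c1 c2 c3 et er eh ep.
have [c30|c30] := eqVneq c3 0.
  move: eh ep; rewrite c30 !mul0r !addr0 => /eqP; rewrite mulf_eq0 (negbTE s0) orbF.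
  move=> /eqP -> /eqP; rewrite mulf_eq0 (negbTE s0) orbF => /eqP -> //.
exfalso; apply: excl.
have U0 : q10 * yt - q7 * yr = 0.
  have : c3 * ((q7 * b3 - q10 * b1) * (q10 * yt - q7 * yr)) = 0.
    have -> : c3 * ((q7 * b3 - q10 * b1) * (q10 * yt - q7 * yr)) =
      q10 * q7 * (c1 * (yh * q10) + c2 * (yp * (q10 * z)) + c3 * (yt * b3 + yr * b4))
      - q10 ^+ 2 * (c1 * (yh * q7) + c2 * (yp * (q7 * z)) + c3 * (yt * b1 + yr * b2))
      + c3 * yr * (q10 * (q7 * b1 + q10 * b2) - q7 * (q7 * b3 + q10 * b4)) by ring.
    by rewrite et er r1 r2; ring.
  by move=> /eqP; rewrite !mulf_eq0 (negbTE c30) (negbTE F0) => /eqP.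
split=> //; apply/eqP; rewrite -subr_eq0.
have : c3 * b5 * ((q7 * q8 + q9 * q10) * yr ^+ 2 - q10 ^+ 2 * (yh ^+ 2 + yp ^+ 2 * z)) = 0.
  have ytE : q10 * yt = q7 * yr by apply/eqP; rewrite -subr_eq0 U0.
  have sq : q10 * s = (q7 * q8 + q9 * q10) * yr by rewrite sE mulrDr mulrA ytE; ring.
  have e1 : c1 * s = - (c3 * (yh * b5)) by apply/eqP; rewrite -addr_eq0 eh.
  have e2 : c2 * s = - (c3 * (yp * b5)) by apply/eqP; rewrite -addr_eq0 ep.
  have e3 : q10 * (yt * b3 + yr * b4) = q10 * p * yr.
    by rewrite mulrDr mulrA ytE -r2; ring.
  have e4 : (q7 * q8 + q9 * q10) * p = (q7 * q8 + q9 * q10) * b5.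
    by apply/eqP; rewrite -subr_eq0 -mulrBr r3.
  (* The factor [s] turns c1 and c2 into multiples of c3 through [e1] and [e2]; the factor [q10]
     lets [e3] use u = 0. *)
  have : q10 * s * (c1 * (yh * q10) + c2 * (yp * (q10 * z)) + c3 * (yt * b3 + yr * b4)) = 0.
    by rewrite er mulr0.
  have -> : q10 * s * (c1 * (yh * q10) + c2 * (yp * (q10 * z)) + c3 * (yt * b3 + yr * b4))
    = q10 ^+ 2 * (c1 * s * yh + c2 * s * yp * z) + s * c3 * (q10 * (yt * b3 + yr * b4)) by ring.
  rewrite e1 e2 e3.
  have -> : s * c3 * (q10 * p * yr) = c3 * yr * p * (q10 * s) by ring.
  rewrite sq => e5.
  have -> : c3 * b5 * ((q7 * q8 + q9 * q10) * yr ^+ 2 - q10 ^+ 2 * (yh ^+ 2 + yp ^+ 2 * z))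
    = c3 * yr ^+ 2 * ((q7 * q8 + q9 * q10) * b5) - c3 * b5 * (q10 ^+ 2 * (yh ^+ 2 + yp ^+ 2 * z)) by ring.
  rewrite -e4 -[RHS]e5; ring.
by move=> /eqP; rewrite !mulf_eq0 (negbTE c30) (negbTE b50).
Qed.

(** Case sigma(y) = 0, with frame (k7, k10, 0, 0), the rotation and B. On the angular components the
    rotation and B act as a quarter turn and a homothety, hence give orthogonal vectors for the form
    with weights 1 and [z]. *)
Lemma rank3_special (yh yp q10 b3 b5 z : R) :
  q10 != 0 -> b5 != 0 -> 0 < z -> (yh, yp) != (0, 0) ->
  forall c1 c2 c3 : R,
  c1 * q10 + c3 * b3 = 0 ->
  c2 * (yp * z) + c3 * (yh * b5) = 0 -> - (c2 * yh) + c3 * (yp * b5) = 0 ->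
  [/\ c1 = 0, c2 = 0 & c3 = 0].
Proof.
move=> q0 b50 z0 yn c1 c2 c3 er eh ep.
have W0 : yh ^+ 2 + yp ^+ 2 * z != 0.
  have h2 : 0 <= yp ^+ 2 * z by rewrite mulr_ge0 ?sqr_ge0// ltW.
  apply: contra yn; rewrite paddr_eq0 ?sqr_ge0//.
  by rewrite sqrf_eq0 mulf_eq0 sqrf_eq0 (gt_eqF z0) orbF => /andP[/eqP -> /eqP ->].
have c30 : c3 = 0.
  have : c3 * b5 * (yh ^+ 2 + yp ^+ 2 * z) = 0.
    have -> : c3 * b5 * (yh ^+ 2 + yp ^+ 2 * z) = yh * (c2 * (yp * z) + c3 * (yh * b5))
       + yp * z * (- (c2 * yh) + c3 * (yp * b5)) by ring.
    by rewrite eh ep; ring.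
  by move=> /eqP; rewrite !mulf_eq0 (negbTE b50) (negbTE W0) !orbF => /eqP.
have c20 : c2 = 0.
  have : c2 * (yh ^+ 2 + yp ^+ 2 * z) = 0.
    have -> : c2 * (yh ^+ 2 + yp ^+ 2 * z) = yp * (c2 * (yp * z) + c3 * (yh * b5))
       - yh * (- (c2 * yh) + c3 * (yp * b5)) by ring.
    by rewrite eh ep; ring.
  by move=> /eqP; rewrite mulf_eq0 (negbTE W0) orbF => /eqP.
split=> //; move: er; rewrite c30 mul0r addr0 => /eqP.
by rewrite mulf_eq0 (negbTE q0) orbF => /eqP.
Qed.

End PointwiseAlgebra.

(** * One-variable behaviour of power laws at their null set *)

Section RealPowers.
Context {R : realType}.
Implicit Types (x y p lam th d : R) (m n : nat).

Lemma normXz x (z : int) : `|x ^ z| = `|x| ^ z.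
Proof. by case: z => n; rewrite -?exprnP ?NegzE -?exprnN ?normfV normrX. Qed.

(** An equation between integer powers of absolute values covers both branches of [real_power],
    including negative bases, and is all that the growth estimates use. *)
Lemma real_power_norm x y (z : int) n : odd n -> x != 0 \/ 0 <= z ->
  real_power x (z%:~R / n%:R) y -> `|y| ^+ n = `|x| ^ z.
Proof.
move=> on xz; have n0 : (n%:R : R) != 0 by rewrite pnatr_eq0; case: n on.
case=> [[x0 ->]|[w [m [om zw _ E]]]].
  rewrite !gtr0_norm ?powR_gt0// -powR_mulrn ?powR_ge0// -powRrM divfK//.
  by rewrite powR_intmul// ltW.
have m0 : (m%:R : R) != 0 by rewrite pnatr_eq0; case: m om {zw E}.
have zmw : z * m = w * n.
  have : (z%:~R : R) * m%:R = w%:~R * n%:R.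
    by rewrite -[z%:~R](divfK n0) zw mulrAC divfK.
  by rewrite -[m%:R]/((m : int)%:~R) -[n%:R]/((n : int)%:~R) -!intrM => /intr_inj.
have mp : (0 < m)%N by case: m om {zw E m0 zmw}.
(* The fraction w / m witnessing the power need not be z / n; a further m-th power lets the two be
   compared by [zmw]. *)
apply/eqP; rewrite -(eqrXn2 mp) ?exprn_ge0//; last first.
  by rewrite -normXz.
rewrite -exprM mulnC exprM -normrX E normXz !exprnP !exprz_exp zmw.
by rewrite [w * _]mulrC.
Qed.

Lemma odd_exprn_inj n (x y : R) : odd n -> x ^+ n = y ^+ n -> x = y.
Proof.
move=> on E; have n0 : (0 < n)%N by case: n on {E}.
have : `|x| == `|y| by rewrite -(eqrXn2 n0)// -!normrX E.
rewrite eqr_norm2 => /orP[/eqP//|/eqP xE].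
move: E; rewrite xE exprNn -signr_odd on expr1 mulN1r => /eqP.
rewrite -subr_eq0 -opprD oppr_eq0 -mulr2n mulrn_eq0 /= expf_eq0 n0 /= => /eqP ->.
by rewrite oppr0.
Qed.

Lemma real_power_nat x k y : real_power x k%:R y -> y = x ^+ k.
Proof.
case=> [[x0 ->]|[z [n [on zn _ E]]]]; first by rewrite powR_mulrn// ltW.
have n0 : (n%:R : R) != 0 by rewrite pnatr_eq0; case: n on {zn E}.
have zE : z = (k * n)%N.
  have : (z%:~R : R) = (k * n)%:R by rewrite natrM zn divfK.
  by rewrite -[_%:R]/(((k * n)%N : int)%:~R) => /intr_inj.
by apply: (odd_exprn_inj on); rewrite E zE -exprnP exprM.
Qed.

(** The mere existence of a power of 0 forces the exponent to be a positive fraction with odd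
    denominator. *)
Lemma real_power0 lam y : lam != 0 -> real_power 0 lam y ->
  exists m n, [/\ odd n, (0 < m)%N & lam = m%:R / n%:R].
Proof.
move=> l0 [[]|[z [n [on zn z0 E]]]]; first by rewrite ltxx.
have {z0} : 0 <= z by case: z0 => //; rewrite eqxx.
case: z zn E => // m zn E _; exists m, n; split=> //.
by rewrite lt0n; apply: contra l0 => /eqP m0; rewrite zn m0 mul0r.
Qed.

Lemma real_power0_ge0 lam y : real_power 0 lam y -> 0 <= lam.
Proof.
have [->//|l0 /(real_power0 l0)[m [n [_ _ ->]]]] := eqVneq lam 0.
by rewrite divr_ge0.
Qed.

Lemma cvg_growth (phi : R -> R) d : is_derive (0 : R) 1 phi d -> phi 0 = 0 ->
  (h^-1 * phi h) @[h --> 0^'] --> d.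
Proof.
move=> [pd <-] p0.
have E : (fun h : R => h^-1 * phi h)
   = (fun h => h^-1 *: ((phi \o shift 0) (h *: 1) - phi 0)).
  by apply/funext => h /=; rewrite addr0 p0 subr0 [_%:A]mulr1.
by rewrite E; exact: pd.
Qed.

Lemma cvg_dnbhs (f : R -> R) : {for 0, continuous f} -> f h @[h --> 0^'] --> f 0.
Proof. by move/continuous_withinNx. Qed.

Lemma dnbhs_lim_eq (f g : R -> R) (a b : R) :
  f h @[h --> 0^'] --> a -> g h @[h --> 0^'] --> b ->
  (\forall h \near 0, h != 0 -> f h = g h) -> a = b.
Proof.
move=> fa gb fg; apply: (@norm_cvg_unique _ _ (g h @[h --> 0^'])) => //.
apply: cvg_trans fa; apply: near_eq_cvg; rewrite near_withinE.
by apply: filterS fg => h fgh h0; rewrite fgh.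
Qed.

Lemma continuous_normX n (f : R -> R) (x : R) : {for x, continuous f} ->
  {for x, continuous (fun z => `|f z| ^+ n)}.
Proof.
move=> fc; apply: (@continuous_comp _ _ _ (fun z => `|f z|) (fun z => z ^+ n)).
  by apply: continuous_comp => //; exact: norm_continuous.
exact: exprn_continuous.
Qed.

Lemma cvg_normX n (f : R -> R) d : f h @[h --> 0^'] --> d ->
  `|f h| ^+ n @[h --> 0^'] --> `|d| ^+ n.
Proof.
move=> fd; apply: (@continuous_cvg _ _ _ _ _ f (fun z => `|z| ^+ n)) fd.
by apply: continuous_normX; exact: cvg_id.
Qed.

(** Here [phi] is L along a line through a point with u = v = 0, so both bases vanish to first order
    at least. With lam = m / n, the n-th power of |phi h| has order at least 2 (n - m) + m > n in
    |h|, so the derivative at 0 vanishes. *)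
Lemma power_law_flat_null (phi : R -> R) (u1 q1 q2 th lam d : R) :
  lam != 0 -> lam != 1 -> is_derive (0 : R) 1 phi d ->
  (\forall h \near 0, exists P Q, [/\ real_power (h * u1) (2 - 2 * lam) P,
     real_power (h * (q1 + h * q2)) lam Q & phi h = th * P * Q]) -> d = 0.
Proof.
move=> l0 l1 pd near_phi.
have [P0 [Q0 []]] := nbhs_singleton near_phi.
rewrite !mul0r => hP hQ phi0E.
have [m [n [on m0 lE]]] := real_power0 l0 hQ.
have n0 : (0 < n)%N by case: n on {lE}.
have nR : (n%:R : R) != 0 by rewrite pnatr_eq0 -lt0n.
have mn : (m < n)%N.
  (* The base u also vanishes at h = 0, so its exponent 2 - 2 lam is nonnegative, that is lam <=
     1. *)
  have := real_power0_ge0 hP; rewrite -{1}[2]mulr1 -mulrBr pmulr_rge0// subr_ge0 => ll1.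
  have : lam < 1 by rewrite lt_neqAle l1.
  by rewrite lE ltr_pdivrMr ?ltr0n// mul1r ltr_nat.
have lZ : lam = (m : int)%:~R / n%:R by [].
have lZ2 : 2 - 2 * lam = ((2 * (n - m))%N : int)%:~R / n%:R.
  rewrite lE -[_%:~R]/((2 * (n - m))%:R) natrM natrB ?(ltnW mn)//; field.
  exact: nR.
have phi0 : phi 0 = 0.
  have : `|Q0| ^+ n = 0.
    rewrite lZ in hQ; rewrite (real_power_norm on _ hQ) ?normr0; last by right.
    by rewrite -exprnP expr0n gtn_eqF.
  by move=> /eqP; rewrite expf_eq0 normr_eq0 n0 /= => /eqP Q00; rewrite phi0E Q00 mulr0.
have psi := cvg_growth pd phi0.
have psin : (`|h^-1 * phi h| ^+ n) @[h --> 0^'] --> `|d| ^+ n.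
  exact: cvg_normX.
(* The n-th power of the absolute difference quotient, in a form continuous at 0 where it vanishes
   because m < n. *)
pose g (h : R) := `|th| ^+ n * `|u1| ^+ (2 * (n - m)) * `|q1 + h * q2| ^+ m * `|h| ^+ (n - m).
have gc : {for 0, continuous g}.
  apply: continuousM; last first.
    by apply: continuous_normX; exact: cvg_id.
  apply: continuousM; first exact: cvg_cst.
  apply: continuous_normX.
  by apply: continuousD; [exact: cvg_cst|apply: continuousM; [exact: cvg_id|exact: cvg_cst]].
have E : `|d| ^+ n = g 0.
  apply: (dnbhs_lim_eq psin (cvg_dnbhs gc)).
  near=> h => h0.
  have [P [Q [hP' hQ' ->]]] : exists P Q, [/\ real_power (h * u1) (2 - 2 * lam) P,
     real_power (h * (q1 + h * q2)) lam Q & phi h = th * P * Q] by near: h.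
  rewrite lZ2 in hP'; rewrite lZ in hQ'.
  have EP := real_power_norm on (or_intror _) hP'.
  have EQ := real_power_norm on (or_intror _) hQ'.
  rewrite !normrM !exprMn EP// EQ// -!exprnP !normrM !exprMn normfV exprVn /g.
  have nh0 : `|h| != 0 by rewrite normr_eq0.
  have key : (`|h| ^+ n)^-1 * (`|h| ^+ (2 * (n - m)) * `|h| ^+ m) = `|h| ^+ (n - m).
    rewrite -exprD mul2n -addnn -addnA subnK 1?ltnW// exprD mulrCA mulVf ?mulr1//.
    by rewrite expf_neq0.
  rewrite -key; ring.
move: E; rewrite /g normr0 expr0n subn_eq0 leqNgt mn /= mulr0 => /eqP.
by rewrite expf_eq0 normr_eq0 n0 => /eqP.
Unshelve. all: by end_near. Qed.


Lemma near_affine_neq0 (u0 u1 : R) : u0 != 0 -> \forall h \near 0, u0 + h * u1 != 0.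
Proof.
move=> un; have : {for 0, continuous (fun h : R => u0 + h * u1)}.
  by apply: continuousD; [exact: cvg_cst|apply: continuousM; [exact: cvg_id|exact: cvg_cst]].
move=> uc; apply: (uc [set z | z != 0]); apply: open_nbhs_nbhs.
by split; [exact: open_neq|rewrite /= mul0r addr0].
Qed.

(** The case u <> 0 with the second base of exact form q h^2. As lam may exceed 1, the exponent 2 -
    2 lam may be negative; multiplying by |u|^(2 m) keeps all exponents natural. *)
Lemma power_law_cone_identity (phi : R -> R) (u0 u1 q th lam : R) :
  u0 != 0 -> lam != 0 ->
  (\forall h \near 0, exists P Q, [/\ real_power (u0 + h * u1) (2 - 2 * lam) P,
     real_power (q * h ^+ 2) lam Q & phi h = th * P * Q]) ->
  phi 0 = 0 /\ exists m n, [/\ odd n, lam = m%:R / n%:R &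
    \forall h \near 0, `|phi h| ^+ n * `|u0 + h * u1| ^+ (2 * m)
      = `|th| ^+ n * `|u0 + h * u1| ^+ (2 * n) * (`|q| ^+ m * `|h| ^+ (2 * m))].
Proof.
move=> un l0 near_phi.
have [P0 [Q0 []]] := nbhs_singleton near_phi.
rewrite expr0n mulr0 => _ hQ phi0E.
have [m [n [on m0 lE]]] := real_power0 l0 hQ.
have n0 : (0 < n)%N by case: n on {lE}.
have nR : (n%:R : R) != 0 by rewrite pnatr_eq0 -lt0n.
have lZ : lam = (m : int)%:~R / n%:R by [].
have lZ2 : 2 - 2 * lam = ((2 * n)%N%:Z - (2 * m)%N%:Z)%:~R / n%:R.
  rewrite lE intrB -[(2 * n)%N%:~R]/((2 * n)%:R) -[(2 * m)%N%:~R]/((2 * m)%:R).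
  rewrite !natrM; field; exact: nR.
split.
  have : `|Q0| ^+ n = 0.
    rewrite lZ in hQ; rewrite (real_power_norm on _ hQ) ?normr0; last by right.
    by rewrite -exprnP expr0n gtn_eqF.
  by move=> /eqP; rewrite expf_eq0 normr_eq0 n0 /= => /eqP Q00; rewrite phi0E Q00 mulr0.
exists m, n; split=> //; near=> h.
have u0h : u0 + h * u1 != 0 by near: h; exact: near_affine_neq0.
have [P [Q [hP' hQ' ->]]] : exists P Q, [/\ real_power (u0 + h * u1) (2 - 2 * lam) P,
   real_power (q * h ^+ 2) lam Q & phi h = th * P * Q] by near: h.
rewrite lZ2 in hP'; rewrite lZ in hQ'.
have EP := real_power_norm on (or_introl u0h) hP'.
have EQ := real_power_norm on (or_intror _) hQ'.
have unz : `|u0 + h * u1| != 0 by rewrite normr_eq0.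
have key : `|P| ^+ n * `|u0 + h * u1| ^+ (2 * m) = `|u0 + h * u1| ^+ (2 * n).
  by rewrite EP exprnP -expfzDr// subrK.
rewrite !normrM !exprMn EQ// -exprnP normrM exprMn normrX -exprM -key; ring.
Unshelve. all: by end_near. Qed.

Lemma cvg_affine_normX (u0 u1 : R) n :
  `|u0 + h * u1| ^+ n @[h --> 0^'] --> `|u0| ^+ n.
Proof.
have : {for 0, continuous (fun h : R => `|u0 + h * u1| ^+ n)}.
  apply: continuous_normX.
  by apply: continuousD; [exact: cvg_cst|apply: continuousM; [exact: cvg_id|exact: cvg_cst]].
by move/cvg_dnbhs; rewrite mul0r addr0.
Qed.

Lemma cvg_normX0 n : (0 < n)%N -> `|h : R| ^+ n @[h --> 0^'] --> (0 : R).
Proof.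
move=> n0; have : {for 0, continuous (fun h : R => `|h| ^+ n)}.
  by apply: continuous_normX; exact: cvg_id.
by move/cvg_dnbhs; rewrite normr0 expr0n gtn_eqF.
Qed.

(** If [q] is nonzero, |phi h| grows like |h|^(2 lam), which is not differentiable at 0 when 2 lam
    <= 1. *)
Lemma power_law_cone_exponent (phi : R -> R) (u0 u1 q th lam d : R) :
  u0 != 0 -> lam != 0 -> q != 0 -> th != 0 -> is_derive (0 : R) 1 phi d ->
  (\forall h \near 0, exists P Q, [/\ real_power (u0 + h * u1) (2 - 2 * lam) P,
     real_power (q * h ^+ 2) lam Q & phi h = th * P * Q]) -> 1 < 2 * lam.
Proof.
move=> un l0 q0 th0 pd near_phi.
have [phi0 [m [n [on lE near_id]]]] := power_law_cone_identity un l0 near_phi.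
have n0 : (0 < n)%N by case: n on {lE near_id}.
rewrite lE mulrA ltr_pdivlMr ?ltr0n// mul1r -natrM ltr_nat ltnNge.
(* The borderline 2 lam = 1, where phi would behave like |h|, is excluded by the parity of [n]. *)
apply/negP; rewrite leq_eqVlt => /orP[/eqP nE|mn]; first by move: on; rewrite -nE mul2n odd_double.
have psin := cvg_normX (n := n) (cvg_growth pd phi0).
have F1 : `|h^-1 * phi h| ^+ n * `|u0 + h * u1| ^+ (2 * m) * `|h| ^+ (n - 2 * m)
    @[h --> 0^'] --> `|d| ^+ n * `|u0| ^+ (2 * m) * 0.
  apply: cvgM; last by apply: cvg_normX0; rewrite subn_gt0.
  by apply: cvgM => //; exact: cvg_affine_normX.
have F2 : `|th| ^+ n * `|q| ^+ m * `|u0 + h * u1| ^+ (2 * n)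
    @[h --> 0^'] --> `|th| ^+ n * `|q| ^+ m * `|u0| ^+ (2 * n).
  by apply: cvgM; [exact: cvg_cst|exact: cvg_affine_normX].
have := dnbhs_lim_eq F1 F2; rewrite mulr0 => E.
have /eqP : 0 = `|th| ^+ n * `|q| ^+ m * `|u0| ^+ (2 * n).
  apply: E; apply: filterS near_id => h id h0.
  rewrite normrM exprMn normfV exprVn.
  have nh0 : `|h| != 0 by rewrite normr_eq0.
  have key : (`|h| ^+ n)^-1 * (`|h| ^+ (2 * m) * `|h| ^+ (n - 2 * m)) = 1.
    by rewrite -exprD subnKC 1?ltnW// mulVf// expf_neq0.
  transitivity ((`|h| ^+ n)^-1 * (`|phi h| ^+ n * `|u0 + h * u1| ^+ (2 * m)) * `|h| ^+ (n - 2 * m)).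
    by ring.
  rewrite id -[RHS]mulr1 -key; ring.
by rewrite eq_sym !mulf_eq0 !expf_eq0 !normr_eq0 (negbTE un) (negbTE q0) (negbTE th0) !andbF.
Qed.

(** Now the difference quotient is of order |h|^(2 lam - 1). Since [q] may vanish, this applies in
    every direction once a single one has bounded the exponent. *)
Lemma power_law_cone_null (phi : R -> R) (u0 u1 q th lam d : R) :
  u0 != 0 -> 1 < 2 * lam -> is_derive (0 : R) 1 phi d ->
  (\forall h \near 0, exists P Q, [/\ real_power (u0 + h * u1) (2 - 2 * lam) P,
     real_power (q * h ^+ 2) lam Q & phi h = th * P * Q]) -> d = 0.
Proof.
move=> un l1 pd near_phi.
have l0 : lam != 0 by apply: contraTneq l1 => ->; rewrite mulr0 ltr10.
have [phi0 [m [n [on lE near_id]]]] := power_law_cone_identity un l0 near_phi.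
have n0 : (0 < n)%N by case: n on {lE near_id}.
have {l1}mn : (n < 2 * m)%N.
  by move: l1; rewrite lE mulrA ltr_pdivlMr ?ltr0n// mul1r -natrM ltr_nat.
have psin := cvg_normX (n := n) (cvg_growth pd phi0).
have F1 : `|h^-1 * phi h| ^+ n * `|u0 + h * u1| ^+ (2 * m)
    @[h --> 0^'] --> `|d| ^+ n * `|u0| ^+ (2 * m).
  by apply: cvgM => //; exact: cvg_affine_normX.
have F2 : `|th| ^+ n * `|q| ^+ m * `|u0 + h * u1| ^+ (2 * n) * `|h| ^+ (2 * m - n)
    @[h --> 0^'] --> `|th| ^+ n * `|q| ^+ m * `|u0| ^+ (2 * n) * 0.
  apply: cvgM; last by apply: cvg_normX0; rewrite subn_gt0.
  by apply: cvgM; [exact: cvg_cst|exact: cvg_affine_normX].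
have := dnbhs_lim_eq F1 F2; rewrite mulr0 => E.
have /eqP : `|d| ^+ n * `|u0| ^+ (2 * m) = 0.
  apply: E; apply: filterS near_id => h id h0.
  have nh0 : `|h| != 0 by rewrite normr_eq0.
  have key : (`|h| ^+ n)^-1 * `|h| ^+ (2 * m) = `|h| ^+ (2 * m - n).
    by rewrite -{1}(subnKC (ltnW mn)) exprD mulKf// expf_neq0.
  rewrite normrM exprMn normfV exprVn.
  transitivity ((`|h| ^+ n)^-1 * (`|phi h| ^+ n * `|u0 + h * u1| ^+ (2 * m))); first ring.
  rewrite id -key; ring.
by rewrite mulf_eq0 !expf_eq0 !normr_eq0 (negbTE un) andbF orbF n0 => /eqP.
Qed.

End RealPowers.

(** * Finsler gradient and the Ricci identity *)

Section FinslerGradient.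
Context {R : realType}.
Local Notation X4 := 'rV[R]_4.
Local Notation TM := (TM4 R).

Lemma derive_scale (V : normedModType R) (f : V -> R) x v (s : R) :
  derivable f x v -> derivable f x (s *: v) -> 'D_(s *: v) f x = s * 'D_v f x.
Proof.
move=> fv fsv.
have dv : is_derive (0 * s) 1 (fun t : R => f (t *: v + x)) ('D_v f x).
  have E0 : 0 *: v + x = x by rewrite scale0r add0r.
  by have := @is_derive_line _ _ f x v 0; rewrite mul0r E0; apply.
have dsv : is_derive (0 : R) 1 (fun t : R => f (t *: (s *: v) + x)) ('D_(s *: v) f x).
  have E0 : 0 *: (s *: v) + x = x by rewrite scale0r add0r.
  by have := @is_derive_line _ _ f x (s *: v) 0; rewrite E0; apply.
have ds : is_derive (0 : R) 1 (fun t : R => t * s) s.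
  have -> : (fun t : R => t * s) = id * cst s by apply/funext => t.
  by apply: is_derive_eq; rewrite scaler0 add0r [s *: _]mulr1.
have [_ E] := @is_derive1_comp _ _ (fun t : R => t * s) 0 _ _ dv ds.
have [_ <-] := dsv; rewrite [RHS]mulrC -E.
suff -> : (fun t : R => f (t *: (s *: v) + x)) =
    (fun t : R => f (t *: v + x)) \o *%R^~ s by [].
by apply/funext => t /=; rewrite scalerA.
Qed.

Lemma derive_sum_dir (V : normedModType R) (U : set V) (f : V -> R) x (n : nat)
    (c : 'I_n -> R) (v : 'I_n -> V) : open U -> Ck_on 1 U f -> U x ->
  'D_(\sum_(a < n) c a *: v a) f x = \sum_(a < n) c a * 'D_(v a) f x.
Proof.
move=> oU fC Ux; have fd w : derivable f x w by move: fC => [_ /(_ w)[fd _]]; exact: fd.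
apply: (big_rec2 (fun w d => 'D_w f x = d)); first by rewrite derive0.
by move=> a w d _ <-; rewrite (derive_dirD _ _ oU)// derive_scale.
Qed.

Lemma vertical_decomposition (y : X4) :
  ((0, y) : TM) = \sum_(a < 4) y 0 a *: ((0, evec a) : TM).
Proof.
rewrite sum4; apply: injective_projections => /=; first by rewrite !scaler0 !addr0.
by apply/rowP; apply: forall_ord4; rewrite !mxE /=; ring.
Qed.

(* Euler's relation for the 1-homogeneous functions dotpar b L gives
   y *m fund_tensor L = dL / 2, which cannot vanish as y is nonzero. *)
Lemma finsler_gradient_neq0 (M : set X4) (A : set TM) (L : TM -> R) (p : TM) :
  pseudo_finsler M A L -> A p -> ~ (forall a, dotpar a L p = 0).
Proof.
case: p => x y [[oA A0 _ As] Ls Lh Lu] Axy grad0.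
have Ld z w : A z -> derivable L z w by move=> Az; exact: smooth_derivable Az Ls.
have hom b (s : R) : 0 < s -> dotpar b L (x, s *: y) = s * dotpar b L (x, y).
  (* Differentiating [psi] by the chain rule and by 2-homogeneity of L shows that [dotpar b L] is
     1-homogeneous. *)
  move=> s0; pose psi (z : TM) : R := L (z.1, s *: z.2).
  have Asz : A (x, s *: y) by exact: As.
  have D1 : 'D_(0, evec b) psi (x, y) = 'D_(s *: (0, evec b)) L (x, s *: y).
    have E : (fun h : R => h^-1 *: ((psi \o shift ((x, y) : TM)) (h *: ((0, evec b) : TM))
        - psi (x, y)))
      = (fun h : R => h^-1 *: ((L \o shift ((x, s *: y) : TM))
          (h *: (s *: ((0, evec b) : TM))) - L (x, s *: y))).
      apply/funext => h; rewrite /psi /=; congr (_ *: (L _ - _)).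
      apply: injective_projections; rewrite /= ?scaler0//.
      by rewrite scalerDr !scalerA mulrC.
    by rewrite /derive E.
  have D2 : 'D_(0, evec b) psi (x, y) = s ^+ 2 * dotpar b L (x, y).
    rewrite /dotpar -[RHS](deriveZ (s ^+ 2) (Ld _ (0, evec b) Axy)).
    apply: near_eq_derive; near=> z.
    have Az : A z by near: z; exact: open_nbhs_nbhs.
    by rewrite /psi Lh//; case: (z) Az.
  have s0' : s != 0 by rewrite gt_eqF.
  apply: (mulfI s0'); rewrite mulrA -expr2 -D2 D1 derive_scale//; exact: Ld.
have fd b w : derivable (dotpar b L) (x, y) w.
  by apply: smooth_derivable Axy _; exact: smooth_derive.
(* Moving from y along y is rescaling by h + 1, so by [hom] the difference quotient is constant for
   small h. *)
have euler b : 'D_(0, y) (dotpar b L) (x, y) = dotpar b L (x, y).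
  apply: cvg_lim => //.
  have cc : dotpar b L (x, y) @[_ --> (0 : R)^'] --> dotpar b L (x, y) by exact: cvg_cst.
  apply: cvg_trans cc.
  apply: near_eq_cvg; near=> h => /=.
  have h0 : h != 0 by near: h; exact: nbhs_dnbhs_neq.
  have h1 : 0 < h + 1.
    have : `|h| < 1 by near: h; apply: dnbhs0_lt; exact: ltr01.
    by rewrite ltr_norml => /andP[]; lra.
  have -> : h *: ((0, y) : TM) + (x, y) = (x, (h + 1) *: y).
    by apply: injective_projections; rewrite /= ?scaler0 ?add0r// scalerDl scale1r.
  by rewrite hom// mulrDl mul1r addrK [_ *: _]mulrA mulVf// mul1r.
have yg : y *m fund_tensor L (x, y) = 0.
  apply/rowP => j; rewrite [LHS]mxE [RHS]mxE.
  have := euler j; rewrite grad0 vertical_decomposition (derive_sum_dir _ _ oA _ Axy).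
    move=> /(congr1 ( *%R 2^-1)); rewrite mulr0; apply: etrans.
    rewrite mulr_sumr; apply: eq_bigr => a _.
    by rewrite [fund_tensor _ _ _ _]mxE mulrCA.
  exact: (smooth_derive (0, evec j) Ls 1%N).
have [_ /eqP] := A0 _ Axy; apply => /=.
by rewrite -(mulmxK (Lu _ Axy) y) yg mul0mx.
Unshelve. all: by end_near. Qed.

End FinslerGradient.

(** * Pseudo-Riemannian metrics with a prescribed connection *)

Section AffineEquivalence.
Context {R : realType}.
Local Notation X4 := 'rV[R]_4.
Local Notation TM := (TM4 R).

Lemma continuous_project (M : set X4) (A : set TM) (F : TM -> R) (f : X4 -> R) :
  open A -> (forall x, M x -> exists y, A (x, y)) ->
  (forall p, A p -> F p = f p.1) -> (forall p, A p -> {for p, continuous F}) ->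
  forall x, M x -> {for x, continuous f}.
Proof.
move=> oA MA Ff Fc x /MA[y Ay] B; rewrite -[f x]/(f (x, y).1) -(Ff _ Ay) => nB.
have nF : nbhs ((x, y) : TM) (F @^-1` B) := Fc _ Ay _ nB.
have [[N1 N2] /= [N1x N2y] sub] := filterI nF (open_nbhs_nbhs (conj oA Ay)).
apply: filterS N1x => z N1z.
have [FB Az] := sub (z, y) (conj N1z (nbhs_singleton N2y)).
by rewrite /= -(Ff (z, y) Az).
Qed.

Lemma is_derive_project (A : set TM) (F : TM -> R) (f : X4 -> R) p v :
  open A -> A p -> (forall q, A q -> F q = f q.1) ->
  derivable F p (v, 0) -> is_derive p.1 v f ('D_(v, 0) F p).
Proof.
move=> oA Ap Ff /derivableP Fd.
have [fd fE] : is_derive p (v, 0) (fun q : TM => f q.1) ('D_(v, 0) F p).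
  exact: is_derive_open oA Ap Ff Fd.
exact: DeriveDef.
Qed.

(** The metric coefficients are reached only through the fundamental tensor on [A]. As [A] is open
    and meets every fibre, regularity of a function of x alone descends to [M]. *)
Lemma Ck_project n (M : set X4) (A : set TM) (F : TM -> R) (f : X4 -> R) :
  open A -> (forall x, M x -> exists y, A (x, y)) ->
  (forall p, A p -> F p = f p.1) -> Ck_on n A F -> Ck_on n M f.
Proof.
move=> oA MA; elim: n F f => [|n IH] F f Ff [Fc Fd];
  (split; first exact: (continuous_project oA MA Ff)) => // v.
have [Fv Fk] := Fd (v, 0).
have fD p : A p -> is_derive p.1 v f ('D_(v, 0) F p).
  by move=> Ap; apply: is_derive_project Ff _ => //; exact: Fv.
split; first by move=> x /MA[y /fD[]].
by apply: IH Fk => p /fD[].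
Qed.

(** The second difference q (y + h v) + q (y - h v) - 2 q y equals 2 h^2 q v, so the form vanishes
    in every direction; polarization on the basis vectors then gives skewness. *)
Lemma quad_zero (S : set X4) y (T : 'M[R]_4) : open S -> S y ->
  (forall z, S z -> (z *m T *m z^T) 0 0 = 0) -> T + T^T = 0.
Proof.
move=> oS Sy TS.
have trD (u w : X4) : (u + w)^T = u^T + w^T by rewrite linearD.
have trZ (c : R) (u : X4) : (c *: u)^T = c *: u^T by rewrite linearZ.
pose q (z : X4) : R := (z *m T *m z^T) 0 0.
have q0 v : q v = 0.
  have [h h0 [S1 S2]] := open_perturb v oS Sy.
  have qE t : q (y + t *: v)
      = q y + t * ((y *m T *m v^T) 0 0 + (v *m T *m y^T) 0 0) + t ^+ 2 * q v.
    rewrite /q trD trZ mulmxDl -scalemxAl mulmxDr !mulmxDl -!scalemxAl -!scalemxAr.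
    move: (y *m T *m y^T) (v *m T *m y^T) (y *m T *m v^T) (v *m T *m v^T) => m1 m2 m3 m4.
    rewrite !mxE; ring.
  have : q (y + h *: v) + q (y - h *: v) - 2 * q y = 2 * h ^+ 2 * q v.
    by rewrite -scaleNr !qE; ring.
  have TS' z : S z -> q z = 0 by exact: TS.
  rewrite (TS' _ S1) (TS' _ S2) (TS' _ Sy) => /eqP; rewrite addr0 mulr0 subrr eq_sym -mulrA !mulf_eq0.
  by rewrite pnatr_eq0 (negbTE h0) /= => /eqP.
have qe a b : (evec a *m T *m (evec b)^T) 0 0 = T a b.
  by rewrite -rowE trmx_delta -colE !mxE.
have aD (m1 m2 : 'M[R]_1) : (m1 + m2) 0 0 = m1 0 0 + m2 0 0 by rewrite mxE.
apply/matrixP => a b; rewrite !mxE.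
have := q0 (evec a + evec b); have := q0 (evec a); have := q0 (evec b).
rewrite /q trD mulmxDl mulmxDr !mulmxDl !aD !qe => E1 E2 E3.
lra.
Qed.

Lemma is_derive_mul (V : normedModType R) (f g : V -> R) x v df dg :
  is_derive x v f df -> is_derive x v g dg ->
  is_derive x v (fun z => f z * g z) (df * g x + f x * dg).
Proof.
move=> fd gd; have := is_deriveM fd gd.
by rewrite addrC [_ *: df]mulrC.
Qed.

Lemma is_derive_quad (g : 'M[R]_4) (y : X4) b :
  is_derive y (evec b) (fun z : X4 => \sum_c \sum_d g c d * z 0 c * z 0 d)
    (\sum_d (g b d + g d b) * y 0 d).
Proof.
have co c : is_derive y (evec b) (fun z : X4 => z 0 c) ((evec b : X4) 0 c).
  exact: is_derive_coord.
have : is_derive y (evec b) (fun z : X4 => \sum_c \sum_d g c d * z 0 c * z 0 d)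
    (\sum_c \sum_d ((0 * y 0 c + g c d * (evec b : X4) 0 c) * y 0 d
       + g c d * y 0 c * (evec b : X4) 0 d)).
  apply: is_derive_bigsum => c; apply: is_derive_bigsum => d.
  by apply: is_derive_mul (co d); apply: is_derive_mul (co c); exact: is_derive_cst.
congr is_derive.
by move: b {co}; apply: forall_ord4; rewrite !sum4 !mxE /=; ring.
Qed.

Lemma is_derive_lin (g : 'I_4 -> R) (y : X4) b :
  is_derive y (evec b) (fun z : X4 => \sum_d g d * z 0 d) (g b).
Proof.
have co c : is_derive y (evec b) (fun z : X4 => z 0 c) ((evec b : X4) 0 c).
  exact: is_derive_coord.
have : is_derive y (evec b) (fun z : X4 => \sum_d g d * z 0 d)
    (\sum_d (0 * y 0 d + g d * (evec b : X4) 0 d)).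
  apply: is_derive_bigsum => d; apply: is_derive_mul (co d); exact: is_derive_cst.
congr is_derive.
by move: b {co}; apply: forall_ord4; rewrite !sum4 !mxE /=; ring.
Qed.

Variables (M : set X4) (A : set TM) (L : TM -> R) (Gam : @christoffel R).
Hypothesis oM : open M.
Hypothesis FL : pseudo_finsler M A L.
Variable g : X4 -> 'M[R]_4.
Hypothesis Lg : forall x y, A (x, y) ->
  L (x, y) = \sum_a \sum_b g x a b * y 0 a * y 0 b.
Hypothesis Gam_smooth : forall c a b, smooth_on M (fun x => Gam x c a b).
Hypothesis Gam_sym : forall x c a b, M x -> Gam x c a b = Gam x c b a.
Hypothesis sprayE : forall x y c, A (x, y) ->
  2 * spray L c (x, y) = \sum_a \sum_b Gam x c a b * y 0 a * y 0 b.

(** The coefficients [g] are assumed neither symmetric nor smooth; only their symmetric part is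
    determined by L. *)
Definition metric_mx (x : X4) : 'M[R]_4 := 2^-1 *: (g x + (g x)^T).

Let oA : open A. Proof. by case: FL => [[]]. Qed.
Let AM p : A p -> M p.1. Proof. by case: FL => [[_ h _ _] _ _ _] /h[]. Qed.
Let MA x : M x -> exists y, A (x, y). Proof. by case: FL => [[_ _ h _] _ _ _]; exact: h. Qed.
Let Ls : smooth_on A L. Proof. by case: FL. Qed.

Lemma metric_mx_sym x : (metric_mx x)^T = metric_mx x.
Proof. by rewrite /metric_mx linearZ /= linearD /= trmxK addrC. Qed.

Lemma dotpar_metric b p : A p -> dotpar b L p = \sum_d (2 * metric_mx p.1 b d) * p.2 0 d.
Proof.
case: p => x y Axy; rewrite /dotpar.
have oS : open [set y | A (x, y)] := open_slice (x := x) oA.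
have [_ ->] : is_derive (x, y) (0, evec b) L (\sum_d (g x b d + g x d b) * y 0 d).
  have [qd qE] := is_derive_open (g := fun z => L (x, z)) oS Axy
    (fun z Az => esym (Lg Az)) (is_derive_quad (g x) y b).
  have E : (fun h : R => h^-1 *: ((L \o shift ((x, y) : TM)) (h *: ((0, evec b) : TM)) - L (x, y)))
    = (fun h : R => h^-1 *: (((fun z => L (x, z)) \o shift y) (h *: evec b) - L (x, y))).
    apply/funext => h /=; congr (_ *: (L _ - _)).
    by apply: injective_projections; rewrite /= ?scaler0 ?add0r.
  by apply: DeriveDef; rewrite /derivable /derive E.
by apply: eq_bigr => d _; rewrite !mxE [2 * (_ * _)]mulrA mulfV ?pnatr_eq0// mul1r.
Qed.

Lemma fund_tensor_metric p : A p -> fund_tensor L p = metric_mx p.1.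
Proof.
case: p => x y Axy; apply/matrixP => a b; rewrite mxE.
suff -> : dotpar a (dotpar b L) (x, y) = 2 * metric_mx x b a.
  by rewrite mulrA mulVf ?pnatr_eq0// mul1r -[in LHS]metric_mx_sym mxE.
rewrite /dotpar -/(dotpar b L).
have oS : open [set y | A (x, y)] := open_slice (x := x) oA.
have [qd qE] := is_derive_open (g := fun z => dotpar b L (x, z)) oS Axy
    (fun z Az => esym (dotpar_metric b Az)) (is_derive_lin (fun d => 2 * metric_mx x b d) y a).
rewrite -qE /derive.
have -> : (fun h : R => h^-1 *: ((dotpar b L \o shift ((x, y) : TM)) (h *: ((0, evec a) : TM))
      - dotpar b L (x, y)))
    = (fun h : R => h^-1 *: (((fun z => dotpar b L (x, z)) \o shift y) (h *: evec a)
      - dotpar b L (x, y))) => //.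
apply/funext => h /=; congr (_ *: (dotpar b L _ - _)).
by apply: injective_projections; rewrite /= ?scaler0 ?add0r.
Qed.

Lemma metric_unit x : M x -> metric_mx x \in unitmx.
Proof.
move=> /MA[y Ay]; rewrite -(fund_tensor_metric Ay).
by case: FL => _ _ _; apply.
Qed.

Lemma metric_smooth : mx_smooth M metric_mx.
Proof.
move=> a b n; apply: (Ck_project (F := fun p => fund_tensor L p a b) oA MA).
  by move=> p Ap; rewrite fund_tensor_metric.
have h : smooth_on A (fun p => 2^-1 * dotpar a (dotpar b L) p).
  apply: smoothM => //; first exact: smooth_cst.
  by apply: smooth_derive; exact: smooth_derive.
by apply: (smooth_ext oA _ h) => p Ap; rewrite mxE.
Qed.

Lemma metric_derivable x v : M x -> mx_derivable metric_mx x v.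
Proof. by move=> Mx i j; exact: smooth_derivable Mx (metric_smooth i j). Qed.

Lemma par_dotpar_metric a b p : A p ->
  par a (dotpar b L) p = \sum_d (2 * dmx a metric_mx p.1 b d) * p.2 0 d.
Proof.
move=> Ap; rewrite /par.
have co d : is_derive p (evec a, 0) (fun q : TM => q.2 0 d) 0.
  have := @is_derive_snd _ (fun z : X4 => z 0 d) p (evec a, 0) _ (is_derive_coord _ _ d).
  by rewrite mxE.
have me d : is_derive p (evec a, 0) (fun q : TM => metric_mx q.1 b d) (dmx a metric_mx p.1 b d).
  apply: (@is_derive_fst _ (fun z : X4 => metric_mx z b d)); rewrite mxE.
  by apply: derivableP; exact: metric_derivable (AM Ap) b d.
have : is_derive p (evec a, 0) (fun q : TM => \sum_d (2 * metric_mx q.1 b d) * q.2 0 d)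
    (\sum_d ((0 * metric_mx p.1 b d + 2 * dmx a metric_mx p.1 b d) * p.2 0 d
       + (2 * metric_mx p.1 b d) * 0)).
  apply: is_derive_bigsum => d; apply: is_derive_mul (co d).
  by apply: is_derive_mul (me d); exact: is_derive_cst.
move=> /(is_derive_open oA Ap (fun q Aq => esym (dotpar_metric b Aq)))[_ ->].
by apply: eq_bigr => d _; rewrite mulr0 addr0 mul0r add0r.
Qed.

Lemma L_metric p : A p -> L p = \sum_a \sum_b metric_mx p.1 a b * p.2 0 a * p.2 0 b.
Proof.
case: p => x y Axy; by rewrite Lg// !sum4 !mxE /=; field.
Qed.

Lemma par_L_metric b p : A p ->
  par b L p = \sum_a \sum_d dmx b metric_mx p.1 a d * p.2 0 a * p.2 0 d.
Proof.
move=> Ap; rewrite /par.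
have co d : is_derive p (evec b, 0) (fun q : TM => q.2 0 d) 0.
  have := @is_derive_snd _ (fun z : X4 => z 0 d) p (evec b, 0) _ (is_derive_coord _ _ d).
  by rewrite mxE.
have me a d : is_derive p (evec b, 0) (fun q : TM => metric_mx q.1 a d) (dmx b metric_mx p.1 a d).
  apply: (@is_derive_fst _ (fun z : X4 => metric_mx z a d)); rewrite mxE.
  by apply: derivableP; exact: metric_derivable (AM Ap) a d.
have : is_derive p (evec b, 0)
    (fun q : TM => \sum_a \sum_d metric_mx q.1 a d * q.2 0 a * q.2 0 d)
    (\sum_a \sum_d ((dmx b metric_mx p.1 a d * p.2 0 a + metric_mx p.1 a d * 0) * p.2 0 d
       + metric_mx p.1 a d * p.2 0 a * 0)).
  apply: is_derive_bigsum => a; apply: is_derive_bigsum => d.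
  by apply: is_derive_mul (co d); apply: is_derive_mul (me a d) (co a).
move=> /(is_derive_open oA Ap (fun q Aq => esym (L_metric Aq)))[_ ->].
by apply: eq_bigr => a _; apply: eq_bigr => d _; rewrite !mulr0 !addr0.
Qed.

Definition qform (y : X4) (T : 'M[R]_4) : R := (y *m T *m y^T) 0 0.

Lemma qformE y T : qform y T = \sum_a \sum_d T a d * y 0 a * y 0 d.
Proof.
rewrite /qform exchange_big /= mxE; apply: eq_bigr => d _.
rewrite !mxE mulr_suml; apply: eq_bigr => a _.
by rewrite [y 0 a * _]mulrC.
Qed.

Lemma qformD y T1 T2 : qform y (T1 + T2) = qform y T1 + qform y T2.
Proof. by rewrite /qform mulmxDr mulmxDl mxE. Qed.

Lemma qformZ y c T : qform y (c *: T) = c * qform y T.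
Proof. by rewrite /qform -scalemxAr -scalemxAl mxE. Qed.

Lemma dmx_metric_sym a x i j : dmx a metric_mx x i j = dmx a metric_mx x j i.
Proof.
rewrite !mxE; congr (derive _ x (evec a)); apply/funext => z.
by rewrite -[in LHS]metric_mx_sym mxE.
Qed.

(** Lowering the index in the spray equation gives a quadratic form in y vanishing on the open fibre
    of [A]. Its symmetric part, read off by [quad_zero], is the claim. *)
Lemma christoffel_first_kind x a d e : M x ->
  dmx a metric_mx x e d + dmx d metric_mx x e a - dmx e metric_mx x a d
    = 2 * \sum_c metric_mx x e c * Gam x c a d.
Proof.
move=> Mx; have [y0 Ay0] := MA Mx.
have [T T0 TE] : exists2 T : 'M[R]_4, (forall y, A (x, y) -> qform y T = 0) &
    forall i j, T i j = 2 * dmx i metric_mx x e j - dmx e metric_mx x i j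
      - 2 * \sum_c metric_mx x e c * Gam x c i j.
  pose P : 'M[R]_4 := \matrix_(a, d) dmx a metric_mx x e d.
  pose S : 'M[R]_4 := \matrix_(a, d) \sum_c metric_mx x e c * Gam x c a d.
  pose T := 2 *: P + -1 *: dmx e metric_mx x + -2 *: S.
  have T0 y : A (x, y) -> qform y T = 0.
    move=> Axy; pose V b := \sum_a y 0 a * par a (dotpar b L) (x, y) - par b L (x, y).
    have VE : V e = 2 * qform y P - qform y (dmx e metric_mx x).
      rewrite /V par_L_metric//= -qformE; congr (_ - _); rewrite qformE mulr_sumr.
      apply: eq_bigr => a' _; rewrite par_dotpar_metric//= !mulr_sumr.
      by apply: eq_bigr => d' _; rewrite [P _ _]mxE; ring.
    have GE c : \sum_a \sum_b Gam x c a b * y 0 a * y 0 b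
        = 2^-1 * (invmx (metric_mx x) *m \col_b V b) c 0.
      rewrite -sprayE// /spray (fund_tensor_metric Axy) mulrA mxE.
      congr (_ * _); first by field.
      by apply: eq_bigr => b _; rewrite mxE.
    have SE : qform y S = 2^-1 * V e.
      transitivity (\sum_c metric_mx x e c * (\sum_a \sum_b Gam x c a b * y 0 a * y 0 b)).
        rewrite qformE; under eq_bigr do under eq_bigr do rewrite [S _ _]mxE !mulr_suml.
        under [RHS]eq_bigr do rewrite mulr_sumr.
        under [RHS]eq_bigr do under eq_bigr do rewrite mulr_sumr.
        rewrite [RHS]exchange_big /=; apply: eq_bigr => a' _.
        rewrite [RHS]exchange_big /=; apply: eq_bigr => d' _.
        by apply: eq_bigr => c _; rewrite !mulrA.
      under eq_bigr do rewrite GE mulrCA.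
      rewrite -mulr_sumr; congr (_ * _).
      have := mulKVmx (metric_unit Mx) (\col_b V b) => /matrixP/(_ e 0).
      by rewrite mxE [in RHS]mxE.
    by rewrite /T !qformD !qformZ SE VE; field.
  exists T => // i j; rewrite -mulN1r -[in RHS]mulNr.
  have addE (m1 m2 : 'M[R]_4) : (m1 + m2) i j = m1 i j + m2 i j by rewrite mxE.
  have scE c (m : 'M[R]_4) : (c *: m) i j = c * m i j by rewrite mxE.
  rewrite /T addE addE scE scE scE; congr (_ * _ + _ + _ * _); by rewrite [LHS]mxE.
have := quad_zero (open_slice (x := x) oA) Ay0 T0.
have SS : \sum_c metric_mx x e c * Gam x c d a = \sum_c metric_mx x e c * Gam x c a d.
  by apply: eq_bigr => c _; rewrite Gam_sym.
move=> /matrixP/(_ a d); rewrite [LHS]mxE [T^T _ _]mxE [RHS]mxE TE TE SS.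
have := dmx_metric_sym e x d a.
generalize (dmx a metric_mx x e d) (dmx d metric_mx x e a) (dmx e metric_mx x a d) (dmx e metric_mx x d a).
move: (\sum_c _) => u1 u2 u3 u4 u5 E1 E2; lra.
Qed.

(** The metric is parallel: in the sum of the first-kind identities for (d, e) and (e, d) all
    derivatives other than those along [a] cancel. *)
Lemma dmx_metric x a : M x ->
  dmx a metric_mx x = conn_mx Gam a x *m metric_mx x + (conn_mx Gam a x *m metric_mx x)^T.
Proof.
move=> Mx; apply/matrixP => d e; rewrite [RHS]mxE [X in _ = _ + X]mxE.
have CE i j : (conn_mx Gam a x *m metric_mx x) i j = \sum_c metric_mx x j c * Gam x c a i.
  rewrite mxE; apply: eq_bigr => c _; rewrite [conn_mx _ _ _ _ _]mxE mulrC.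
  by rewrite -[in RHS]metric_mx_sym [_^T _ _]mxE.
rewrite !CE.
have := christoffel_first_kind a d e Mx; have := christoffel_first_kind a e d Mx.
have := dmx_metric_sym a x e d; have := dmx_metric_sym e x d a; have := dmx_metric_sym d x e a.
generalize (dmx a metric_mx x e d) (dmx a metric_mx x d e) (dmx e metric_mx x d a) (dmx e metric_mx x a d)
  (dmx d metric_mx x e a) (dmx d metric_mx x a e).
generalize (\sum_c metric_mx x e c * Gam x c a d) (\sum_c metric_mx x d c * Gam x c a e).
move=> u1 u2 u3 u4 u5 u6 u7 u8 E1 E2 E3 E4 E5; lra.
Qed.

Lemma dmxM (N1 N2 : X4 -> 'M[R]_4) a x :
  mx_derivable N1 x (evec a) -> mx_derivable N2 x (evec a) ->
  dmx a (fun z => N1 z *m N2 z) x = dmx a N1 x *m N2 x + N1 x *m dmx a N2 x.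
Proof.
move=> d1 d2; apply/matrixP => i j; rewrite !mxE -big_split /=.
have -> : (fun z => (N1 z *m N2 z) i j) = (fun z => \sum_k N1 z i k * N2 z k j).
  by apply/funext => z; rewrite mxE.
have [_ ->] : is_derive x (evec a) (fun z => \sum_k N1 z i k * N2 z k j)
  (\sum_k ('D_(evec a) (fun z => N1 z i k) x * N2 x k j
     + N1 x i k * 'D_(evec a) (fun z => N2 z k j) x)).
  by apply: is_derive_bigsum => k; apply: is_derive_mul; exact: derivableP.
by apply: eq_bigr => k _; rewrite !mxE.
Qed.

Lemma dmx_tr (N : X4 -> 'M[R]_4) a x : dmx a (fun z => (N z)^T) x = (dmx a N x)^T.
Proof.
apply/matrixP => i j; rewrite !mxE.
by congr (derive _ x (evec a)); apply/funext => z; rewrite mxE.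
Qed.

Lemma mx_derivable_tr (N : X4 -> 'M[R]_4) x v :
  mx_derivable N x v -> mx_derivable (fun z => (N z)^T) x v.
Proof.
move=> Nd i j; have -> : (fun z => (N z)^T i j) = (fun z => N z j i).
  by apply/funext => z; rewrite [LHS]mxE.
exact: Nd.
Qed.

(** The terms C1 H C2^T and C2 H C1^T are transposes of each other and occur on both sides; after
    cancelling them only the curvature remains. *)
Lemma ricci_algebra (D1 D2 C1 C2 H : 'M[R]_4) : H^T = H ->
  D2 *m H + C1 *m (C2 *m H + (C2 *m H)^T)
    + (D2 *m H + C1 *m (C2 *m H + (C2 *m H)^T))^T
  = D1 *m H + C2 *m (C1 *m H + (C1 *m H)^T)
    + (D1 *m H + C2 *m (C1 *m H + (C1 *m H)^T))^T ->
  (D2 - D1 + C1 *m C2 - C2 *m C1) *m H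
    + ((D2 - D1 + C1 *m C2 - C2 *m C1) *m H)^T = 0.
Proof.
move=> Hs; have trD (u w : 'M[R]_4) : (u + w)^T = u^T + w^T by rewrite linearD.
have trN (u : 'M[R]_4) : (- u)^T = - u^T by rewrite linearN.
have E1 : C1 *m (C2 *m H)^T = (C2 *m (C1 *m H)^T)^T.
  by rewrite !trmx_mul !trmxK ?Hs mulmxA.
rewrite !mulmxDr E1 !trD trmxK !mulmxBl !mulmxDl !mulNmx !trD !trN -!mulmxA.
move: (C2 *m (C1 *m H)^T) (C1 *m (C2 *m H)) (C2 *m (C1 *m H)) (D2 *m H) (D1 *m H).
move=> m1 m2 m3 m4 m5 E; apply/matrixP => i j; move/matrixP/(_ i j): E.
by rewrite !mxE; lra.
Qed.

(* Ricci identity for the parallel tensor metric_mx. *)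
Lemma curv_skew x a b : M x ->
  curv Gam a b x *m metric_mx x + (curv Gam a b x *m metric_mx x)^T = 0.
Proof.
move=> Mx; set H := metric_mx x.
have Cd c v : mx_derivable (conn_mx Gam c) x v.
  move=> i j; have -> : (fun z => conn_mx Gam c z i j) = (fun z => Gam z j c i).
    by apply/funext => z; rewrite mxE.
  exact: smooth_derivable Mx (Gam_smooth _ _ _).
have mul_derivable (N1 N2 : X4 -> 'M[R]_4) v : mx_derivable N1 x v -> mx_derivable N2 x v ->
    mx_derivable (fun z => N1 z *m N2 z) x v.
  move=> d1 d2 i j.
  have -> : (fun z => (N1 z *m N2 z) i j) = (fun z => \sum_k N1 z i k * N2 z k j).
    by apply/funext => z; rewrite mxE.
  have [] // : is_derive x v (fun z => \sum_k N1 z i k * N2 z k j)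
    (\sum_k ('D_v (fun z => N1 z i k) x * N2 x k j
     + N1 x i k * 'D_v (fun z => N2 z k j) x)).
  by apply: is_derive_bigsum => k; apply: is_derive_mul; exact: derivableP.
(* The d-derivative of [conn_mx c] times the metric, with the derivative of the metric eliminated by
   parallelism. *)
pose X c d := dmx d (conn_mx Gam c) x *m H
  + conn_mx Gam c x *m (conn_mx Gam d x *m H + (conn_mx Gam d x *m H)^T).
have DD c d : dmx d (dmx c metric_mx) x = X c d + (X c d)^T.
  transitivity (dmx d (fun z => conn_mx Gam c z *m metric_mx z
      + (conn_mx Gam c z *m metric_mx z)^T) x).
    apply/matrixP => i j; rewrite [LHS]mxE [RHS]mxE; apply: near_eq_derive.
    near=> z; have Mz : M z by near: z; exact: open_nbhs_nbhs.
    by rewrite dmx_metric.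
  have Pd : mx_derivable (fun z => conn_mx Gam c z *m metric_mx z) x (evec d).
    by apply: mul_derivable => //; exact: metric_derivable.
  have PdT : mx_derivable (fun z => (conn_mx Gam c z *m metric_mx z)^T) x (evec d).
    by exact: mx_derivable_tr.
  apply: etrans (dmxD Pd PdT) _.
  have E : dmx d (fun z => conn_mx Gam c z *m metric_mx z) x = X c d.
    have h := dmxM (Cd c (evec d)) (@metric_derivable x (evec d) Mx).
    by rewrite h /X -(dmx_metric d Mx).
  by rewrite (dmx_tr (fun z => conn_mx Gam c z *m metric_mx z)) E.
have comm : dmx b (dmx a metric_mx) x = dmx a (dmx b metric_mx) x.
  apply/matrixP => i j; rewrite [LHS]mxE [RHS]mxE.
  have E c : (fun z => dmx c metric_mx z i j) = 'D_(evec c) (fun z => metric_mx z i j).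
    by apply/funext => z; rewrite [LHS]mxE.
  have h := derive_commute (evec b) (evec a) oM (metric_smooth i j 2%N) Mx.
  exact: etrans (congr1 (fun f => 'D_(evec b) f x) (E a))
    (etrans h (esym (congr1 (fun f => 'D_(evec a) f x) (E b)))).
move: comm; rewrite DD DD /X /curv.
exact: ricci_algebra (metric_mx_sym x).
Unshelve. all: by end_near. Qed.

End AffineEquivalence.

(** * The holonomy distribution of the spherical connection *)

Section SphericalConnection.
Context {R : realType}.
Local Notation X4 := 'rV[R]_4.
Variables (k : sph_coef R) (M : set X4).
Local Notation Gam := (sph_connection k).
Local Notation K1 := (trf (k1 k)).
Local Notation K2 := (trf (k2 k)).
Local Notation K3 := (trf (k3 k)).
Local Notation K4 := (trf (k4 k)).
Local Notation K5 := (trf (k5 k)).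
Local Notation K6 := (trf (k6 k)).
Local Notation K7 := (trf (k7 k)).
Local Notation K8 := (trf (k8 k)).
Local Notation K9 := (trf (k9 k)).
Local Notation K10 := (trf (k10 k)).
Local Notation s2 := (thf sin2).
Local Notation sc := (thf sincos).
Local Notation ct := (thf cotan).

Hypothesis oM : open M.
Hypothesis chart : forall x, M x -> in_spherical_chart x.
Hypothesis Gam_smooth : forall c a b, smooth_on M (fun x => Gam x c a b).
Hypothesis k10_neq0 : forall x, M x -> K10 x != 0.
Hypothesis relations : forall x, M x -> power_law_relations k (x 0 it) (x 0 ir).

Lemma sin_neq0 x : M x -> sin (x 0 ith) != 0.
Proof. by move=> /chart[_ /sin_gt0_pi]; exact: lt0r_neq0. Qed.

Lemma conn_t : conn_mx Gam it = fun x => mx4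
  [:: [:: K1 x; K4 x; 0; 0]; [:: K2 x; K6 x; 0; 0];
      [:: 0; 0; K8 x; 0]; [:: 0; 0; 0; K8 x]].
Proof.
by apply/funext => x; apply/matrixP; apply: forall_ord4; apply: forall_ord4;
  rewrite !mxE.
Qed.

Lemma conn_r : conn_mx Gam ir = fun x => mx4
  [:: [:: K2 x; K6 x; 0; 0]; [:: K3 x; K5 x; 0; 0];
      [:: 0; 0; K9 x; 0]; [:: 0; 0; 0; K9 x]].
Proof.
by apply/funext => x; apply/matrixP; apply: forall_ord4; apply: forall_ord4;
  rewrite !mxE.
Qed.

Lemma conn_th : conn_mx Gam ith = fun x => mx4
  [:: [:: 0; 0; K8 x; 0]; [:: 0; 0; K9 x; 0];
      [:: K7 x; K10 x; 0; 0]; [:: 0; 0; 0; ct x]].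
Proof.
by apply/funext => x; apply/matrixP; apply: forall_ord4; apply: forall_ord4;
  rewrite !mxE.
Qed.

Lemma conn_ph : conn_mx Gam iph = fun x => mx4
  [:: [:: 0; 0; 0; K8 x]; [:: 0; 0; 0; K9 x];
      [:: 0; 0; 0; ct x]; [:: K7 x * s2 x; K10 x * s2 x; - sc x; 0]].
Proof.
by apply/funext => x; apply/matrixP; apply: forall_ord4; apply: forall_ord4;
  rewrite !mxE.
Qed.

Lemma conn_derivable a x v : M x -> mx_derivable (conn_mx Gam a) x v.
Proof.
move=> Mx i j; have -> : (fun z => conn_mx Gam a z i j) = (fun z => Gam z j a i).
  by apply/funext => z; rewrite mxE.
exact: smooth_derivable Mx (Gam_smooth _ _ _).
Qed.

Lemma K1_smooth : smooth_on M K1. Proof. exact: (Gam_smooth it it it). Qed.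
Lemma K2_smooth : smooth_on M K2. Proof. exact: (Gam_smooth it it ir). Qed.
Lemma K3_smooth : smooth_on M K3. Proof. exact: (Gam_smooth it ir ir). Qed.
Lemma K4_smooth : smooth_on M K4. Proof. exact: (Gam_smooth ir it it). Qed.
Lemma K5_smooth : smooth_on M K5. Proof. exact: (Gam_smooth ir ir ir). Qed.
Lemma K6_smooth : smooth_on M K6. Proof. exact: (Gam_smooth ir it ir). Qed.
Lemma K7_smooth : smooth_on M K7. Proof. exact: (Gam_smooth it ith ith). Qed.
Lemma K8_smooth : smooth_on M K8. Proof. exact: (Gam_smooth ith ith it). Qed.
Lemma K9_smooth : smooth_on M K9. Proof. exact: (Gam_smooth ith ith ir). Qed.
Lemma K10_smooth : smooth_on M K10. Proof. exact: (Gam_smooth ir ith ith). Qed.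
Lemma cot_smooth : smooth_on M ct. Proof. exact: (Gam_smooth iph ith iph). Qed.

Lemma sincos_smooth : smooth_on M sc.
Proof.
apply: (smooth_ext oM _ (smoothN oM (Gam_smooth ith iph iph))) => x _.
by rewrite /= opprK.
Qed.

(** Smoothness is read off from the connection: the phi-phi coefficient with upper index r is k10
    sin^2 theta, and k10 is nonzero. *)
Lemma sin2_smooth : smooth_on M s2.
Proof.
apply: (smooth_ext oM _ (smooth_div oM k10_neq0 (Gam_smooth ir iph iph) K10_smooth)).
by move=> x Mx; have := k10_neq0 Mx; rewrite /= -/(trf (k10 k) x) => h; rewrite mulrC mulKf.
Qed.

Lemma trf_dt_smooth f : smooth_on M (trf f) -> smooth_on M (trf (d_t f)).
Proof.
move=> /(smooth_derive (evec it)); apply: (smooth_ext oM) => x _.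
exact: derive_trf_t.
Qed.

Lemma trf_dr_smooth f : smooth_on M (trf f) -> smooth_on M (trf (d_r f)).
Proof.
move=> /(smooth_derive (evec ir)); apply: (smooth_ext oM) => x _.
exact: derive_trf_r.
Qed.

Ltac smooth_tac := repeat lazymatch goal with
  | |- smooth_on _ (trf (k1 _)) => exact: K1_smooth
  | |- smooth_on _ (trf (k2 _)) => exact: K2_smooth
  | |- smooth_on _ (trf (k3 _)) => exact: K3_smooth
  | |- smooth_on _ (trf (k4 _)) => exact: K4_smooth
  | |- smooth_on _ (trf (k5 _)) => exact: K5_smooth
  | |- smooth_on _ (trf (k6 _)) => exact: K6_smooth
  | |- smooth_on _ (trf (k7 _)) => exact: K7_smooth
  | |- smooth_on _ (trf (k8 _)) => exact: K8_smooth
  | |- smooth_on _ (trf (k9 _)) => exact: K9_smooth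
  | |- smooth_on _ (trf (k10 _)) => exact: K10_smooth
  | |- smooth_on _ (trf (d_t _)) => apply: trf_dt_smooth
  | |- smooth_on _ (trf (d_r _)) => apply: trf_dr_smooth
  | |- smooth_on _ (trf _) => fail
  | |- smooth_on _ (fun x => _ + _) => apply: (smoothD oM)
  | |- smooth_on _ (fun x => - _) => apply: (smoothN oM)
  | |- smooth_on _ (fun x => _ * _) => apply: (smoothM oM)
  | |- smooth_on _ (fun x => _ ^+ _) => apply: (smoothX oM)
  end.

Lemma a1_smooth : smooth_on M (trf (a1 k)).
Proof.
apply: (smooth_ext oM (f := fun x => trf (d_r (k1 k)) x - trf (d_t (k2 k)) x
  + K3 x * K4 x - K2 x * K6 x)) => //; smooth_tac.
Qed.

Lemma a2_smooth : smooth_on M (trf (a2 k)).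
Proof.
apply: (smooth_ext oM (f := fun x => trf (d_r (k2 k)) x - trf (d_t (k3 k)) x
  + K2 x ^+ 2 + K3 x * K6 x - K1 x * K3 x - K2 x * K5 x)) => //; smooth_tac.
Qed.

Lemma a3_smooth : smooth_on M (trf (a3 k)).
Proof.
apply: (smooth_ext oM (f := fun x => trf (d_r (k4 k)) x - trf (d_t (k6 k)) x
  + K1 x * K6 x + K4 x * K5 x - K2 x * K4 x - K6 x ^+ 2)) => //; smooth_tac.
Qed.

Lemma a4_smooth : smooth_on M (trf (a4 k)).
Proof.
apply: (smooth_ext oM (f := fun x => trf (d_r (k6 k)) x - trf (d_t (k5 k)) x
  + K2 x * K6 x - K3 x * K4 x)) => //; smooth_tac.
Qed.

Lemma a5_smooth : smooth_on M (trf (a5 k)).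
Proof.
apply: (smooth_ext oM (f := fun x => trf (d_r (k8 k)) x - trf (d_t (k9 k)) x)) => //.
smooth_tac.
Qed.

Lemma a7_smooth : smooth_on M (trf (a7 k)).
Proof.
apply: (smooth_ext oM (f := fun x => - trf (d_t (k10 k)) x
  + K8 x * K10 x - K4 x * K7 x - K6 x * K10 x)) => //; smooth_tac.
Qed.

Lemma a11_smooth : smooth_on M (trf (a11 k)).
Proof.
apply: (smooth_ext oM (f := fun x => - trf (d_r (k10 k)) x
  + K9 x * K10 x - K6 x * K7 x - K5 x * K10 x)) => //; smooth_tac.
Qed.

(** In terms of these quotients, a6 to a9 are [m7] times k7, k10, k8, k9, and a10 to a13 are [m11]
    times the same. They become the recurrence factors of V_theta and V_phi in the directions t and
    r. *)
Definition m7 x := trf (a7 k) x / K10 x.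
Definition m11 x := trf (a11 k) x / K10 x.
(* [kk] is k10^2 (2ab + c), and [pp] is the eigenvalue of [Btr] on the row
   (k7, k10, 0, 0). *)
Definition kk x := K7 x * K8 x + K9 x * K10 x.
Definition pp x := (K7 x * trf (a3 k) x + K10 x * trf (a4 k) x) / K10 x.

Lemma m7_smooth : smooth_on M m7.
Proof. exact: (smooth_div oM k10_neq0 a7_smooth K10_smooth). Qed.

Lemma m11_smooth : smooth_on M m11.
Proof. exact: (smooth_div oM k10_neq0 a11_smooth K10_smooth). Qed.

Lemma kk_smooth : smooth_on M kk.
Proof. by rewrite /kk; smooth_tac. Qed.

Lemma pp_smooth : smooth_on M pp.
Proof.
apply: (smooth_div oM k10_neq0 _ K10_smooth); smooth_tac.
  exact: a3_smooth.
exact: a4_smooth.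
Qed.

(** The relations solved for the derivatives of k7 to k10, so that substitution makes the covariant
    derivatives of V_theta and V_phi polynomial; then the eigenvector form of the (t, r) block. *)
Lemma derivative_relations x : M x ->
  [/\ [/\ trf (d_t (k7 k)) x = K7 x * K8 x - K1 x * K7 x - K2 x * K10 x - m7 x * K7 x,
           trf (d_t (k8 k)) x = K1 x * K8 x + K4 x * K9 x - K8 x ^+ 2 - m7 x * K8 x,
           trf (d_t (k9 k)) x = K2 x * K8 x + K6 x * K9 x - K8 x * K9 x - m7 x * K9 x &
           trf (d_t (k10 k)) x = K8 x * K10 x - K4 x * K7 x - K6 x * K10 x - m7 x * K10 x],
      [/\ trf (d_r (k7 k)) x = K7 x * K9 x - K2 x * K7 x - K3 x * K10 x - m11 x * K7 x,
           trf (d_r (k8 k)) x = K2 x * K8 x + K6 x * K9 x - K8 x * K9 x - m11 x * K8 x,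
           trf (d_r (k9 k)) x = K3 x * K8 x + K5 x * K9 x - K9 x ^+ 2 - m11 x * K9 x &
           trf (d_r (k10 k)) x = K9 x * K10 x - K6 x * K7 x - K5 x * K10 x - m11 x * K10 x],
      [/\ K7 x * trf (a1 k) x + K10 x * trf (a2 k) x = K7 x * pp x,
           K7 x * trf (a3 k) x + K10 x * trf (a4 k) x = K10 x * pp x,
           K8 x * trf (a1 k) x + K9 x * trf (a3 k) x = K8 x * (2 * trf (a5 k) x - pp x) &
           K8 x * trf (a2 k) x + K9 x * trf (a4 k) x = K9 x * (2 * trf (a5 k) x - pp x)],
      kk x * (pp x - trf (a5 k) x) = 0 &
      trf (a5 k) x = m7 x * K9 x - m11 x * K8 x].
Proof.
move=> Mx; have z0 := k10_neq0 Mx.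
have [r1 r2 r3 [r6 r8 r9] [r10 r12 r13]] := relations Mx.
have cabc : ca k (x 0 it) (x 0 ir) * cb k (x 0 it) (x 0 ir) + cc k (x 0 it) (x 0 ir)
    = K9 x / K10 x.
  rewrite /ca /cb /cc -/(K7 x) -/(K8 x) -/(K9 x) -/(K10 x).
  move: (K7 x) (K8 x) (K9 x) (K10 x) z0 => u7 u8 u9 u10 u0; by field.
have zE (u v : R) : v / K10 x * (u * K10 x) = u * v by rewrite mulrCA divfK.
have m7E : trf (a7 k) x = m7 x * K10 x by rewrite /m7 divfK.
have m11E : trf (a11 k) x = m11 x * K10 x by rewrite /m11 divfK.
rewrite cabc in r9 r13.
rewrite -/(trf (a7 k) x) m7E zE in r6.
rewrite -/(trf (a7 k) x) m7E zE in r8.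
rewrite -/(trf (a7 k) x) m7E zE in r9.
rewrite -/(trf (a11 k) x) m11E zE in r10.
rewrite -/(trf (a11 k) x) m11E zE in r12.
rewrite -/(trf (a11 k) x) m11E zE in r13.
have t7 : trf (d_t (k7 k)) x = K7 x * K8 x - K1 x * K7 x - K2 x * K10 x - m7 x * K7 x.
  by rewrite -r6 /a6 /trf; ring.
have t8 : trf (d_t (k8 k)) x = K1 x * K8 x + K4 x * K9 x - K8 x ^+ 2 - m7 x * K8 x.
  by rewrite -r8 /a8 /trf; ring.
have t9 : trf (d_t (k9 k)) x = K2 x * K8 x + K6 x * K9 x - K8 x * K9 x - m7 x * K9 x.
  by rewrite -r9 /a9 /trf; ring.
have t10 : trf (d_t (k10 k)) x = K8 x * K10 x - K4 x * K7 x - K6 x * K10 x - m7 x * K10 x.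
  by rewrite -m7E /trf /a7; ring.
have u7 : trf (d_r (k7 k)) x = K7 x * K9 x - K2 x * K7 x - K3 x * K10 x - m11 x * K7 x.
  by rewrite -r10 /a10 /trf; ring.
have u8 : trf (d_r (k8 k)) x = K2 x * K8 x + K6 x * K9 x - K8 x * K9 x - m11 x * K8 x.
  by rewrite -r12 /a12 /trf; ring.
have u9 : trf (d_r (k9 k)) x = K3 x * K8 x + K5 x * K9 x - K9 x ^+ 2 - m11 x * K9 x.
  by rewrite -r13 /a13 /trf; ring.
have u10 : trf (d_r (k10 k)) x = K9 x * K10 x - K6 x * K7 x - K5 x * K10 x - m11 x * K10 x.
  by rewrite -m11E /trf /a11; ring.
(* The expressions for the r-derivative of k8 and the t-derivative of k9 share all terms except
   those with [m11] and [m7]. *)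
have a5E : trf (a5 k) x = m7 x * K9 x - m11 x * K8 x.
  have -> : trf (a5 k) x = trf (d_r (k8 k)) x - trf (d_t (k9 k)) x by [].
  by rewrite u8 t9; ring.
have pE : ca k (x 0 it) (x 0 ir) * trf (a3 k) x + trf (a4 k) x = pp x.
  rewrite /ca /pp mulrDl mulrAC; congr (_ + _).
  by rewrite mulrC mulKf.
have k7E : ca k (x 0 it) (x 0 ir) * K10 x = K7 x by rewrite /ca divfK.
have k8E : cb k (x 0 it) (x 0 ir) * K10 x = K8 x by rewrite /cb divfK.
have k9E : (ca k (x 0 it) (x 0 ir) * cb k (x 0 it) (x 0 ir) + cc k (x 0 it) (x 0 ir))
  * K10 x = K9 x by rewrite cabc divfK.
have := curvature_block_algebra z0 r1 r2 r3.
rewrite -/(trf (a3 k) x) -/(trf (a4 k) x) -/(trf (a1 k) x) -/(trf (a2 k) x).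
rewrite -/(trf (a5 k) x) pE k7E k8E k9E => -[A1 A2 A3 A4].
split=> //; split=> //.
by rewrite /pp [RHS]mulrC divfK.
Qed.

(** All theta-dependence is expressed in [s2] and [ct], whose derivatives are polynomials in them;
    the tables below then need no trigonometric identity beyond [ring]. *)
Lemma sincos_cotan x : M x -> sc x = s2 x * ct x.
Proof.
move=> /sin_neq0; rewrite /thf /sincos /sin2 /cotan => s0.
by move: (sin _) (cos _) s0 => u v u0; field.
Qed.

Lemma derive_const (c : R) v x : 'D_v (fun _ : X4 => c) x = 0.
Proof. exact: derive_cst. Qed.

Lemma derive_sin2 x : M x -> 'D_(evec ith) s2 x = 2 * (s2 x * ct x).
Proof.
move=> Mx; have [_ ->] := is_derive_thf (is_derive_sin2 (x 0 ith)).
by rewrite -sincos_cotan.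
Qed.

Lemma derive_sincos x : M x -> 'D_(evec ith) (fun z => - sc z) x = s2 x - s2 x * ct x ^+ 2.
Proof.
move=> Mx; have Dsc := is_derive_thf (is_derive_sincos (x 0 ith)).
have [_ ->] := is_deriveN Dsc.
have := sin_neq0 Mx; rewrite /thf /sin2 /cotan.
by move: (sin _) (cos _) => u v u0; field.
Qed.

Lemma derive_sincos0 (a : 'I_4) (x : X4) : a != ith -> 'D_(evec a) (fun z => - sc z) x = 0.
Proof.
by move=> an; rewrite -[LHS]/('D_(evec a) (thf (fun s => - sincos s)) x) derive_thf0.
Qed.

Lemma derive_cotan x : M x -> 'D_(evec ith) ct x = - (1 + ct x ^+ 2).
Proof.
move=> Mx; have s0 := sin_neq0 Mx.
have [_ ->] := is_derive_thf (is_derive_cotan s0).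
rewrite /thf /cotan; have := cos2Dsin2 (x 0 ith).
move: (sin _) (cos _) s0 => u v u0 E.
have -> : (u ^+ 2)^-1 = (v ^+ 2 + u ^+ 2) * (u ^+ 2)^-1 by rewrite E mul1r.
by field.
Qed.

Lemma derive_trf_sin2 a f x : M x -> smooth_on M (trf f) ->
  'D_(evec a) (fun z => trf f z * s2 z) x
    = 'D_(evec a) (trf f) x * s2 x + trf f x * 'D_(evec a) s2 x.
Proof.
move=> Mx fs; have fd := @smooth_derivable _ _ _ _ _ (evec a) Mx fs.
have sd := @smooth_derivable _ _ _ _ _ (evec a) Mx sin2_smooth.
by rewrite (deriveM fd sd) addrC [_ *: 'D_(evec a) (trf f) x]mulrC.
Qed.

Lemma derive_trf_sin2_t f x : M x -> smooth_on M (trf f) ->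
  'D_(evec it) (fun z => trf f z * s2 z) x = trf (d_t f) x * s2 x.
Proof.
by move=> Mx fs; rewrite derive_trf_sin2// derive_trf_t derive_thf0// mulr0 addr0.
Qed.

Lemma derive_trf_sin2_r f x : M x -> smooth_on M (trf f) ->
  'D_(evec ir) (fun z => trf f z * s2 z) x = trf (d_r f) x * s2 x.
Proof.
by move=> Mx fs; rewrite derive_trf_sin2// derive_trf_r derive_thf0// mulr0 addr0.
Qed.

Lemma derive_trf_sin2_th f x : M x -> smooth_on M (trf f) ->
  'D_(evec ith) (fun z => trf f z * s2 z) x = trf f x * (2 * (s2 x * ct x)).
Proof.
by move=> Mx fs; rewrite derive_trf_sin2// derive_trf_th derive_sin2// mul0r add0r.
Qed.

Lemma derive_trf_sin2_ph f x : M x -> smooth_on M (trf f) ->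
  'D_(evec iph) (fun z => trf f z * s2 z) x = 0.
Proof.
move=> Mx fs; rewrite derive_trf_sin2// derive_trf_ph derive_thf0//.
by rewrite mulr0 mul0r addr0.
Qed.

(** * The generating matrix fields, their covariant derivatives and the curvature *)

Definition Vth x : 'M[R]_4 := mx4
  [:: [:: 0; 0; K8 x; 0]; [:: 0; 0; K9 x; 0]; [:: K7 x; K10 x; 0; 0]; [:: 0; 0; 0; 0]].

Definition Vph x : 'M[R]_4 := mx4
  [:: [:: 0; 0; 0; K8 x]; [:: 0; 0; 0; K9 x]; [:: 0; 0; 0; 0];
      [:: K7 x * s2 x; K10 x * s2 x; 0; 0]].

(** The infinitesimal rotation of (thetadot, phidot) preserving thetadot^2 + [s2] phidot^2. *)
Definition Rot x : 'M[R]_4 := mx4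
  [:: [:: 0; 0; 0; 0]; [:: 0; 0; 0; 0]; [:: 0; 0; 0; -1]; [:: 0; 0; s2 x; 0]].

Definition Btr x : 'M[R]_4 := mx4
  [:: [:: trf (a1 k) x; trf (a3 k) x; 0; 0]; [:: trf (a2 k) x; trf (a4 k) x; 0; 0];
      [:: 0; 0; trf (a5 k) x; 0]; [:: 0; 0; 0; trf (a5 k) x]].

Ltac mx4_entries :=
  rewrite ?conn_t ?conn_r ?conn_th ?conn_ph /Vth /Vph /Rot ?dmx4 /=;
  repeat rewrite ?derive_const ?derive_trf_t ?derive_trf_r ?derive_trf_th ?derive_trf_ph
    ?(derive_trf_sin2_t _ K7_smooth) ?(derive_trf_sin2_t _ K10_smooth)
    ?(derive_trf_sin2_r _ K7_smooth) ?(derive_trf_sin2_r _ K10_smooth)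
    ?(derive_trf_sin2_th _ K7_smooth) ?(derive_trf_sin2_th _ K10_smooth)
    ?(derive_trf_sin2_ph _ K7_smooth) ?(derive_trf_sin2_ph _ K10_smooth)
    ?derive_sincos ?derive_cotan ?derive_sin2 ?derive_sincos0 ?derive_thf0 //;
  rewrite ?mx4M ?mx4Z ?mx4N ?mx4D ?mx4N ?mx4D ?mx4N ?mx4D /=.

Ltac gen_atoms := repeat match goal with
  | |- context [trf ?f ?x] => generalize (trf f x); intro
  | |- context [thf ?f ?x] => generalize (thf f x); intro
  | |- context [m7 ?x] => generalize (m7 x); intro
  | |- context [m11 ?x] => generalize (m11 x); intro
  | |- context [pp ?x] => generalize (pp x); intro
  end.

Ltac rewrite_derivatives := repeat match goal with
  | H : trf (d_t _) _ = _ |- _ => rewrite ?H; clear H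
  | H : trf (d_r _) _ = _ |- _ => rewrite ?H; clear H
  end.

Ltac table Mx :=
  rewrite /nabla /curv /kk /Btr; mx4_entries;
  case: (derivative_relations Mx) => -[? ? ? ?] [? ? ? ?] _ _ _;
  rewrite_derivatives; rewrite ?(sincos_cotan Mx);
  apply: mx4_eq; gen_atoms; ring.

Lemma nabla_t_Vth x : M x -> nabla Gam it Vth x = - m7 x *: Vth x.
Proof. by move=> Mx; table Mx. Qed.

Lemma nabla_r_Vth x : M x -> nabla Gam ir Vth x = - m11 x *: Vth x.
Proof. by move=> Mx; table Mx. Qed.

Lemma nabla_th_Vth x : M x -> nabla Gam ith Vth x = 0 *: Vth x.
Proof. by move=> Mx; table Mx. Qed.

Lemma nabla_ph_Vth x : M x ->
  nabla Gam iph Vth x = ct x *: Vph x + (- kk x) *: Rot x.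
Proof. by move=> Mx; table Mx. Qed.

Lemma nabla_t_Vph x : M x -> nabla Gam it Vph x = - m7 x *: Vph x.
Proof. by move=> Mx; table Mx. Qed.

Lemma nabla_r_Vph x : M x -> nabla Gam ir Vph x = - m11 x *: Vph x.
Proof. by move=> Mx; table Mx. Qed.

Lemma nabla_th_Vph x : M x ->
  nabla Gam ith Vph x = ct x *: Vph x + kk x *: Rot x.
Proof. by move=> Mx; table Mx. Qed.

Lemma nabla_ph_Vph x : M x -> nabla Gam iph Vph x = - sc x *: Vth x.
Proof. by move=> Mx; table Mx. Qed.

Lemma nabla_t_Rot x : M x -> nabla Gam it Rot x = 0 *: Rot x.
Proof. by move=> Mx; table Mx. Qed.

Lemma nabla_r_Rot x : M x -> nabla Gam ir Rot x = 0 *: Rot x.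
Proof. by move=> Mx; table Mx. Qed.

Lemma nabla_th_Rot x : M x -> nabla Gam ith Rot x = ct x *: Rot x + 1 *: Vph x.
Proof. by move=> Mx; table Mx. Qed.

Lemma nabla_ph_Rot x : M x -> nabla Gam iph Rot x = - s2 x *: Vth x.
Proof. by move=> Mx; table Mx. Qed.

Lemma curv_tr x : M x -> curv Gam it ir x = Btr x.
Proof.
move=> Mx; rewrite /Btr.
have -> : trf (a1 k) x = trf (d_r (k1 k)) x - trf (d_t (k2 k)) x
  + K3 x * K4 x - K2 x * K6 x by [].
have -> : trf (a2 k) x = trf (d_r (k2 k)) x - trf (d_t (k3 k)) x
  + K2 x ^+ 2 + K3 x * K6 x - K1 x * K3 x - K2 x * K5 x by [].
have -> : trf (a3 k) x = trf (d_r (k4 k)) x - trf (d_t (k6 k)) x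
  + K1 x * K6 x + K4 x * K5 x - K2 x * K4 x - K6 x ^+ 2 by [].
have -> : trf (a4 k) x = trf (d_r (k6 k)) x - trf (d_t (k5 k)) x
  + K2 x * K6 x - K3 x * K4 x by [].
have -> : trf (a5 k) x = trf (d_r (k8 k)) x - trf (d_t (k9 k)) x by [].
table Mx.
Qed.

Lemma curv_t_th x : M x -> curv Gam it ith x = m7 x *: Vth x.
Proof. by move=> Mx; table Mx. Qed.

Lemma curv_r_th x : M x -> curv Gam ir ith x = m11 x *: Vth x.
Proof. by move=> Mx; table Mx. Qed.

Lemma curv_t_ph x : M x -> curv Gam it iph x = m7 x *: Vph x.
Proof. by move=> Mx; table Mx. Qed.

Lemma curv_r_ph x : M x -> curv Gam ir iph x = m11 x *: Vph x.
Proof. by move=> Mx; table Mx. Qed.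

(** The 1 is the curvature of the unit sphere; [kk], the pairing of X with sigma, enters as in the
    Gauss equation. *)
Lemma curv_th_ph x : M x -> curv Gam ith iph x = - (1 + kk x) *: Rot x.
Proof. by move=> Mx; table Mx. Qed.


(** [Btr] does not depend on the angles, so only its commutator with the connection matrix remains.
    The eigenvalues [pp] and 2 a5 - [pp] of the block, compared with the angular factor a5, give the
    same coefficient in the row and the column. *)
Lemma nabla_th_Btr x : M x ->
  nabla Gam ith Btr x = (trf (a5 k) x - pp x) *: Vth x.
Proof.
move=> Mx; rewrite /nabla /Btr; mx4_entries.
have [_ _ [] + + + + _ _] := derivative_relations Mx.
by gen_atoms => r1 r2 r3 r4; apply: mx4_eq; lra.
Qed.

Lemma nabla_ph_Btr x : M x ->
  nabla Gam iph Btr x = (trf (a5 k) x - pp x) *: Vph x.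
Proof.
move=> Mx; rewrite /nabla /Btr; mx4_entries.
have [_ _ [r1 r2 r3 r4] _ _] := derivative_relations Mx.
(* The phi row carries the factor [s2]; its multiples of the relations must be supplied because
   [lra] is linear. *)
have := congr1 (fun z => z * s2 x) r1; have := congr1 (fun z => z * s2 x) r2.
move: r1 r2 r3 r4 => /=.
by gen_atoms => r1 r2 r3 r4 r5 r6; apply: mx4_eq; lra.
Qed.

Lemma mx4_smooth (a0 a1 a2 a3 b0 b1 b2 b3 c0 c1 c2 c3 d0 d1 d2 d3 : X4 -> R) :
  smooth_on M a0 -> smooth_on M a1 -> smooth_on M a2 -> smooth_on M a3 ->
  smooth_on M b0 -> smooth_on M b1 -> smooth_on M b2 -> smooth_on M b3 ->
  smooth_on M c0 -> smooth_on M c1 -> smooth_on M c2 -> smooth_on M c3 ->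
  smooth_on M d0 -> smooth_on M d1 -> smooth_on M d2 -> smooth_on M d3 ->
  mx_smooth M (fun z => mx4 [:: [:: a0 z; a1 z; a2 z; a3 z];
    [:: b0 z; b1 z; b2 z; b3 z]; [:: c0 z; c1 z; c2 z; c3 z];
    [:: d0 z; d1 z; d2 z; d3 z]]).
Proof.
move=> *; apply: forall_ord4; apply: forall_ord4; (eapply (smooth_ext oM);
  [by move=> x _; rewrite [RHS]mxE /=; reflexivity|by []]).
Qed.

Lemma Vth_smooth : mx_smooth M Vth.
Proof.
apply: mx4_smooth; by [exact: smooth_cst|exact: K7_smooth|exact: K8_smooth
  |exact: K9_smooth|exact: K10_smooth].
Qed.

Lemma Vph_smooth : mx_smooth M Vph.
Proof.
have := smoothM oM K7_smooth sin2_smooth; have := smoothM oM K10_smooth sin2_smooth.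
move=> s7 s10; apply: mx4_smooth; by [exact: smooth_cst|exact: s7|exact: s10|exact: K8_smooth
  |exact: K9_smooth].
Qed.

Lemma Rot_smooth : mx_smooth M Rot.
Proof. apply: mx4_smooth; by [exact: smooth_cst|exact: sin2_smooth]. Qed.

Lemma Btr_smooth : mx_smooth M Btr.
Proof.
apply: mx4_smooth; by [exact: smooth_cst|exact: a1_smooth|exact: a2_smooth
  |exact: a3_smooth|exact: a4_smooth|exact: a5_smooth].
Qed.

Inductive generator : (X4 -> 'M[R]_4) -> Prop :=
| gen_Vth : generator Vth
| gen_Vph : generator Vph
| gen_Rot : generator Rot
| gen_Btr : generator Btr.

Lemma generator_smooth N : generator N -> mx_smooth M N.
Proof.
by case; [exact: Vth_smooth|exact: Vph_smooth|exact: Rot_smooth|exact: Btr_smooth].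
Qed.

Local Notation span := (smooth_span M generator).

Lemma span_gen1 f N N' : smooth_on M f -> generator N ->
  (forall x, M x -> N' x = f x *: N x) -> span N'.
Proof.
by move=> fs gN E; apply: span_ext (span_scale fs (span_gen M gN)) _ => x /E.
Qed.

Lemma span_gen2 f1 f2 N1 N2 N' : smooth_on M f1 -> smooth_on M f2 ->
  generator N1 -> generator N2 ->
  (forall x, M x -> N' x = f1 x *: N1 x + f2 x *: N2 x) -> span N'.
Proof.
move=> s1 s2 g1 g2 E; apply: span_ext (span_add (span_scale s1 (span_gen M g1))
  (span_scale s2 (span_gen M g2))) _ => x /E //.
Qed.

Lemma curv_span a b : span (curv Gam a b).
Proof.
have s0 : smooth_on M (fun=> 0 : R) by exact: smooth_cst.
have sN1 : smooth_on M (fun=> -1 : R) by exact: smooth_cst.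
have s1 : smooth_on M (fun=> 1 : R) by exact: smooth_cst.
have diag c : span (curv Gam c c).
  by apply: (span_gen1 s0 gen_Rot) => x _; rewrite curv_diag scale0r.
have anti c d : span (curv Gam c d) -> span (curv Gam d c).
  by move=> h; apply: span_ext (span_scale sN1 h) _ => x _; rewrite -curv_anti.
have tr : span (curv Gam it ir).
  apply: (span_gen1 s1 gen_Btr) => x Mx.
  by rewrite curv_tr// scale1r.
have tth : span (curv Gam it ith) := span_gen1 m7_smooth gen_Vth curv_t_th.
have rth : span (curv Gam ir ith) := span_gen1 m11_smooth gen_Vth curv_r_th.
have tph : span (curv Gam it iph) := span_gen1 m7_smooth gen_Vph curv_t_ph.
have rph : span (curv Gam ir iph) := span_gen1 m11_smooth gen_Vph curv_r_ph.
have thph : span (curv Gam ith iph).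
  apply: (span_gen1 _ gen_Rot curv_th_ph).
  by apply: smoothN => //; apply: smoothD => //; exact: kk_smooth.
by move: a b; apply: forall_ord4; apply: forall_ord4 => //; exact: anti.
Qed.

(** * Iterated brackets and the dimension of the vertical part *)

Variable A : set (TM4 R).
Hypothesis oA : open A.
Hypothesis M_A : forall x, M x -> exists y, A (x, y).
Hypothesis a5_neq0 : forall x, M x -> trf (a5 k) x != 0.

Lemma slice_coord_neq0 x a : M x -> exists2 y, A (x, y) & y 0 a != 0.
Proof.
move=> /M_A[y Ay]; have [|y0] := eqVneq (y 0 a) 0; last by exists y.
move=> y0; have [h h0 [Ah _]] := open_perturb (evec a) (open_slice (x := x) oA) Ay.
by exists (y + h *: evec a) => //; rewrite addrC evec_shift eqxx y0 addr0.
Qed.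

Local Notation dt := (delta Gam it).
Local Notation dr := (delta Gam ir).

Lemma bracket_tr p : M p.1 -> bracket dt dr p = vert Btr p.
Proof.
move=> Mp; rewrite bracket_delta_delta; try exact: conn_derivable.
by rewrite /vert curv_tr.
Qed.

Lemma bracket_delta_Btr a p : M p.1 ->
  bracket (delta Gam a) (bracket dt dr) p = vert (nabla Gam a Btr) p.
Proof.
move=> Mp; rewrite (bracket_eq_near _ (open_fst oM) Mp bracket_tr).
apply: bracket_delta_vert => i j.
exact: smooth_derivable Mp (Btr_smooth i j).
Qed.

(* The theta column of nabla_a Btr is that of Btr up to a factor depending on
   (t, r) only, which determines the proportionality factor. *)
Lemma nabla_Btr_proportional a f : proportional_on A
    (bracket (delta Gam a) (bracket dt dr)) (bracket dt dr) ->
  (forall x, M x -> exists b0 b1 b2 b3, nabla Gam a Btr x = mx4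
     [:: [:: b0; b1; 0; 0]; [:: b2; b3; 0; 0];
         [:: 0; 0; trf f x; 0]; [:: 0; 0; 0; trf f x]]) ->
  forall x, M x -> nabla Gam a Btr x = (trf f x / trf (a5 k) x) *: Btr x.
Proof.
move=> [mu muE] form x Mx; apply/eqP; rewrite -subr_eq0; apply/eqP.
set N := _ - _.
have NE y : A (x, y) -> y 0 ith != 0 -> y *m N = 0.
  move=> Ay y0; have Ap : M (x, y).1 by exact: Mx.
  have := muE _ Ay; rewrite bracket_delta_Btr// bracket_tr// => /(congr1 snd) /= E.
  have : (y *m nabla Gam a Btr x) 0 ith = mu (x, y) * (y *m Btr x) 0 ith.
    by rewrite E mxE.
  have [b0 [b1 [b2 [b3 ->]]]] := form x Mx.
  rewrite !mxE !sum4 !mxE /= !mulr0 !add0r !addr0 mulrCA [RHS]mulrA => {}muE'.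
  have muF : mu (x, y) = trf f x / trf (a5 k) x.
    apply: (mulfI y0); apply: (mulIf (a5_neq0 Mx)).
    by rewrite mulrA divfK ?a5_neq0// muE' mulrAC mulrA.
  by rewrite /N mulmxBr E muF -scalemxAr subrr.
have [y Ay y0] := slice_coord_neq0 ith Mx.
have oS := openI (open_slice (x := x) oA) (open_coord_neq0 (a := ith)).
have vN (v : X4) : v *m N = 0.
  (* [N] kills both y and y + h v, hence v by subtraction. *)
  have [h h0 [[Ah hn] _]] := open_perturb v oS (conj Ay y0).
  have := NE _ Ah hn; rewrite mulmxDl (NE _ Ay y0) add0r -scalemxAl.
  by move=> /eqP; rewrite scaler_eq0 (negbTE h0) => /eqP.
by apply/row_matrixP => i; rewrite rowE vN row0.
Qed.

Hypothesis prop_t : proportional_on A (bracket dt (bracket dt dr)) (bracket dt dr).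
Hypothesis prop_r : proportional_on A (bracket dr (bracket dt dr)) (bracket dt dr).

(** The angular block of [Btr] is a5 times the identity and commutes with the connection matrix, so
    its covariant derivative is just that of a5. *)
Lemma nabla_t_Btr x : M x ->
  nabla Gam it Btr x = (trf (d_t (a5 k)) x / trf (a5 k) x) *: Btr x.
Proof.
apply: nabla_Btr_proportional => // {}x Mx; do 4 eexists.
rewrite /nabla /Btr; mx4_entries.
by apply: mx4_eq; try reflexivity; gen_atoms; ring.
Qed.

Lemma nabla_r_Btr x : M x ->
  nabla Gam ir Btr x = (trf (d_r (a5 k)) x / trf (a5 k) x) *: Btr x.
Proof.
apply: nabla_Btr_proportional => // {}x Mx; do 4 eexists.
rewrite /nabla /Btr; mx4_entries.
by apply: mx4_eq; try reflexivity; gen_atoms; ring.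
Qed.

Lemma generator_nabla a N : generator N -> span (nabla Gam a N).
Proof.
have s0 : smooth_on M (fun=> 0 : R) by exact: smooth_cst.
have s1 : smooth_on M (fun=> 1 : R) by exact: smooth_cst.
have sp : smooth_on M (fun x => trf (a5 k) x - pp x).
  by apply: smoothB => //; [exact: a5_smooth|exact: pp_smooth].
move=> gN; move: a; case: gN; apply: forall_ord4.
- exact: (span_gen1 (smoothN oM m7_smooth) gen_Vth nabla_t_Vth).
- exact: (span_gen1 (smoothN oM m11_smooth) gen_Vth nabla_r_Vth).
- exact: (span_gen1 s0 gen_Vth nabla_th_Vth).
- exact: (span_gen2 cot_smooth (smoothN oM kk_smooth) gen_Vph gen_Rot nabla_ph_Vth).
- exact: (span_gen1 (smoothN oM m7_smooth) gen_Vph nabla_t_Vph).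
- exact: (span_gen1 (smoothN oM m11_smooth) gen_Vph nabla_r_Vph).
- exact: (span_gen2 cot_smooth kk_smooth gen_Vph gen_Rot nabla_th_Vph).
- exact: (span_gen1 (smoothN oM sincos_smooth) gen_Vth nabla_ph_Vph).
- exact: (span_gen1 s0 gen_Rot nabla_t_Rot).
- exact: (span_gen1 s0 gen_Rot nabla_r_Rot).
- exact: (span_gen2 cot_smooth s1 gen_Rot gen_Vph nabla_th_Rot).
- exact: (span_gen1 (smoothN oM sin2_smooth) gen_Vth nabla_ph_Rot).
- exact: (span_gen1 (smooth_div oM a5_neq0 (trf_dt_smooth a5_smooth) a5_smooth)
    gen_Btr nabla_t_Btr).
- exact: (span_gen1 (smooth_div oM a5_neq0 (trf_dr_smooth a5_smooth) a5_smooth)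
    gen_Btr nabla_r_Btr).
- exact: (span_gen1 sp gen_Vth nabla_th_Btr).
- exact: (span_gen1 sp gen_Vph nabla_ph_Btr).
Qed.

Definition gen_comb x (N : 'M[R]_4) := exists c1 c2 c3 c4 : R,
  N = c1 *: Vth x + c2 *: Vph x + c3 *: Rot x + c4 *: Btr x.

Lemma span_comb N x : span N -> M x -> gen_comb x (N x).
Proof.
move=> + Mx; elim=> {N} [N|N1 N2 _ [c1 [c2 [c3 [c4 E1]]]] _ [d1 [d2 [d3 [d4 E2]]]]
  |f N _ _ [c1 [c2 [c3 [c4 E]]]]|N1 N2 _ [c1 [c2 [c3 [c4 E]]]] N12].
- case; [exists 1, 0, 0, 0|exists 0, 1, 0, 0|exists 0, 0, 1, 0|exists 0, 0, 0, 1];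
  by rewrite !scale0r scale1r ?addr0 ?add0r.
- exists (c1 + d1), (c2 + d2), (c3 + d3), (c4 + d4).
  rewrite E1 E2 !scalerDl [LHS]addrACA [X in X + _ = _]addrACA.
  by rewrite [X in X + _ + _ = _]addrACA.
- exists (f x * c1), (f x * c2), (f x * c3), (f x * c4).
  by rewrite E !scalerDr !scalerA.
- by exists c1, c2, c3, c4; rewrite -N12.
Qed.

Lemma nested_bracket_comb a b s p : M p.1 ->
  exists2 N, gen_comb p.1 N &
    nested_bracket Gam a (b :: s) p = (0, p.2 *m N).
Proof.
move=> Mp.
have [N sN NE] : exists2 N, span N &
    forall p, M p.1 -> nested_bracket Gam a (b :: s) p = vert N p.
  apply: (nested_bracket_vert oM).
  - by move=> *; exact: conn_derivable.
  - by move=> N x v sN Mx; exact: (smooth_span_derivable oM generator_smooth).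
  - exact: curv_span.
  - by move=> c N; exact: (smooth_span_nabla oM generator_smooth generator_nabla).
by exists (N p.1); [exact: span_comb|exact: NE].
Qed.

Definition fibre_comb (p : TM4 R) (v : X4) := exists2 N, gen_comb p.1 N & v = p.2 *m N.

Lemma gen_combD x N1 N2 : gen_comb x N1 -> gen_comb x N2 -> gen_comb x (N1 + N2).
Proof.
move=> [c1 [c2 [c3 [c4 ->]]]] [d1 [d2 [d3 [d4 ->]]]].
exists (c1 + d1), (c2 + d2), (c3 + d3), (c4 + d4).
rewrite !scalerDl [LHS]addrACA [X in X + _ = _]addrACA.
by rewrite [X in X + _ + _ = _]addrACA.
Qed.

Lemma gen_combZ x (c : R) N : gen_comb x N -> gen_comb x (c *: N).
Proof.
move=> [c1 [c2 [c3 [c4 ->]]]]; exists (c * c1), (c * c2), (c * c3), (c * c4).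
by rewrite !scalerDr !scalerA.
Qed.

(** A vertical combination may contain fields delta_a whose base parts cancel. The linear map [Phi]
    is the projection along the delta_a: it kills them and fixes vertical vectors. *)
Lemma hol_sub p v : M p.1 -> vertical_part (hol_distribution Gam p) v -> fibre_comb p v.
Proof.
move=> Mp [n [c [s [sS E]]]].
pose Phi (q : TM4 R) := q.2 + \sum_(a < 4) q.1 0 a *: (p.2 *m conn_mx Gam a p.1).
have -> : v = Phi (0, v).
  by rewrite /Phi /= big1 ?addr0// => a _; rewrite mxE scale0r.
rewrite E; apply: (big_ind (fun q => fibre_comb p (Phi q))).
- exists (0 *: Vth p.1).
    by apply: gen_combZ; exists 1, 0, 0, 0; rewrite !scale0r scale1r !addr0.
  rewrite scale0r mulmx0 /Phi /= add0r big1// => a _.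
  by rewrite mxE scale0r.
- move=> q1 q2 [N1 c1 E1] [N2 c2 E2]; exists (N1 + N2); first exact: gen_combD.
  rewrite mulmxDr -E1 -E2 /Phi /= [RHS]addrACA -big_split /=; congr (_ + _).
  by apply: eq_bigr => a _; rewrite mxE scalerDl.
- move=> i _; have [N cN EN] : fibre_comb p (Phi (s i)).
    have [a [[|b l] ->]] := sS i; last first.
      have [N cN ->] := nested_bracket_comb a b l Mp; exists N => //.
      by rewrite /Phi /= big1 ?addr0// => d _; rewrite mxE scale0r.
    exists (0 *: Vth p.1).
      by apply: gen_combZ; exists 1, 0, 0, 0; rewrite !scale0r scale1r !addr0.
    rewrite scale0r mulmx0 -[nested_bracket _ _ _]/(delta Gam a) deltaE.
    rewrite /Phi /= (bigD1 a)//= big1 => [|d da].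
      by rewrite mxE !eqxx scale1r addr0 addNr.
    by rewrite mxE eqxx /= (negbTE da) scale0r.
  exists (c i *: N); first exact: gen_combZ.
  rewrite -scalemxAr -EN /Phi /= scalerDr scaler_sumr; congr (_ + _).
  by apply: eq_bigr => a _; rewrite mxE scalerA.
Qed.

Definition in_hol (p : TM4 R) (N : 'M[R]_4) := hol_distribution Gam p (0, p.2 *m N).

Lemma in_hol_unscale p (c : R) N : c != 0 -> in_hol p (c *: N) -> in_hol p N.
Proof.
move=> c0 /(lspan_scale c^-1); rewrite /in_hol -scalemxAr.
suff -> : c^-1 *: ((0, c *: (p.2 *m N)) : TM4 R) = (0, p.2 *m N) by [].
by apply: injective_projections; rewrite /= ?scaler0// scalerA mulVf// scale1r.
Qed.

Lemma in_hol_scale p (c : R) N : in_hol p N -> in_hol p (c *: N).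
Proof.
move=> /(lspan_scale c); rewrite /in_hol -scalemxAr.
suff -> : c *: ((0, p.2 *m N) : TM4 R) = (0, c *: (p.2 *m N)) by [].
by apply: injective_projections; rewrite /= ?scaler0.
Qed.

Lemma in_holD p N1 N2 : in_hol p N1 -> in_hol p N2 -> in_hol p (N1 + N2).
Proof.
move=> h1 h2; have := lspan_add h1 h2; rewrite /in_hol mulmxDr.
suff -> : ((0, p.2 *m N1) : TM4 R) + (0, p.2 *m N2)
    = (0, p.2 *m N1 + p.2 *m N2) by [].
by apply: injective_projections; rewrite /= ?addr0.
Qed.

Lemma in_hol_nested p a b s N : nested_bracket Gam a (b :: s) p = (0, p.2 *m N) ->
  in_hol p N.
Proof. by move=> E; apply: lspan_gen; exists a, (b :: s). Qed.

Lemma in_hol_curv p a b : M p.1 -> in_hol p (curv Gam a b p.1).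
Proof.
move=> Mp; apply: (@in_hol_nested p a b [::]).
by apply: bracket_delta_delta; exact: conn_derivable.
Qed.

Lemma in_hol_nabla_curv p c a b (N : X4 -> 'M[R]_4) : M p.1 ->
  (forall x, M x -> curv Gam a b x = N x) -> mx_smooth M N ->
  in_hol p (nabla Gam c N p.1).
Proof.
move=> Mp E Ns; apply: (@in_hol_nested p c a [:: b]).
rewrite -[RHS]/(vert (nabla Gam c N) p) -bracket_delta_vert; last first.
  by move=> i j; exact: smooth_derivable Mp (Ns i j).
apply: (bracket_eq_near _ (open_fst oM) Mp) => q Mq.
by rewrite bracket_delta_delta /vert ?E//; exact: conn_derivable.
Qed.

Lemma in_hol_Btr p : M p.1 -> in_hol p (Btr p.1).
Proof. by move=> Mp; rewrite -curv_tr//; exact: in_hol_curv. Qed.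

Lemma m7_m11_neq0 x : M x -> (m7 x != 0) || (m11 x != 0).
Proof.
move=> Mx; have [_ _ _ _ E] := derivative_relations Mx.
have := a5_neq0 Mx; rewrite E; apply: contra_neqT.
by rewrite negb_or !negbK => /andP[/eqP -> /eqP ->]; rewrite !mul0r subrr.
Qed.

Lemma in_hol_Vth p : M p.1 -> in_hol p (Vth p.1).
Proof.
move=> Mp; have /orP[m0|m0] := m7_m11_neq0 Mp; apply: (in_hol_unscale m0).
  by rewrite -curv_t_th//; exact: in_hol_curv.
by rewrite -curv_r_th//; exact: in_hol_curv.
Qed.

Lemma in_hol_Vph p : M p.1 -> in_hol p (Vph p.1).
Proof.
move=> Mp; have /orP[m0|m0] := m7_m11_neq0 Mp; apply: (in_hol_unscale m0).
  by rewrite -curv_t_ph//; exact: in_hol_curv.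
by rewrite -curv_r_ph//; exact: in_hol_curv.
Qed.

(* Rot is obtained from [delta_theta, delta_phi] unless kk = -1, in which case
   it appears in [delta_phi, [delta_a, delta_theta]] with factor kk. *)
Lemma in_hol_Rot p : M p.1 -> in_hol p (Rot p.1).
Proof.
move=> Mp; have [k1|k0] := eqVneq (1 + kk p.1) 0; last first.
  apply: (@in_hol_unscale p (- (1 + kk p.1))); first by rewrite oppr_eq0.
  by rewrite -curv_th_ph//; exact: in_hol_curv.
have kN : - kk p.1 = 1 by apply/eqP; rewrite -subr_eq0 -oppr_eq0 opprB opprK k1.
suff key a m : m p.1 != 0 -> smooth_on M m ->
    (forall x, M x -> curv Gam a ith x = m x *: Vth x) -> in_hol p (Rot p.1).
  have /orP[m0|m0] := m7_m11_neq0 Mp.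
    by apply: (key it) m0 m7_smooth _; exact: curv_t_th.
  by apply: (key ir) m0 m11_smooth _; exact: curv_r_th.
move=> m0 ms E; have ds : mx_smooth M (fun x => m x *: Vth x).
  move=> i j; apply: (smooth_ext oM _ (smoothM oM ms (Vth_smooth i j))) => x _.
  by rewrite [RHS]mxE.
have := in_hol_nabla_curv iph Mp E ds.
rewrite nablaZ; [|exact: smooth_derivable Mp ms|]; last first.
  by move=> i j; exact: smooth_derivable Mp (Vth_smooth i j).
rewrite nabla_ph_Vth// kN scale1r; set d := 'D_(evec iph) m p.1 => h.
apply: (in_hol_unscale m0).
(* The bracket [h] contains the rotation up to multiples of V_theta and V_phi, which lie in the
   distribution already. *)
have -> : m p.1 *: Rot p.1 = (d *: Vth p.1 + m p.1 *: (ct p.1 *: Vph p.1 + Rot p.1))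
    + - d *: Vth p.1 + (- (m p.1 * ct p.1)) *: Vph p.1.
  rewrite scalerDr scalerA scaleNr scaleNr [d *: _ + _]addrC addrK.
  by rewrite [_ + _ *: Rot _]addrC addrK.
apply: in_holD; last by apply: in_hol_scale; exact: in_hol_Vph.
by apply: in_holD => //; apply: in_hol_scale; exact: in_hol_Vth.
Qed.

Lemma hol_fibre p v : M p.1 ->
  vertical_part (hol_distribution Gam p) v <-> fibre_comb p v.
Proof.
move=> Mp; split=> [|[N [c1 [c2 [c3 [c4 ->]]]] ->]]; first exact: hol_sub.
apply: in_holD; last by apply: in_hol_scale; exact: in_hol_Btr.
apply: in_holD; last by apply: in_hol_scale; exact: in_hol_Rot.
by apply: in_holD; apply: in_hol_scale; [exact: in_hol_Vth|exact: in_hol_Vph].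
Qed.

(** When s = sigma(y) is nonzero, the relation s Rot = phidot [s2] V_theta - thetadot V_phi
    eliminates the rotation. When s = 0, V_theta and V_phi both become multiples of (k7, k10, 0, 0),
    which takes their place. *)
Lemma hol_dim3 (p : TM4 R) : M p.1 ->
  K7 p.1 * trf (a3 k) p.1 - K10 p.1 * trf (a1 k) p.1 != 0 ->
  ~ (K10 p.1 * p.2 0 it - K7 p.1 * p.2 0 ir = 0 /\
     kk p.1 * p.2 0 ir ^+ 2
       = K10 p.1 ^+ 2 * (p.2 0 ith ^+ 2 + p.2 0 iph ^+ 2 * s2 p.1)) ->
  ~ [/\ kk p.1 != 0, p.2 0 it * K8 p.1 + p.2 0 ir * K9 p.1 = 0,
        p.2 0 ith = 0 & p.2 0 iph = 0] ->
  has_dim (vertical_part (hol_distribution Gam p)) 3.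
Proof.
case: p => x y /= Mx F0 excl1 excl2.
have q0 := k10_neq0 Mx; have b0 := a5_neq0 Mx.
have [_ _ [r1 r2 _ _] r3 a5E] := derivative_relations Mx.
have z0 : 0 < s2 x by rewrite lt_def sqr_ge0 andbT sqrf_eq0 sin_neq0.
have yVth : y *m Vth x = row4 (y 0 ith * K7 x) (y 0 ith * K10 x)
    (y 0 it * K8 x + y 0 ir * K9 x) 0.
  by rewrite row4M /=; congr row4; ring.
have yVph : y *m Vph x = row4 (y 0 iph * (K7 x * s2 x)) (y 0 iph * (K10 x * s2 x))
    0 (y 0 it * K8 x + y 0 ir * K9 x).
  by rewrite row4M /=; congr row4; ring.
have yRot : y *m Rot x = row4 0 0 (y 0 iph * s2 x) (- y 0 ith).
  by rewrite row4M /=; congr row4; ring.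
have yBtr : y *m Btr x = row4 (y 0 it * trf (a1 k) x + y 0 ir * trf (a2 k) x)
    (y 0 it * trf (a3 k) x + y 0 ir * trf (a4 k) x)
    (y 0 ith * trf (a5 k) x) (y 0 iph * trf (a5 k) x).
  by rewrite row4M /=; congr row4; ring.
have fibE v : vertical_part (hol_distribution Gam (x, y)) v <->
    exists c1 c2 c3 c4 : R, v = c1 *: (y *m Vth x) + c2 *: (y *m Vph x)
      + c3 *: (y *m Rot x) + c4 *: (y *m Btr x).
  split=> [/(hol_fibre (p := (x, y)) v Mx)[N [c1 [c2 [c3 [c4 ->]]]] ->]
    |[c1 [c2 [c3 [c4 vE]]]]].
    by exists c1, c2, c3, c4; rewrite !mulmxDr -!scalemxAr.
  apply/(hol_fibre (p := (x, y)) v Mx).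
  exists (c1 *: Vth x + c2 *: Vph x + c3 *: Rot x + c4 *: Btr x).
    by exists c1, c2, c3, c4.
  by rewrite vE !mulmxDr -!scalemxAr.
set s := y 0 it * K8 x + y 0 ir * K9 x in yVth yVph excl2.
have [sE|s0] := eqVneq s 0; last first.
  apply: (has_dim3 (v1 := y *m Vth x) (v2 := y *m Vph x) (v3 := y *m Btr x)) => [v|c1 c2 c3].
    rewrite fibE; split=> [[c1 [c2 [c3 [c4 ->]]]]|[c1 [c2 [c3 ->]]]]; last first.
      by exists c1, c2, 0, c3; rewrite scale0r addr0.
    have -> : y *m Rot x = (y 0 iph * s2 x / s) *: (y *m Vth x)
        + (- y 0 ith / s) *: (y *m Vph x).
      rewrite yRot yVth yVph !row4Z row4D; congr row4; rewrite -?/s.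
      - ring.
      - ring.
      - by rewrite divfK// mulr0 addr0.
      - by rewrite divfK// mulr0 add0r.
    exists (c1 + c3 * (y 0 iph * s2 x / s)), (c2 + c3 * (- y 0 ith / s)), c4.
    by rewrite scalerDr !scalerA !scalerDl [X in X + _ = _]addrACA.
  rewrite yVth yVph yBtr !row4Z !row4D => /row4_eq0[et er eh ep].
  rewrite mulr0 addr0 in eh; rewrite mulr0 add0r in ep.
  exact: (rank3_generic q0 b0 F0 r1 r2 r3 erefl s0 excl1 et er eh ep).
have yn : (y 0 ith, y 0 iph) != (0, 0).
  apply/negP => /eqP[yh yp].
  (* For [kk] = 0 the vanishing of sigma(y) means k8 u = 0. Either u = 0 with w = 0, which [excl1]
     forbids, or k8 = k9 = 0, which makes a5 zero. *)
  have [kk0|kk0] := eqVneq (kk x) 0; last by apply: excl2.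
  have kE : K9 x * K10 x = - (K7 x * K8 x) by apply/eqP; rewrite -addr_eq0 addrC -/(kk x) kk0.
  have : K8 x * (K10 x * y 0 it - K7 x * y 0 ir) = 0.
    have -> : K8 x * (K10 x * y 0 it - K7 x * y 0 ir)
      = K10 x * s + y 0 ir * (- (K7 x * K8 x) - K9 x * K10 x) by rewrite /s; ring.
    by rewrite sE kE; ring.
  move=> /eqP; rewrite mulf_eq0 => /orP[|/eqP U0]; last first.
    by apply: excl1; split=> //; rewrite kk0 yh yp; ring.
  move=> /eqP k80; move: kE; rewrite k80 mulr0 oppr0 => /eqP.
  rewrite mulf_eq0 (negbTE q0) orbF => /eqP k90.
  by move: b0; rewrite a5E k80 k90 !mulr0 subrr eqxx.
apply: (has_dim3 (v1 := row4 (K7 x) (K10 x) 0 0) (v2 := y *m Rot x) (v3 := y *m Btr x)) => [v|c1 c2 c3].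
  have E1 : y *m Vth x = y 0 ith *: row4 (K7 x) (K10 x) 0 0.
    by rewrite yVth row4Z sE !mulr0.
  have E2 : y *m Vph x = (y 0 iph * s2 x) *: row4 (K7 x) (K10 x) 0 0.
    by rewrite yVph row4Z sE !mulr0; congr row4; ring.
  rewrite fibE E1 E2; split=> [[c1 [c2 [c3 [c4 ->]]]]|[c1 [c2 [c3 ->]]]].
    exists (c1 * y 0 ith + c2 * (y 0 iph * s2 x)), c3, c4.
    by rewrite !scalerA scalerDl.
  (* The row (k7, k10, 0, 0) is recovered from V_theta if thetadot is nonzero and from V_phi
     otherwise. *)
  have [yh|yh] := eqVneq (y 0 ith) 0; last first.
    exists (c1 / y 0 ith), 0, c2, c3.
    by rewrite !scalerA divfK// mul0r scale0r addr0.
  have yp : y 0 iph * s2 x != 0.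
    rewrite mulf_neq0// ?(gt_eqF z0)//.
    by move: yn; rewrite yh xpair_eqE eqxx.
  exists 0, (c1 / (y 0 iph * s2 x)), c2, c3.
  by rewrite !scalerA divfK// mul0r scale0r add0r.
rewrite yRot yBtr !row4Z !row4D => /row4_eq0[_ er eh ep].
rewrite mulr0 addr0 in er; rewrite mulr0 add0r in eh; rewrite mulr0 add0r mulrN in ep.
exact: (rank3_special q0 b0 z0 yn er eh ep).
Qed.

End SphericalConnection.

(** * Power law metrics *)

Section PowerLaw.
Context {R : realType}.
Local Notation X4 := 'rV[R]_4.
Local Notation TM := (TM4 R).
Variables (M : set X4) (A : set TM) (L : TM -> R) (k : sph_coef R) (lam : R)
  (vth : R -> R -> R).
Local Notation Gam := (sph_connection k).
Hypothesis oM : open M.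
Hypothesis chart : forall x, M x -> in_spherical_chart x.
Hypothesis hL : power_law_berwald M A L k lam vth.
Hypothesis nonriem : ~ pseudo_riemannian A L.

Let FL : pseudo_finsler M A L. Proof. by case: hL => [[]]. Qed.
Let oA : open A. Proof. by case: FL => [[]]. Qed.
Let AM p : A p -> M p.1. Proof. by case: FL => [[_ h _ _] _ _ _] /h[]. Qed.
Let MA x : M x -> exists y, A (x, y). Proof. by case: FL => [[_ _ h _] _ _ _]; exact: h. Qed.

Let MU x : M x -> tr_domain M (x 0 it, x 0 ir). Proof. by move=> Mx; exists x. Qed.

Let Gam_smooth c a b : smooth_on M (fun x => Gam x c a b).
Proof. by case: hL => [[_ _ [[h _] _]] _ _ _ _]; exact: h. Qed.

Let k10_neq0 x : M x -> trf (k10 k) x != 0.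
Proof. by case: hL => [_ [h _ _ _] _ _ _] Mx; exact: h (MU Mx). Qed.

Let relations x : M x -> power_law_relations k (x 0 it) (x 0 ir).
Proof. by case: hL => [_ [_ _ _ h] _ _ _] Mx; exact: h (MU Mx). Qed.

Let D_neq0 x : M x -> cD k (x 0 it) (x 0 ir) != 0.
Proof. by case: hL => [_ _ h _ _] Mx; case: (h _ _ (MU Mx)). Qed.

Let lamE x : M x -> lam = cF k (x 0 it) (x 0 ir) / cD k (x 0 it) (x 0 ir).
Proof. by case: hL => [_ _ h _ _] Mx; case: (h _ _ (MU Mx)). Qed.

Let vth_neq0 x : M x -> trf vth x != 0.
Proof.
case: hL => [_ _ _ [q0 _ h] _] Mx; have [[g1 [g2 gp]] vE] := h _ _ (MU Mx).
by rewrite /trf (vE _ _ gp) gt_eqF// expR_gt0.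
Qed.

Definition Qform x y := v_form k x y + rho k (x 0 it) (x 0 ir) * u_form k x y ^+ 2.

Let LE x y : A (x, y) -> exists P Q : R,
  [/\ real_power (u_form k x y) (2 - 2 * lam) P, real_power (Qform x y) lam Q &
      L (x, y) = trf vth x * P * Q].
Proof. by case: hL => [_ _ _ _ h] /h. Qed.

Lemma wspeed_sqr x (y : X4) :
  wspeed x y ^+ 2 = y 0 ith ^+ 2 + y 0 iph ^+ 2 * sin (x 0 ith) ^+ 2.
Proof.
rewrite sqr_sqrtr//; apply: addr_ge0; first exact: sqr_ge0.
by apply: mulr_ge0; exact: sqr_ge0.
Qed.

(** On an empty [A] every function is quadratic; the non-Riemannian hypothesis thus supplies the
    base point at which the skewness argument is run. *)
Let A_nonempty : exists p, A p.
Proof.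
apply: contrapT => hA; apply: nonriem; exists (fun=> 0) => x y Axy.
by case: hA; exists (x, y).
Qed.

Lemma lam_neq1 : lam != 1.
Proof.
apply/eqP => l1; apply: nonriem.
pose a := trf (ca k); pose b := trf (cb k); pose c := trf (cc k); pose r := trf (rho k).
exists (fun x => trf vth x *: mx4
  [:: [:: r x; b x - r x * a x; 0; 0];
      [:: b x - r x * a x; c x + r x * a x ^+ 2; 0; 0];
      [:: 0; 0; -1; 0]; [:: 0; 0; 0; - sin (x 0 ith) ^+ 2]]) => x y Axy.
have [P [Q [hP hQ ->]]] := LE Axy.
have {}hP : real_power (u_form k x y) 0%:R P.
  by move: hP; rewrite l1 mulr1 subrr.
have {}hQ : real_power (Qform x y) 1%:R Q by move: hQ; rewrite l1.
rewrite (real_power_nat hP) (real_power_nat hQ).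
rewrite expr0 expr1 mulr1 /Qform /v_form /u_form wspeed_sqr.
rewrite -/(trf (ca k) x) -/(trf (cb k) x) -/(trf (cc k) x) -/(trf (rho k) x).
rewrite -/(a x) -/(b x) -/(c x) -/(r x).
rewrite !sum4 !mxE /=; ring.
Qed.

(** With exponent 0 the metric reduces to [vth] u^2, which is quadratic in the velocity as well. *)
Lemma lam_neq0 : lam != 0.
Proof.
apply/eqP => l0; apply: nonriem; pose a := trf (ca k).
exists (fun x => trf vth x *: mx4
  [:: [:: 1; - a x; 0; 0]; [:: - a x; a x ^+ 2; 0; 0];
      [:: 0; 0; 0; 0]; [:: 0; 0; 0; 0]]) => x y Axy.
have [P [Q [hP hQ ->]]] := LE Axy.
have {}hP : real_power (u_form k x y) 2%:R P.
  by move: hP; rewrite l0 mulr0 subr0.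
have {}hQ : real_power (Qform x y) 0%:R Q by move: hQ; rewrite l0.
rewrite (real_power_nat hP) (real_power_nat hQ).
rewrite expr0 mulr1 /u_form -/(trf (ca k) x) -/(a x).
rewrite !sum4 !mxE /=; ring.
Qed.

Lemma a5_nonzero x : M x -> trf (a5 k) x != 0.
Proof.
move=> Mx; apply: contra_neq lam_neq1 => a50.
have D0 := D_neq0 Mx; rewrite (lamE Mx).
have -> : cF k (x 0 it) (x 0 ir) = cD k (x 0 it) (x 0 ir).
  by rewrite /cD -/(trf (a5 k) x) a50 addr0.
by rewrite divff.
Qed.

Lemma F_neq0 x : M x ->
  trf (k7 k) x * trf (a3 k) x - trf (k10 k) x * trf (a1 k) x != 0.
Proof.
move=> Mx; have := lam_neq0; rewrite (lamE Mx); apply: contra_neq => E.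
have q0 := k10_neq0 Mx.
have -> : cF k (x 0 it) (x 0 ir) = 0; last by rewrite mul0r.
apply: (mulfI q0); rewrite mulr0 -E /cF /ca.
rewrite -/(trf (k7 k) x) -/(trf (k10 k) x) -/(trf (a3 k) x) -/(trf (a1 k) x).
by rewrite mulrBr mulrA mulrCA mulfV// mulr1.
Qed.

Lemma L_line x y e : A (x, y) ->
  is_derive (0 : R) 1 (fun h : R => L (x, h *: e + y)) ('D_(0, e) L (x, y)).
Proof.
move=> Axy; have Ls : smooth_on A L by case: FL.
have E0 : 0 *: ((0, e) : TM) + (x, y) = (x, y).
  by apply: injective_projections; rewrite /= ?scaler0 ?scale0r ?add0r.
have := @is_derive_line R _ L (x, y) ((0, e) : TM) 0; rewrite E0.
have -> : (fun s : R => L (s *: ((0, e) : TM) + (x, y))) = (fun h : R => L (x, h *: e + y)).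
  apply/funext => s; congr (L _).
  by apply: injective_projections; rewrite /= ?scaler0 ?add0r.
by apply; exact: smooth_derivable Axy Ls.
Qed.

Lemma near_line x y (e : X4) : A (x, y) -> \forall h \near (0 : R), A (x, h *: e + y).
Proof.
move=> Axy; have [d d0 dS] := nbhs_parallelogram e 0
  (open_nbhs_nbhs (conj (open_slice (x := x) oA) Axy)).
apply: filterS (nbhs0_le d0) => h hd.
by have := dS h 0 hd; rewrite normr0 scale0r add0r; apply; exact: ltW.
Qed.

Lemma u_form_line x (y e : X4) h :
  u_form k x (h *: e + y) = u_form k x y + h * u_form k x e.
Proof. by rewrite /u_form !mxE; ring. Qed.

Lemma null_cone_empty x y : A (x, y) -> u_form k x y = 0 -> v_form k x y = 0 -> False.
Proof.
move=> Axy u0 v0; apply: (finsler_gradient_neq0 FL Axy) => a; rewrite /dotpar.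
move: (evec a) => e.
(* The first derivative of v at y along [e]. Since u and v vanish at y, [Qform] on the line has no
   constant term. *)
pose q1 := 2 * trf (cc k) x * y 0 ir * e 0 ir
  + 2 * trf (cb k) x * (y 0 it * e 0 ir + y 0 ir * e 0 it)
  - 2 * (y 0 ith * e 0 ith + y 0 iph * e 0 iph * sin (x 0 ith) ^+ 2).
have QE h : Qform x (h *: e + y) = h * (q1 + h * Qform x e).
  have vE : v_form k x (h *: e + y) = v_form k x y + h * (q1 + h * v_form k x e).
    by rewrite /v_form !wspeed_sqr /q1 !mxE /trf; ring.
  rewrite /Qform u_form_line u0 vE v0.
  by generalize (v_form k x e) (u_form k x e) q1 => *; ring.
apply: (power_law_flat_null (u1 := u_form k x e) (q1 := q1) (q2 := Qform x e)
  (th := trf vth x) lam_neq0 lam_neq1 (L_line e Axy)).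
near=> h; have Ah : A (x, h *: e + y) by near: h; exact: near_line.
have [P [Q [hP hQ E]]] := LE Ah; exists P, Q; split=> //.
  by move: hP; rewrite u_form_line u0 add0r.
by move: hQ; rewrite QE.
Unshelve. all: by end_near. Qed.

Definition kap x := 2 * trf (ca k) x * trf (cb k) x + trf (cc k) x.

Lemma kapE x : M x -> kk k x = trf (k10 k) x ^+ 2 * kap x.
Proof.
move=> /k10_neq0; rewrite /kk /kap /trf /ca /cb /cc => q0.
by field.
Qed.

(** If [kap] is nonzero, the first two relations give a a3 + a4 = a5 and the third becomes b D =
    [kap] a3. This value of rho completes the square in v + rho u^2. *)
Lemma rho_cone x : M x -> kap x != 0 -> trf (rho k) x = trf (cb k) x ^+ 2 / kap x.
Proof.
move=> Mx kap0; have [r1 r2 r3 _ _] := relations Mx; have := D_neq0 Mx.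
move: r1 r2 r3 kap0; rewrite /kap /rho /cE /cD /trf.
move: (ca k _ _) (cb k _ _) (cc k _ _) (a1 k _ _) (a2 k _ _) (a3 k _ _) (a4 k _ _) (a5 k _ _).
move=> a b c y1 y2 y3 y4 y5 r1 r2 r3 kap0 D0.
have p5 : (a * y3 + y4) = y5.
  apply: (mulfI kap0); apply/eqP; rewrite -subr_eq0 -r1; apply/eqP.
  have -> : a * y1 + y2 = a * (a * y3 + y4) by apply/eqP; rewrite eq_sym -subr_eq0 r2.
  ring.
have bD : b * (a * y3 - y1 + y5) = (2 * a * b + c) * y3.
  rewrite p5 in r3; apply/eqP; rewrite -subr_eq0 -oppr_eq0 -r3; apply/eqP; ring.
apply: (mulIf kap0); rewrite divfK// mulrAC; apply: (mulIf D0); rewrite divfK//.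
by rewrite expr2 -[RHS]mulrA bD; ring.
Qed.

(** Where sigma and w vanish, v + rho u^2 has no linear term in any direction. Its theta coefficient
    is nonzero, which bounds the exponent; all first derivatives of L then vanish. *)
Lemma cone_axis_empty x y : A (x, y) -> kk k x != 0 ->
  y 0 it * trf (k8 k) x + y 0 ir * trf (k9 k) x = 0 ->
  y 0 ith = 0 -> y 0 iph = 0 -> False.
Proof.
move=> Axy kk0 s0 yh yp; have Mx : M x := AM Axy.
have q0 := k10_neq0 Mx.
have kap0 : kap x != 0 by move: kk0; rewrite kapE// mulf_eq0 negb_or => /andP[].
(* This is sigma / k10, and v + rho u^2 = [sig]^2 / [kap] - w^2. *)
pose sig (z : X4) := trf (cb k) x * z 0 it
  + (trf (ca k) x * trf (cb k) x + trf (cc k) x) * z 0 ir.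
have sig0 : sig y = 0.
  apply: (mulfI q0); rewrite mulr0 -s0 /sig /trf /ca /cb /cc.
  by move: q0; rewrite /trf => q0; field.
have QE z : Qform x z = sig z ^+ 2 / kap x
    - (z 0 ith ^+ 2 + z 0 iph ^+ 2 * sin (x 0 ith) ^+ 2).
  rewrite /Qform /v_form wspeed_sqr -/(trf (rho k) x) rho_cone// /u_form /sig /kap.
  move: kap0; rewrite /kap /trf => kap0; by field.
pose q (e : X4) := Qform x e.
have QL e h : Qform x (h *: e + y) = q e * h ^+ 2.
  have -> : q e * h ^+ 2 = (h * sig e + sig y) ^+ 2 / kap x
      - ((h * e 0 ith) ^+ 2 + (h * e 0 iph) ^+ 2 * sin (x 0 ith) ^+ 2).
    by rewrite /q QE sig0; ring.
  by rewrite QE /sig !mxE yh yp !addr0; congr (_ ^+ 2 / _ - _); ring.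
have u0 : u_form k x y != 0.
  apply/eqP => u0; apply: (null_cone_empty Axy u0).
  have := QL 0 0; rewrite scale0r add0r expr0n mulr0 /Qform u0.
  by rewrite expr0n mulr0 addr0.
have formula e : \forall h \near 0, exists P Q,
   [/\ real_power (u_form k x y + h * u_form k x e) (2 - 2 * lam) P,
       real_power (q e * h ^+ 2) lam Q & L (x, h *: e + y) = trf vth x * P * Q].
  near=> h; have Ah : A (x, h *: e + y) by near: h; exact: near_line.
  have [P [Q [hP hQ E]]] := LE Ah; exists P, Q; split=> //.
    by move: hP; rewrite u_form_line.
  by move: hQ; rewrite QL.
(* The direction theta only changes w, so it detects the exponent independently of the sign of
   [kap]. *)
have qth : q (evec ith) != 0.
  have -> : q (evec ith) = -1 by rewrite /q QE /sig !mxE /=; ring.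
  by rewrite oppr_eq0 oner_eq0.
have l1 := power_law_cone_exponent u0 lam_neq0 qth (vth_neq0 Mx)
  (L_line (evec ith) Axy) (formula (evec ith)).
apply: (finsler_gradient_neq0 FL Axy) => a.
exact: power_law_cone_null u0 l1 (L_line (evec a) Axy) (formula (evec a)).
Unshelve. all: by end_near. Qed.

Lemma hol_vertical_dim p : A p ->
  has_dim (vertical_part (hol_distribution Gam p)) 3.
Proof.
move=> Ap; have Mx := AM Ap.
case: hL => [_ [_ prop_t prop_r _] _ _ _].
apply: (hol_dim3 oM chart Gam_smooth k10_neq0 relations oA MA a5_nonzero prop_t prop_r Mx).
- exact: F_neq0.
- case: p Ap Mx => x y /= Axy Mx [U0 kE]; have q0 := k10_neq0 Mx.
  have u0 : u_form k x y = 0.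
    apply: (mulfI q0); rewrite mulr0 -U0 /u_form /ca -/(trf (k7 k) x) -/(trf (k10 k) x).
    by rewrite mulrBr mulrA [trf (k10 k) x * (_ / _)]mulrC divfK.
  apply: (null_cone_empty Axy u0).
  (* On u = 0 the form v is [kap] rdot^2 - w^2, so the equation for [kk] says v = 0. *)
  have ytE : y 0 it = trf (ca k) x * y 0 ir by apply/eqP; rewrite -subr_eq0 -u0.
  apply: (mulfI (expf_neq0 2 q0)); rewrite mulr0.
  rewrite /v_form wspeed_sqr -/(trf (cc k) x) -/(trf (cb k) x) ytE mulrBr.
  rewrite -[_ + y 0 iph ^+ 2 * sin (x 0 ith) ^+ 2]/(y 0 ith ^+ 2 + y 0 iph ^+ 2 * thf sin2 x).
  by rewrite -kE kapE// /kap; ring.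
- case: p Ap Mx => x y /= Axy Mx [kk0 s0 yh yp].
  exact: (cone_axis_empty Axy kk0 s0 yh yp).
Qed.

(** The theta component of the bracket is a5 thetadot, and the open fibre of [A] contains a vector
    with thetadot nonzero. *)
Lemma bracket_not_in_span x : M x ->
  ~ (forall y, A (x, y) -> lspan [set ((0, evec it) : TM); (0, evec ir)]
      (bracket (delta Gam it) (delta Gam ir) (x, y))).
Proof.
move=> Mx h; have [y Axy y0] := slice_coord_neq0 oA MA ith Mx.
have [n [c [s [sS E]]]] := h y Axy.
have z0 : (\sum_(i < n) c i *: s i).2 0 ith = 0.
  apply: (big_ind (fun q : TM => q.2 0 ith = 0)) => [|q1 q2 E1 E2|i _].
  - by rewrite mxE.
  - by rewrite /= mxE E1 E2 addr0.
  - by rewrite /= mxE; case: (sS i) => ->; rewrite mxE /= mulr0.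
move: z0; rewrite -E (bracket_tr (p := (x, y)) Gam_smooth k10_neq0 relations Mx) /= mxE sum4 !mxE /=.
rewrite !mulr0 !add0r addr0 => /eqP.
by rewrite mulf_eq0 (negbTE y0) (negbTE (a5_nonzero Mx)).
Qed.

(** Affine equivalence provides some common connection, which must be identified with the spherical
    one: torsion-free connections with equal sprays on an open fibre agree by polarization. *)
Lemma canonical_connection_unique (A' : set TM) (L' : TM -> R) (G1 G2 : @christoffel R) :
  open A' -> (forall x, M x -> exists y, A' (x, y)) ->
  canonical_connection M A' L' G1 -> canonical_connection M A' L' G2 ->
  forall x c a b, M x -> G1 x c a b = G2 x c a b.
Proof.
move=> oA' MA' [[_ s1] E1] [[_ s2] E2] x c a b Mx; have [y0 Ay0] := MA' x Mx.
pose T : 'M[R]_4 := \matrix_(a, b) (G1 x c a b - G2 x c a b).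
have TE i j : T i j = G1 x c i j - G2 x c i j by rewrite mxE.
have T0 y : A' (x, y) -> qform y T = 0.
  move=> Ay; have := E1 x y c Ay; rewrite (E2 x y c Ay) => E.
  rewrite qformE; under eq_bigr do under eq_bigr do rewrite TE !mulrBl.
  by under eq_bigr do rewrite sumrB; rewrite sumrB E subrr.
have := quad_zero (open_slice (x := x) oA') Ay0 T0.
move=> /matrixP/(_ a b); rewrite [LHS]mxE [T^T _ _]mxE [RHS]mxE !TE.
by rewrite (s1 x c b a Mx) (s2 x c b a Mx) => E; lra.
Qed.

Lemma no_riemannian_equivalent (A' : set TM) (L' : TM -> R) :
  pseudo_finsler M A' L' -> pseudo_riemannian A' L' ->
  ~ affinely_equivalent M A L A' L'.
Proof.
move=> FL' [g L'g] [G [cL cL']].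
have [p Ap] := A_nonempty; have Mx := AM Ap; move: (p.1) Mx => x Mx.
have cGam : canonical_connection M A L Gam by case: hL => [[]].
have GE := canonical_connection_unique oA MA cL cGam.
have Gam_sym z c a b : M z -> Gam z c a b = Gam z c b a.
  by case: cGam => [[_ h] _]; exact: h.
have spr z y c : A' (z, y) ->
    2 * spray L' c (z, y) = \sum_a \sum_b Gam z c a b * y 0 a * y 0 b.
  move=> Ay; case: cL' => _ h; rewrite h//.
  apply: eq_bigr => a _; apply: eq_bigr => b _; rewrite GE//.
  by case: FL' => [[_ h' _ _] _ _ _]; case: (h' _ Ay).
have skew a b := curv_skew oM FL' L'g Gam_smooth Gam_sym spr a b Mx.
have Hu := metric_unit FL' L'g Mx.
move: skew Hu; move: (metric_mx g x) => H skew Hu.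
have q0 := k10_neq0 Mx.
have Hth : H ith ith = 0.
  have := skew it ir; rewrite (curv_tr k10_neq0 relations Mx) => /matrixP/(_ ith ith).
  rewrite !mxE sum4 !mxE /= !mul0r !add0r addr0 => /eqP.
  by rewrite -mulr2n mulrn_eq0 /= mulf_eq0 (negbTE (a5_nonzero Mx)) => /eqP.
have VH : Vth k x *m H + (Vth k x *m H)^T = 0.
  have scaled m : m != 0 -> (m *: Vth k x) *m H + ((m *: Vth k x) *m H)^T = 0 ->
      Vth k x *m H + (Vth k x *m H)^T = 0.
    move=> m0; rewrite -scalemxAl linearZ /= -scalerDr => /eqP.
    by rewrite scaler_eq0 (negbTE m0) => /eqP.
  have /orP[m0|m0] := m7_m11_neq0 k10_neq0 relations a5_nonzero Mx; apply: (scaled _ m0).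
    by rewrite -(curv_t_th k10_neq0 relations Mx).
  by rewrite -(curv_r_th k10_neq0 relations Mx).
(* The theta row of [Vth], nonzero as k10 is; showing that H kills it contradicts invertibility. *)
pose z := row4 (trf (k7 k) x) (trf (k10 k) x) 0 0.
have zj j : (z *m H) 0 j = (Vth k x *m H) ith j.
  by rewrite !mxE !sum4 !mxE.
have zH : z *m H = 0.
  apply/rowP => j; rewrite zj [RHS]mxE; move/matrixP/(_ ith): VH => VH.
  have VHj i : (Vth k x *m H) ith i + (Vth k x *m H) i ith = 0.
    by have := VH i; rewrite [LHS]mxE [_^T _ _]mxE [RHS]mxE.
  (* Off its theta row [Vth] is supported in the theta column, so these entries are multiples of the
     vanishing theta-theta entry of H. *)
  have col i : i != ith -> (Vth k x *m H) i ith = 0.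
    move: i; apply: forall_ord4 => // _; rewrite !mxE sum4 !mxE /= Hth.
    - by ring.
    - by ring.
    - by ring.
  have [->|jn] := eqVneq j ith; last by have := VHj j; rewrite (col j jn) addr0.
  by have /eqP := VHj ith; rewrite -mulr2n mulrn_eq0 => /eqP.
have z0 : z = 0 by rewrite -(mulmxK Hu z) zH mul0mx.
by have [_ /eqP] := row4_eq0 z0; rewrite (negbTE q0).
Qed.

End PowerLaw.

Theorem proposition6 (R : realType) (M : set 'rV[R]_4) (A : set (TM4 R))
    (L : TM4 R -> R) (k : sph_coef R) (lam : R) (vth : R -> R -> R)
    (hMopen : open M)
    (hMchart : forall x, M x -> in_spherical_chart x)
    (hL : power_law_berwald M A L k lam vth)
    (hnonriem : ~ pseudo_riemannian A L) :
  [/\ (* 1 *)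
      forall x, M x ->
        a5 k (x 0 it) (x 0 ir) != 0 /\
        (a5 k (x 0 it) (x 0 ir) != 0 <->
         ~ (forall y, A (x, y) ->
              lspan [set ((0, evec it) : TM4 R); (0, evec ir)]
                (bracket (delta (sph_connection k) it)
                         (delta (sph_connection k) ir) (x, y)))),
      (* 2 *)
      forall p, A p ->
        has_dim (vertical_part (hol_distribution (sph_connection k) p)) 3 &
      (* 3 *)
      ~ (exists (A' : set (TM4 R)) (L' : TM4 R -> R),
           [/\ pseudo_finsler M A' L', pseudo_riemannian A' L' &
               affinely_equivalent M A L A' L'])].
Proof.
split.
- move=> x Mx; have a50 := a5_nonzero hL hnonriem Mx.
  (* Both sides of the equivalence hold outright. *)
  by split=> //; split=> // _; exact: (bracket_not_in_span hL hnonriem Mx).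
- by move=> p Ap; exact: (hol_vertical_dim hMopen hMchart hL hnonriem Ap).
- move=> [A' [L' [FL' RL' aff]]].
  exact: (no_riemannian_equivalent hMopen hL hnonriem FL' RL' aff).
Qed.
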